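(* Let $\theta_1,\theta_2,\ldots$ be i.i.d. with law $\rho$. Let $S_M=\sum_{m=1}^M\zeta_{\theta_m}\otimes\zeta_{\theta_m}$, acting on $H=L^2(\mu)$, and let $\lambda_1(G)\ge\lambda_2(G)\ge\cdots$ denote the eigenvalues of the $M\times M$ Gram matrix $G$, padded by zeros for $j>M$. Let $\varepsilon_{\rm op}\in(0,1)$ and $\delta\in(0,1)$. If $$M\ge\frac{R_\zeta\,\mathrm{tr}(\mathcal T)}{\delta\,\varepsilon_{\rm op}^2\,\tau_1^2}=\frac{R_\zeta\,\widetilde d}{\delta\,\varepsilon_{\rm op}^2\,\tau_1},$$ then, with probability at least $1-\delta$ over the random-feature realization, $$\|M^{-1}S_M-\mathcal T\|_2\le\varepsilon_{\rm op}\tau_1\qquad\text{and}\qquad\sup_{j\ge1}|\lambda_j(G)/M-\tau_j|\le\varepsilon_{\rm op}\tau_1.$$ In particular, as $M\to\infty$, $M^{-1}S_M$ converges to $\mathcal T$ in operator norm almost surely, and the normalized spectrum of $G$ converges uniformly to that of $\mathcal T$, i.e. $\sup_{j\ge1}|\lambda_j(G)/M-\tau_j|\to0$ almost surely.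
   Context: Let $\Omega\subset\mathbb{R}^d$ be a bounded domain with a reference probability measure $\mu$, $L$ a linear differential operator, and $H=L^2(\mu)$ with inner product $\langle\cdot,\cdot\rangle_H$. Random features are $\varphi(\mathbf{x};\theta)=\sigma(w\cdot\mathbf{x}+b_\theta)$ with activation function $\sigma$ and parameter $\theta=(w,b_\theta)\in\mathbb{R}^d\times\mathbb{R}$ drawn from a law $\rho$. Write $\zeta_\theta(\mathbf{x})=(L\varphi)(\mathbf{x};\theta)$; for i.i.d. $\theta_m\sim\rho$ the residual features $\zeta_{\theta_m}$ are i.i.d. random fields. Standing assumptions: $\rho$ has bounded support; the required derivatives of $\sigma$ are bounded on the corresponding compact affine image of $\Omega$; and $$R_\zeta:=\sup_{\theta\in\operatorname{supp}(\rho)}\|\zeta_\theta\|_H^2<\infty.$$ The residual kernel and its integral operator on $H$ are $$k_L(\mathbf{x},\mathbf{x}')=\mathbb{E}_\theta[\zeta_\theta(\mathbf{x})\zeta_\theta(\mathbf{x}')],\qquad(\mathcal T v)(\mathbf{x})=\int_\Omega k_L(\mathbf{x},\mathbf{x}')v(\mathbf{x}')\,d\mu(\mathbf{x}').$$ $\mathcal T$ is self-adjoint, positive semidefinite and trace-class with $\mathrm{tr}(\mathcal T)=\mathbb{E}_\theta\|\zeta_\theta\|_H^2\le R_\zeta$; its eigenvalues are $\tau_1\ge\tau_2\ge\cdots\ge0$ (counted with multiplicity, padded by zeros if necessary). Assume $\mathcal T\neq0$ and set $\widetilde d=\mathrm{tr}(\mathcal T)/\tau_1$. For $h_1,h_2\in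 H$, $(h_1\otimes h_2)v=\langle h_2,v\rangle_H h_1$. The Gram matrix of the realized features is $G\in\mathbb{R}^{M\times M}$ with $G_{ml}=\langle\zeta_{\theta_m},\zeta_{\theta_l}\rangle_H=\mathbb{E}_{\mathbf{x}\sim\mu}[\zeta_{\theta_m}(\mathbf{x})\zeta_{\theta_l}(\mathbf{x})]$. $\|\cdot\|_2$ is the operator norm on $H$. *)

(* Defs.v *)
From HB Require Import structures.
From mathcomp Require Import all_boot all_order all_algebra.
From mathcomp Require Import all_classical all_reals all_analysis.

Set Implicit Arguments.
Unset Strict Implicit.
Unset Printing Implicit Defensive.

Import Order.TTheory GRing.Theory Num.Theory.
Import numFieldNormedType.Exports.

Local Open Scope classical_set_scope.
Local Open Scope ring_scope.

(* R^n and the parameter space R^n x R with their Borel sigma-algebras *)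
Notation borelType T := (g_sigma_algebraType (@open T)).
Notation x_space R n := (borelType 'rV[R]_n).
Notation theta_space R n := (borelType ('rV[R]_n * R)%type).

(* An element of L^2(mu) is represented by a function [f \in Lfun mu 2],      *)
(* two such functions being identified when they agree mu-almost everywhere.  *)
(* An operator on L^2(mu) is represented by a map on functions; all operators *)
(* used below respect almost everywhere equality.                             *)
Section L2.
Context {d : measure_display} {X : measurableType d} {R : realType}.
Variable mu : {measure set X -> \bar R}.
Implicit Types (f g v h : X -> R) (A : (X -> R) -> X -> R).

Definition L2 : set (X -> R) := [set f | f \in Lfun mu 2%:E].

Definition L2norm f : \bar R := 'N[mu]_2%:E[EFin \o f].

Definition L2inner f g : R := \int[mu]_x (f x * g x).

Definition tensor h1 h2 : (X -> R) -> X -> R :=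
  fun v x => L2inner h2 v * h1 x.

Definition opnorm A : \bar R :=
  ereal_sup [set L2norm (A v) | v in [set v | L2 v /\ (L2norm v <= 1)%E]].

Definition hilbert_basis (B : set (X -> R)) : Prop :=
  [/\ B `<=` L2,
      forall e, B e -> L2inner e e = 1,
      forall e e', B e -> B e' -> e <> e' -> L2inner e e' = 0 &
      forall v (eps : R), L2 v -> 0 < eps ->
        exists n (e : 'I_n -> X -> R) (c : 'I_n -> R),
          (forall i, B (e i)) /\
          (L2norm (fun x => v x - \sum_i c i * e i x)%R < eps%:E)%E].

(* [esum] is the unordered sum of nonnegative terms, so this is meant for     *)
(* positive semidefinite [A], for which the sum does not depend on [B].       *)
Definition is_trace A (t : R) : Prop :=
  exists2 B, hilbert_basis B &
    \esum_(e in B) (L2inner (A e) e)%:E = t%:E.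

(* dim ker (A - lambda) = n *)
Definition eigen_multiplicity A (lambda : R) (n : nat) : Prop :=
  exists e : 'I_n -> X -> R,
    [/\ forall i, L2 (e i),
        forall i, A (e i) = (fun x => lambda * e i x) %[ae mu],
        forall c : 'I_n -> R,
          (fun x => \sum_i c i * e i x) = (fun=> 0) %[ae mu] ->
          forall i, c i = 0 &
        forall v, L2 v -> A v = (fun x => lambda * v x) %[ae mu] ->
          exists c : 'I_n -> R,
            v = (fun x => \sum_i c i * e i x) %[ae mu]].

(* [tau] lists the eigenvalues of the positive semidefinite compact operator  *)
(* [A] in nonincreasing order: every nonzero real number occurs as many times *)
(* as its multiplicity as an eigenvalue, and the list is padded by zeros.     *)
Definition eigenvalue_seq A (tau : nat -> R) : Prop :=
  [/\ nonincreasing_seq tau,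
      forall j, 0 <= tau j &
      forall lambda : R, lambda != 0 ->
        exists2 n, eigen_multiplicity A lambda n &
                   ([set j | tau j = lambda] #= `I_n)%card].

End L2.

(* Eigenvalues with multiplicity, in nonincreasing order, of a square matrix  *)
(* whose characteristic polynomial splits over [R] (e.g. a symmetric one).    *)
Definition eigenvalues (R : realType) (n : nat) (A : 'M[R]_n) : seq R :=
  xget [::] [set s | sorted >=%R s /\
                     char_poly A = \prod_(a <- s) ('X - a%:P)].

(* padded by zeros for n <= j; the index [j] starts from 0 *)
Definition eigenvalue_nth (R : realType) (n : nat) (A : 'M[R]_n) (j : nat) : R :=
  nth 0 (eigenvalues A) j.

Section DifferentialOperators.
Context {R : realType} {n : nat}.

Definition partial (i : 'I_n) (u : 'rV[R]_n -> R) : 'rV[R]_n -> R :=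
  fun x => 'D_(delta_mx 0 i) u x.

Definition mpartial (p : nat) (alpha : {ffun 'I_n -> 'I_p.+1})
    (u : 'rV[R]_n -> R) : 'rV[R]_n -> R :=
  foldr (fun i f => iter (alpha i) (partial i) f) u (enum 'I_n).

End DifferentialOperators.

(* u |-> \sum_(|alpha| <= p) a_alpha * d^alpha u; the coefficients attached   *)
(* to multi-indices with |alpha| > p are ignored.                             *)
Record diffop (R : realType) (n : nat) := DiffOp {
  dop_order : nat ;
  dop_coef : {ffun 'I_n -> 'I_dop_order.+1} -> 'rV[R]_n -> R }.

Definition dop_apply (R : realType) (n : nat) (L : diffop R n)
    (u : 'rV[R]_n -> R) : 'rV[R]_n -> R :=
  fun x => \sum_(alpha : {ffun 'I_n -> 'I_(dop_order L).+1}
                   | (\sum_i alpha i <= dop_order L)%N)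
             dop_coef alpha x * mpartial alpha u x.

Definition measurable_coefficients (R : realType) (n : nat) (L : diffop R n)
    (Omega : set (x_space R n)) : Prop :=
  forall alpha : {ffun 'I_n -> 'I_(dop_order L).+1},
    (\sum_i alpha i <= dop_order L)%N ->
    measurable_fun Omega (dop_coef alpha).

Section RandomFeatures.
Context {R : realType} {n : nat}.
Notation Rn := 'rV[R]_n.
Implicit Types (theta : Rn * R) (x : Rn) (Omega : set Rn).

Definition affine theta x : R :=
  \sum_i theta.1 0 i * x 0 i + theta.2.

Definition feature (sigma : R -> R) theta x : R := sigma (affine theta x).

(* The features live on [Omega], which carries the whole mass of the reference *)
(* measure; they are extended by 0 so as to be functions on R^n.              *)
Definition residual Omega (L : diffop R n) (sigma : R -> R) :
    theta_space R n -> x_space R n -> R :=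
  fun theta => dop_apply L (feature sigma theta) \_ Omega.

Definition bounded_domain Omega : Prop :=
  [/\ open Omega, connected Omega, Omega !=set0 & bounded_set Omega].

Definition law_support (rho : probability (theta_space R n) R) : set (Rn * R) :=
  [set theta | forall U : set (Rn * R), open U -> U theta -> (0 < rho U)%E].

Definition affine_image Omega (S : set (Rn * R)) : set R :=
  [set t | exists theta x, [/\ S theta, closure Omega x & t = affine theta x]].

Definition bounded_derivatives (sigma : R -> R) (p : nat) (K : set R) : Prop :=
  (forall k t, (k < p)%N -> K t -> derivable (derive1n k sigma) t 1) /\
  (exists C : R, forall k t, (k <= p)%N -> K t -> `|derive1n k sigma t| <= C).

End RandomFeatures.

Section ResidualOperators.
Context {d d' : measure_display} {X : measurableType d} {Th : measurableType d'}.
Context {R : realType}.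
Variables (mu : {measure set X -> \bar R}) (zeta : Th -> X -> R).

Definition mean_kernel (rho : probability Th R) (x x' : X) : R :=
  fine 'E_rho[fun theta => zeta theta x * zeta theta x'].

Definition integral_operator (Omega : set X) (k : X -> X -> R)
    (v : X -> R) (x : X) : R :=
  \int[mu]_(x' in Omega) (k x x' * v x').

Definition sup_sqnorm (S : set Th) : \bar R :=
  ereal_sup [set (L2norm mu (zeta theta) ^+ 2)%E | theta in S].

Definition tensor_sum (theta : nat -> Th) (M : nat) (v : X -> R) (x : X) : R :=
  \sum_(m < M) tensor mu (zeta (theta m)) (zeta (theta m)) v x.

Definition gram (theta : nat -> Th) (M : nat) : 'M[R]_M :=
  \matrix_(m, l) L2inner mu (zeta (theta m)) (zeta (theta l)).

Definition operator_error (T : (X -> R) -> X -> R) (theta : nat -> Th)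
    (M : nat) : \bar R :=
  opnorm mu (fun v x => M%:R^-1 * tensor_sum theta M v x - T v x).

Definition spectral_error (tau : nat -> R) (theta : nat -> Th)
    (M : nat) : \bar R :=
  ereal_sup
    [set `|eigenvalue_nth (gram theta M) j / M%:R - tau j|%:E | j in [set: nat]].

End ResidualOperators.

Section IID.
Context {d d' : measure_display} {W : measurableType d} {Th : measurableType d'}.
Context {R : realType}.
Variables (P : probability W R) (theta : nat -> {RV P >-> Th}).

Definition mutually_independent : Prop :=
  forall (J : seq nat) (B : nat -> set Th), uniq J ->
    (forall m, measurable (B m)) ->
    P (\bigcap_(m in [set` J]) theta m @^-1` B m) =
      (\prod_(m <- J) P (theta m @^-1` B m))%E.

Definition iid_with_law (rho : probability Th R) : Prop :=
  mutually_independent /\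
  forall m (B : set Th), measurable B -> distribution P (theta m) B = rho B.

End IID.

(* Main.v *)
Require Import Defs.
From HB Require Import structures.
From mathcomp Require Import all_boot all_order all_algebra.
From mathcomp Require Import all_classical all_reals all_analysis.
From mathcomp Require Import measurable_realfun.
From mathcomp Require Import ring lra zify.

Set Implicit Arguments.
Unset Strict Implicit.
Unset Printing Implicit Defensive.

Import Order.TTheory GRing.Theory Num.Theory.
Import numFieldNormedType.Exports.

Local Open Scope classical_set_scope.
Local Open Scope ring_scope.

(** Write Z_theta for the residual feature of theta, C for the largest squared
    norm R_zeta, and A_M for the sampling error S_M / M - T.  The operator A_M
    is the integral operator with kernel K_M, the average of the M centered
    kernels Z_m(x) Z_m(x') - k_L(x, x').  Hence its operator norm is at most the
    Hilbert-Schmidt norm, that is, the norm of K_M in L^2(mu x mu); the square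
    D_M of that norm is called [sample_error] ([sample_diff_le]).  Expanding D_M
    gives M^-2 times the sum of all covariances of the centered kernels.
    Independence makes the mean of each off-diagonal one vanish, so that
    E D_M <= C E|Z|^2 / M <= C tr(T) / M ([sample_error_mean], [trace_bound]).
    Markov's inequality at the level (eps tau_1)^2 then is the stated bound on M
    ([error_concentration]).

    The nonzero eigenvalues of the Gram matrix are those of S_M, and the forms
    of S_M / M and T differ by at most sqrt(D_M) |v|^2; Weyl's inequality
    therefore bounds every difference of eigenvalues by sqrt(D_M)
    ([spectral_error_le]).

    For the almost sure statements, E D_(n^2) is of order n^-2, so the sum of
    the D_(n^2) has a finite mean and D_(n^2) tends to 0 almost surely.  Between
    two consecutive squares bounded vectors change the average only by a term of
    order 1/n, and D_M tends to 0 along all M ([sample_error_cvg0]).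

    Three facts carry these steps.

    Eigenvalues of T are given through the dimensions of the eigenspaces,
    whereas Weyl's inequality needs their variational form.  The passage is the
    spectral theorem for compact positive operators: tau is realized by
    orthonormal eigenvectors, and on the complement of the first j of them the
    form is at most tau_j |v|^2, since otherwise a maximizer of the form there
    would be one eigenvector too many ([max_eigenvector],
    [eigenvalue_seq_diagonalizes]).

    Compactness of T and E|Z|^2 <= tr(T) rest on the density in L^2(rho x mu) of
    the finite sums of functions 1_A(theta) e(x) with e in an orthonormal basis:
    up to a small mean square error, Z takes its values in the span of finitely
    many basis functions ([approximable_L2], [finite_parseval]).

    All exchanges of integrals need a field that is jointly measurable in
    (theta, x).  The residual is defined with directional derivatives, but for
    theta = (w, b) in the support of rho these are the functions
    w^alpha sigma^(|alpha|)(w.x + b), and when w is nonzero the point w.x + b is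
    interior to the set on which sigma is differentiable, so that the derivative
    is a limit of difference quotients.  This yields a measurable field that
    agrees with the residual on the support of rho, a set of full measure
    ([regular_residualE], [regular_residualP], [law_support_null]). *)

(** * Semi-inner products *)

Section SemiInner.
Context {R : realType} {H : lmodType R}.
Variable ip : H -> H -> R.

Definition semi_inner : Prop :=
  [/\ forall u v, ip u v = ip v u,
      forall a u v w, ip (a *: u + v) w = a * ip u w + ip v w &
      forall u, 0 <= ip u u].

Hypothesis ipP : semi_inner.

Lemma ipC u v : ip u v = ip v u. Proof. by case: ipP. Qed.
Lemma ip_ge0 u : 0 <= ip u u. Proof. by case: ipP. Qed.
Lemma ipL a u v w : ip (a *: u + v) w = a * ip u w + ip v w.
Proof. by case: ipP. Qed.
Lemma ipDl u v w : ip (u + v) w = ip u w + ip v w.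
Proof. by rewrite -[u in LHS]scale1r ipL mul1r. Qed.
Lemma ip0l w : ip 0 w = 0.
Proof. by have := ipDl 0 0 w; rewrite addr0; lra. Qed.
Lemma ipZl a u w : ip (a *: u) w = a * ip u w.
Proof. by rewrite -[a *: u]addr0 ipL ip0l addr0. Qed.
Lemma ipNl u w : ip (- u) w = - ip u w.
Proof. by rewrite -scaleN1r ipZl mulN1r. Qed.
Lemma ipBl u v w : ip (u - v) w = ip u w - ip v w.
Proof. by rewrite ipDl ipNl. Qed.
Lemma ip_suml (I : Type) (r : seq I) (P : pred I) (F : I -> H) w :
  ip (\sum_(i <- r | P i) F i) w = \sum_(i <- r | P i) ip (F i) w.
Proof. by apply: (big_morph (fun u => ip u w)) => [u v|]; rewrite ?ipDl ?ip0l. Qed.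
Lemma ipDr u v w : ip w (u + v) = ip w u + ip w v.
Proof. by rewrite !(ipC w) ipDl. Qed.
Lemma ipZr a u w : ip w (a *: u) = a * ip w u.
Proof. by rewrite !(ipC w) ipZl. Qed.
Lemma ip0r w : ip w 0 = 0.
Proof. by rewrite ipC ip0l. Qed.
Lemma ipBr u v w : ip w (u - v) = ip w u - ip w v.
Proof. by rewrite !(ipC w) ipBl. Qed.
Lemma ip_sumr (I : Type) (r : seq I) (P : pred I) (F : I -> H) w :
  ip w (\sum_(i <- r | P i) F i) = \sum_(i <- r | P i) ip w (F i).
Proof. by rewrite ipC ip_suml; apply: eq_bigr => i _; rewrite ipC. Qed.

Lemma ip_sqrB u v : ip (u - v) (u - v) = ip u u - 2 * ip u v + ip v v.
Proof. by rewrite !(ipBl, ipBr) (ipC v u); ring. Qed.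
Lemma ip_sqrD u v : ip (u + v) (u + v) = ip u u + 2 * ip u v + ip v v.
Proof. by rewrite !(ipDl, ipDr) (ipC v u); ring. Qed.
Lemma ip_sqrD_le u v : ip (u + v) (u + v) <= 2 * ip u u + 2 * ip v v.
Proof. by have := ip_ge0 (u - v); rewrite ip_sqrB ip_sqrD; lra. Qed.

End SemiInner.

Lemma discr_le (R : realFieldType) (a b c : R) :
  0 <= a -> (forall t, 0 <= a * t ^+ 2 + 2 * b * t + c) -> b ^+ 2 <= a * c.
Proof.
move=> a0 h; have [a_eq0|an0] := eqVneq a 0.
  move: h; rewrite a_eq0 => h.
  have [->|b0] := eqVneq b 0; first by rewrite expr0n mul0r.
  have := h (- (c + 1) / (2 * b)).
  have -> : 0 * (- (c + 1) / (2 * b)) ^+ 2 + 2 * b * (- (c + 1) / (2 * b)) + c = -1.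
    by field.
  by rewrite ler0N1.
have agt0 : 0 < a by rewrite lt_neqAle eq_sym an0.
have := h (- b / a).
have -> : a * (- b / a) ^+ 2 + 2 * b * (- b / a) + c = (a * c - b ^+ 2) / a by field.
by rewrite pmulr_lge0 ?invr_gt0// subr_ge0.
Qed.

Section SemiInnerTheory.
Context {R : realType} {H : lmodType R}.
Variable ip : H -> H -> R.
Hypothesis ipP : semi_inner ip.

Let C := ipC ipP.

Lemma cauchy_schwarz u v : ip u v ^+ 2 <= ip u u * ip v v.
Proof.
apply: discr_le; first exact: (ip_ge0 ipP).
move=> t; have := ip_ge0 ipP (t *: u + v).
rewrite (ip_sqrD ipP) !(ipZl ipP, ipZr ipP); set x := ip u u; set y := ip u v.
by move=> h; apply: le_trans h _; rewrite le_eqVlt; apply/orP; left; apply/eqP; ring.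
Qed.

Lemma ip_null u v : ip u u = 0 -> ip u v = 0.
Proof.
move=> u0; have := cauchy_schwarz u v; rewrite u0 mul0r => h.
by apply/eqP; rewrite -sqrf_eq0 eq_le h sqr_ge0.
Qed.

Lemma ip_sum_sum n (c : 'I_n -> R) (e : 'I_n -> H) (k : 'I_n -> R) :
  (forall i j, ip (e i) (e j) = (i == j)%:R * k i) ->
  ip (\sum_i c i *: e i) (\sum_i c i *: e i) = \sum_i c i ^+ 2 * k i.
Proof.
move=> he; rewrite (ip_suml ipP); apply: eq_bigr => i _.
rewrite (ipZl ipP) (ip_sumr ipP) (bigD1 i)//= big1 => [|j ji].
  by rewrite (ipZr ipP) he eqxx addr0 mul1r expr2 mulrA.
by rewrite (ipZr ipP) he eq_sym (negbTE ji) mul0r mulr0.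
Qed.

(** More vectors than linear conditions leave room for a nontrivial
    combination. *)
Lemma exists_comb_orth m n (e : 'I_m -> H) (g : 'I_n -> H) : (n < m)%N ->
  exists c : 'I_m -> R, (exists i, c i != 0) /\
    forall l, ip (g l) (\sum_i c i *: e i) = 0.
Proof.
move=> nm; pose A : 'M[R]_(m, n) := \matrix_(i, l) ip (g l) (e i).
have : kermx A != 0.
  rewrite kermx_eq0 /row_free; apply: contraTneq nm => rA.
  by rewrite -leqNgt -rA rank_leq_col.
case/rowV0Pn => u /sub_kermxP uA u0.
exists (fun i => u 0 i); split.
  have [//|h] := pselect (exists i, u 0 i != 0).
  exfalso; move/eqP: u0; apply; apply/rowP => i; rewrite mxE.
  by apply/eqP/negP => ui; apply: h; exists i; apply/negP.
move=> l; have /rowP/(_ l) := uA; rewrite !mxE => uAl.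
rewrite (ip_sumr ipP) -[RHS]uAl; apply: eq_bigr => i _.
by rewrite (ipZr ipP) mxE.
Qed.

Lemma bessel n (e : 'I_n -> H) (k : 'I_n -> R) K v : 0 <= K ->
  (forall i, 0 <= k i <= K) ->
  (forall i j, ip (e i) (e j) = (i == j)%:R * k i) ->
  \sum_i ip (e i) v ^+ 2 <= K * ip v v.
Proof.
move=> K0 hk he; set S := \sum_i _.
have S0 : 0 <= S by apply: sumr_ge0 => i _; exact: sqr_ge0.
pose w := \sum_i ip (e i) v *: e i.
have wv : ip w v = S.
  by rewrite (ip_suml ipP); apply: eq_bigr => i _; rewrite (ipZl ipP) expr2.
have ww : ip w w <= K * S.
  rewrite (ip_sum_sum _ he) mulr_sumr; apply: ler_sum => i _.
  by rewrite mulrC ler_wpM2r ?sqr_ge0//; case/andP: (hk i).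
have := cauchy_schwarz w v; rewrite wv => h.
have [->|Sn0] := eqVneq S 0; first by rewrite mulr_ge0 ?(ip_ge0 ipP).
have Sgt0 : 0 < S by rewrite lt_neqAle eq_sym Sn0.
rewrite -(ler_pM2l Sgt0) -expr2; apply: le_trans h _.
by rewrite mulrA (mulrC S K) ler_wpM2r ?(ip_ge0 ipP).
Qed.

End SemiInnerTheory.

(** * Comparison of diagonalized quadratic forms *)

Section Weyl.
Context {R : realType} {H : lmodType R}.
Variable ip : H -> H -> R.
Hypothesis ipP : semi_inner ip.

(** A spectral decomposition of the form q.  The vectors are orthonormal at the
    indices with a positive eigenvalue and null at the others, so that forms of
    finite rank are covered.  The last clause is the min-max bound: it also
    says that no part of q is missed by f. *)
Definition diagonalizes (q : H -> R) (f : nat -> H) (lam : nat -> R) : Prop :=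
  [/\ nonincreasing_seq lam /\ (forall j, 0 <= lam j),
      forall i j, ip (f i) (f j) = (i == j)%:R * (0 < lam i)%R%:R,
      forall j (c : 'I_j -> R),
        q (\sum_(i < j) c i *: f i) = \sum_(i < j) c i ^+ 2 * lam i &
      forall j v, (forall i, (i < j)%N -> ip (f i) v = 0) ->
        q v <= lam j * ip v v].

(** Courant-Fischer: the first j+1 vectors of f1 span some v orthogonal to the
    first j vectors of f2, and on this v the two forms are compared with lam1 j
    from below and with lam2 j from above. *)
Lemma weyl q1 f1 lam1 q2 f2 lam2 (eps : R) :
  diagonalizes q1 f1 lam1 -> diagonalizes q2 f2 lam2 -> 0 <= eps ->
  (forall v, q1 v <= q2 v + eps * ip v v) ->
  forall j, lam1 j <= lam2 j + eps.
Proof.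
move=> [[dec1 pos1] on1 diag1 _] [[_ pos2] _ _ tail2] eps0 q12 j.
have [l1|l1] := leP (lam1 j) 0.
  by rewrite (le_trans l1)// addr_ge0.
have [c [[i0 ci0] corth]] := exists_comb_orth ipP
  (fun i : 'I_j.+1 => f1 i) (fun i : 'I_j => f2 i) (ltnSn j).
set v := \sum_i _ in corth.
have vv : ip v v = \sum_(i < j.+1) c i ^+ 2.
  rewrite (ip_sum_sum ipP _ (k := fun=> 1)) => [|i l].
    by apply: eq_bigr => i _; rewrite mulr1.
  rewrite on1; congr (_ * _).
  by rewrite (lt_le_trans l1)// dec1// -ltnS.
have vv0 : 0 < ip v v.
  rewrite vv (bigD1 i0)//= ltr_pwDl ?exprn_even_gt0//.
  by apply: sumr_ge0 => i _; exact: sqr_ge0.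
have h1 : lam1 j * ip v v <= q1 v.
  rewrite /v diag1 -/v vv mulr_sumr; apply: ler_sum => i _.
  by rewrite mulrC ler_wpM2l ?sqr_ge0// dec1// -ltnS.
have h2 : q2 v <= lam2 j * ip v v.
  by apply: tail2 => i ij; exact: (corth (Ordinal ij)).
rewrite -(ler_pM2r vv0) mulrDl (le_trans h1)// (le_trans (q12 v))//.
by rewrite lerD2r.
Qed.

End Weyl.

(** * Maximizers of compact quadratic forms *)

Section FiltersOfReals.
Context {R : realType}.

Lemma fmap_ultra (T U : Type) (f : T -> U) (F : set_system T) :
  UltraFilter F -> UltraFilter (f @ F).
Proof.
move=> FU; split; first exact: fmap_proper_filter.
move=> G PG FG; apply/seteqP; split=> A GA; last exact: FG.
have [//|FnA] := in_ultra_setVsetC (f @^-1` A) FU.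
have GnA : G (~` A) by apply: FG.
have : G (A `&` ~` A) by apply: filterI.
by rewrite setICr => /filter_not_empty.
Qed.

(** A bounded real function converges along an ultrafilter. *)
Lemma ultra_bounded_cauchy (T : Type) (F : set_system T) (x : T -> R) (K : R) :
  UltraFilter F -> (forall t, `|x t| <= K) ->
  forall eta : R, 0 < eta ->
  exists2 A, F A & forall s t, A s -> A t -> `|x s - x t| < eta.
Proof.
move=> FU xK eta eta0.
have cK : compact `[- K, K] by exact: segment_compact.
rewrite compact_ultra in cK.
have [|l [_ xl]] := cK (x @ F) (fmap_ultra x FU).
  by apply: (@filterE T F) => t; rewrite /= in_itv/= -ler_norml.
have eta2 : 0 < eta / 2 by rewrite divr_gt0.
exists (x @^-1` ball l (eta / 2)); first exact/xl/nbhsx_ballx.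
move=> s t; rewrite /= /ball/= => hs ht.
rewrite (_ : x s - x t = (l - x t) - (l - x s)); last by ring.
by rewrite (le_lt_trans (ler_normB _ _))// [eta]splitr ltrD.
Qed.

End FiltersOfReals.

Section MaxEigenvector.
Context {R : realType} {H : lmodType R}.
Variable ip : H -> H -> R.
Hypothesis ipP : semi_inner ip.

(** Completeness tested on sequences that are Cauchy at a geometric rate, which
    every Cauchy sequence has as subsequences. *)
Definition fast_complete : Prop := forall w : nat -> H,
  (forall k l, (k <= l)%N -> ip (w k - w l) (w k - w l) <= 4^-1 ^+ k) ->
  exists u, forall k, ip (w k - u) (w k - u) <= 4^-1 ^+ k.

(** Compactness of the operator behind q, read off its form: up to a small
    multiple of the squared norm, finitely many functionals control q. *)
Definition quasi_compact (q : H -> R) : Prop := forall eps : R, 0 < eps ->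
  exists n (a : 'I_n -> H), forall v,
    q v <= eps * ip v v + \sum_i ip (a i) v ^+ 2.

(** T is a plain function; symmetry makes it linear modulo null vectors. *)
Record psd_operator (T : H -> H) (C : R) : Prop := PsdOperator {
  psd_sym : forall u v, ip (T u) v = ip u (T v) ;
  psd_ge0 : forall v, 0 <= ip (T v) v ;
  psd_le : forall v, ip (T v) v <= C * ip v v ;
  psd_compact : quasi_compact (fun v => ip (T v) v) }.

Variables (T : H -> H) (K : R).
Hypotheses (TP : psd_operator T K) (cH : fast_complete).

Let q v := ip (T v) v.

Let TDl u v w : ip (T (u + v)) w = ip (T u) w + ip (T v) w.
Proof. by rewrite !(psd_sym TP) (ipDl ipP). Qed.
Let TZl a v w : ip (T (a *: v)) w = a * ip (T v) w.
Proof. by rewrite !(psd_sym TP) (ipZl ipP). Qed.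

Let qD u v : q (u + v) = q u + 2 * ip (T u) v + q v.
Proof.
rewrite /q TDl !(ipDr ipP) (ipC ipP (T v) u) -(psd_sym TP); ring.
Qed.
Let qZ a v : q (a *: v) = a ^+ 2 * q v.
Proof. by rewrite /q TZl (ipZr ipP); ring. Qed.

Let qB u v : q (u - v) = q u - 2 * ip (T u) v + q v.
Proof. by rewrite -scaleN1r qD qZ (ipZr ipP); ring. Qed.

Variables (n : nat) (g : 'I_n -> H) (lam : 'I_n -> R).
Hypothesis gT : forall i v, ip (T (g i)) v = lam i * ip (g i) v.

Let N v := forall i, ip (g i) v = 0.

Let ND u v : N u -> N v -> N (u + v).
Proof. by move=> hu hv i; rewrite (ipDr ipP) hu hv addr0. Qed.
Let NZ a v : N v -> N (a *: v).
Proof. by move=> hv i; rewrite (ipZr ipP) hv mulr0. Qed.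
Let NT v : N v -> N (T v).
Proof. by move=> hv i; rewrite -(psd_sym TP) gT hv mulr0. Qed.

Let qs (s : R) := forall v, N v -> q v <= s * ip v v.

(** A zero of the nonnegative form s |v|^2 - <Tv, v> lies in its radical. *)
Let extremal_eigen s u : qs s -> N u -> q u = s * ip u u ->
  forall v, ip (T u) v = s * ip u v.
Proof.
move=> hs Nu qu.
pose x := s *: u - T u.
have Nx : N x by apply: ND; [exact: NZ|rewrite -scaleN1r; exact/NZ/NT].
have B w : N w -> s * ip u w - ip (T u) w = 0.
  move=> Nw; have := @discr_le _ (s * ip w w - q w) (s * ip u w - ip (T u) w) 0.
  rewrite mulr0 => h; apply/eqP; rewrite -sqrf_eq0 eq_le sqr_ge0 andbT; apply: h.
    by rewrite subr_ge0 hs.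
  move=> t; have := hs (u + t *: w) (ND Nu (NZ t Nw)).
  rewrite qD qZ qu !(ipZr ipP) (ip_sqrD ipP) !(ipZl ipP, ipZr ipP).
  by rewrite -subr_ge0 => h; apply: le_trans h _; rewrite le_eqVlt; apply/orP; left; apply/eqP; ring.
have xx : ip x x = 0 by rewrite {1}/x (ipBl ipP) (ipZl ipP) B.
move=> v; have := ip_null ipP v xx.
by rewrite /x (ipBl ipP) (ipZl ipP) => /eqP; rewrite subr_eq0 => /eqP.
Qed.

(** The supremum s of the form on the unit sphere of N is attained.  Along an
    ultrafilter the finitely many functionals of [quasi_compact] converge on a
    maximizing sequence; so q is small on the differences of far terms, and the
    parallelogram identity makes the sequence Cauchy if s > 0.  A maximizer is an
    eigenvector by [extremal_eigen], N being invariant. *)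
Lemma max_eigenvector : (exists v, N v /\ 0 < ip v v) ->
  exists u s, [/\ N u, ip u u = 1, 0 <= s,
    forall v, ip (T u) v = s * ip u v & forall v, N v -> q v <= s * ip v v].
Proof.
move=> [v0 [Nv0 v0gt0]].
pose A := [set q v | v in [set v | N v /\ ip v v = 1]].
have nrm v : 0 < ip v v -> N v ->
    let w := (Num.sqrt (ip v v))^-1 *: v in
    [/\ N w, ip w w = 1 & q v = q w * ip v v].
  move=> vgt0 Nv w; have sq := sqr_sqrtr (ltW vgt0).
  have s0 : Num.sqrt (ip v v) != 0 by rewrite sqrtr_eq0 -ltNge.
  split; first exact: NZ.
    rewrite /w (ipZl ipP) (ipZr ipP) mulrA -expr2 exprVn sq mulVf//.
    by rewrite gt_eqF.
  by rewrite /w qZ exprVn sq mulrAC mulVf ?mul1r// gt_eqF.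
have [Nw0 w01 _] := nrm _ v0gt0 Nv0.
have hA : has_sup A.
  split; first by eexists; exists ((Num.sqrt (ip v0 v0))^-1 *: v0).
  by exists K => _ [v [_ v1] <-]; rewrite (le_trans (psd_le TP v))// v1 mulr1.
set s := sup A.
have s0 : 0 <= s.
  apply: le_trans (psd_ge0 TP ((Num.sqrt (ip v0 v0))^-1 *: v0)) _.
  by apply: sup_upper_bound => //; exists ((Num.sqrt (ip v0 v0))^-1 *: v0).
have sP : qs s.
  move=> v Nv; have [vgt0|] := ltP 0 (ip v v).
    have [Nw w1 ->] := nrm _ vgt0 Nv; rewrite ler_wpM2r ?(ip_ge0 ipP)//.
    by apply: sup_upper_bound => //; eexists; last by [].
  rewrite le_eqVlt ltNge (ip_ge0 ipP) orbF => /eqP vv0.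
  by rewrite /q vv0 mulr0 (ipC ipP) (ip_null ipP).
suff [u [Nu u1 qu]] : exists u, [/\ N u, ip u u = 1 & q u = s].
  exists u, s; split => //; apply: extremal_eigen => //.
  by rewrite u1 mulr1.
have [s_eq0|sn0] := eqVneq s 0.
  exists ((Num.sqrt (ip v0 v0))^-1 *: v0); split=> //.
  rewrite s_eq0; apply/eqP; rewrite eq_le; apply/andP; split.
    by have := sP _ Nw0; rewrite w01 mulr1 s_eq0.
  exact: (psd_ge0 TP).
have sgt0 : 0 < s by rewrite lt_neqAle eq_sym sn0.
have /choice[v vP] : forall k : nat, exists v,
    [/\ N v, ip v v = 1 & s - k.+1%:R^-1 < q v].
  move=> k; have [|_ [v [Nv v1] <-] h] := @sup_adherent _ A k.+1%:R^-1 _ hA.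
    by rewrite invr_gt0.
  by exists v.
have [F [FU ooF]] := @ultraFilterLemma nat \oo _.
(* parallelogram identity, with q bounded by s on v1 + v2 *)
have B v1 v2 : N v1 -> N v2 ->
    s * ip (v1 - v2) (v1 - v2) <= q (v1 - v2) + 2 * (s * ip v1 v1 - q v1)
      + 2 * (s * ip v2 v2 - q v2).
  move=> N1 N2; have := sP _ (ND N1 N2).
  rewrite qD qB (ip_sqrD ipP) (ip_sqrB ipP) -subr_ge0 => h.
  rewrite -subr_ge0; apply: le_trans h _.
  by rewrite le_eqVlt; apply/orP; left; apply/eqP; ring.
have Fcauchy (eta : R) : 0 < eta -> exists2 A, F A &
    forall k l, A k -> A l -> ip (v k - v l) (v k - v l) <= eta.
  move=> eta0.
  have e0 : 0 < s * eta / 16 by rewrite divr_gt0// mulr_gt0.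
  have [m [a aP]] := psd_compact TP e0.
  (* m functionals that vary by less than d contribute at most m * d^2 *)
  have [d [d0 dP]] : exists d, 0 < d /\ m%:R * d ^+ 2 <= s * eta / 4.
    exists (Num.sqrt (s * eta / 4 / m.+1%:R)); split.
      by rewrite sqrtr_gt0 !divr_gt0// mulr_gt0.
    rewrite sqr_sqrtr; last by rewrite !divr_ge0// mulr_ge0// ltW.
    rewrite mulrCA ler_piMr//; first by rewrite ltW// divr_gt0// mulr_gt0.
    by rewrite ler_pdivrMr// mul1r ler_nat.
  have /choice[A_ A_P] : forall i : 'I_m, exists A, F A /\
      forall k l, A k -> A l -> `|ip (a i) (v k) - ip (a i) (v l)| < d.
    move=> i; pose c := Num.sqrt (ip (a i) (a i)).
    have [|D FD Dd] := @ultra_bounded_cauchy R _ F (fun k => ip (a i) (v k)) c FU _ d d0.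
      move=> k; rewrite -ler_sqr ?nnegrE ?sqrtr_ge0//.
      rewrite real_normK ?num_real// sqr_sqrtr ?(ip_ge0 ipP)//.
      rewrite (le_trans (cauchy_schwarz ipP _ _))//.
      by case: (vP k) => _ -> _; rewrite mulr1.
    by exists D.
  have [k0 k0P] : exists k0, forall k, (k0 <= k)%N -> k.+1%:R^-1 <= s * eta / 16.
    have [k0 hk0] := near_infty_natSinv_lt (PosNum e0).
    by move=> k0P; exists k0 => k /k0P /ltW.
  exists ([set k | forall i, A_ i k] `&` [set k | (k0 <= k)%N]).
    apply: filterI; last by apply: ooF; exists k0.
    by apply: (@filter_forall _ _ _ F) => i; case: (A_P i).
  move=> k l [Ak k0k] [Al k0l].
  have [Nk k1 qk] := vP k; have [Nl l1 ql] := vP l.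
  have h := B _ _ Nk Nl.
  have h1 := aP (v k - v l).
  have h2 : \sum_i ip (a i) (v k - v l) ^+ 2 <= s * eta / 4.
    apply: le_trans dP; rewrite mulr_natl -[X in _ *+ X]card_ord -sumr_const.
    apply: ler_sum => i _; rewrite (ipBr ipP) -real_normK ?num_real// ler_sqr ?nnegrE ?(ltW d0)//.
    by apply/ltW; case: (A_P i) => _; apply; [exact: Ak|exact: Al].
  have h3 : ip (v k - v l) (v k - v l) <= 4.
    have := ip_ge0 ipP (v k + v l); rewrite (ip_sqrD ipP) (ip_sqrB ipP) k1 l1; lra.
  have h4 : s * eta / 16 * ip (v k - v l) (v k - v l) <= s * eta / 4.
    rewrite (_ : s * eta / 4 = s * eta / 16 * 4); last by field.
    by rewrite ler_wpM2l// ltW.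
  rewrite -(ler_pM2l sgt0); move: h; rewrite k1 l1 => h.
  have := k0P _ k0k; have := k0P _ k0l.
  have : 0 < s * eta by rewrite mulr_gt0.
  move: qk ql h1 h h2 h4; rewrite /q.
  set x := ip (v k - v l) _; set y := \sum_i _; set z := ip (T (v k - v l)) _.
  move: x y z (k.+1%:R^-1) (l.+1%:R^-1) (ip _ _) (ip _ _) => x y z i1 i2 z1 z2.
  lra.
have /choice[A_ A_P] : forall k : nat, exists D, [/\ F D, forall i, D i -> (4 ^ k <= i)%N &
   forall i j, D i -> D j -> ip (v i - v j) (v i - v j) <= 4^-1 ^+ k].
  move=> k; have [|D FD DP] := Fcauchy (4^-1 ^+ k); first by rewrite exprn_gt0.
  exists (D `&` [set i | (4 ^ k <= i)%N]); split.
  - by apply: filterI => //; apply: ooF; exists (4 ^ k)%N.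
  - by move=> i [].
  - by move=> i j [Ai _] [Aj _]; apply: DP.
have /choice[m mP] : forall k : nat, exists m, forall i, (i <= k)%N -> A_ i m.
  move=> k; have : F [set j | forall i : 'I_k.+1, A_ i j].
    by apply: (@filter_forall _ _ _ F) => i; case: (A_P i).
  case/filter_ex => m mP; exists m => i ik.
  by apply: (mP (Ordinal (ik : (i < k.+1)%N))).
have [k l kl|u uP] := cH (w := v \o m).
  by case: (A_P k) => _ _; apply; apply: mP.
exists u.
(* the chosen subsequence approaches u at the rate 2^-k; each identity for u
   follows from an error bound by a multiple of 4^-k *)
have small (c d : R) : 0 <= d -> (forall k, c <= d * 4^-1 ^+ k) -> c <= 0.
  move=> d0 h; apply/ler_addgt0Pr => e e0; rewrite add0r.
  have : (fun k => d * 4^-1 ^+ k) @ \oo --> (d * 0 : R).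
    by apply: cvgMr; apply: cvg_expr; rewrite gtr0_norm// invf_lt1// ltr1n.
  rewrite mulr0 => /cvgrPdist_lt/(_ e e0)[k0 _ /(_ k0 (leqnn _))].
  rewrite sub0r normrN => hk; apply: (le_trans (h k0)).
  by apply: le_trans (ltW hk); rewrite ler_norm.
have ipu x : forall k, (ip x (v (m k)) - ip x u) ^+ 2 <= ip x x * 4^-1 ^+ k.
  move=> k; rewrite -(ipBr ipP) (le_trans (cauchy_schwarz ipP _ _))//.
  by rewrite ler_wpM2l ?(ip_ge0 ipP)//; exact: uP.
have Nu : N u.
  move=> i; apply/eqP; rewrite -sqrf_eq0 eq_le sqr_ge0 andbT.
  apply: (small _ (ip (g i) (g i))); first exact: ip_ge0.
  move=> k; apply: le_trans (ipu (g i) k).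
  by have [-> _ _] := vP (m k); rewrite sub0r sqrrN.
have sm (e c d d' x : R) : 0 <= x <= 1 -> e ^+ 2 <= c * x -> 0 <= d' <= x -> 0 <= d <= K * x ->
    (d' + 2 * e + d) ^+ 2 <= 3 * (1 + 4 * c + K ^+ 2) * x.
  move=> /andP[x0 x1] he /andP[d'0 d'x] /andP[d0 dx].
  have h1 : (d' + 2 * e + d) ^+ 2 <= 3 * (d' ^+ 2 + 4 * e ^+ 2 + d ^+ 2).
    rewrite -subr_ge0 (_ : _ - _ = (d' - 2 * e) ^+ 2 + (2 * e - d) ^+ 2 + (d' - d) ^+ 2).
      by rewrite !addr_ge0 ?sqr_ge0.
    by ring.
  have h2 : d' ^+ 2 <= x.
    by rewrite (le_trans _ d'x)// expr2 ler_piMl// (le_trans d'x).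
  have h3 : d ^+ 2 <= K ^+ 2 * x.
    apply: (@le_trans _ _ ((K * x) ^+ 2)).
      by rewrite ler_sqr ?nnegrE// (le_trans d0).
    by rewrite exprMn ler_wpM2l ?sqr_ge0// expr2 ler_piMl.
  rewrite (le_trans h1)//; move: he h2 h3; lra.
have x01 k : 0 <= (4^-1 : R) ^+ k <= 1.
  by rewrite exprn_ge0//= exprn_ile1// invf_le1// ler1n.
have zero_sq c (r : R) : 0 <= c -> (forall k, r ^+ 2 <= c * 4^-1 ^+ k) -> r = 0.
  move=> c0 h; apply/eqP; rewrite -sqrf_eq0 eq_le sqr_ge0 andbT.
  exact: (small _ c).
have K0 : 0 <= K.
  by have [_ v1 _] := vP 0%N; rewrite -[K]mulr1 -v1 (le_trans _ (psd_le TP _))// (psd_ge0 TP).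
have u1 : ip u u = 1.
  apply/esym/eqP; rewrite -subr_eq0; apply/eqP.
  apply: (zero_sq (3 * (1 + 4 * ip u u + K ^+ 2))).
    by rewrite mulr_ge0// !addr_ge0 ?sqr_ge0// mulr_ge0// (ip_ge0 ipP).
  move=> k; have := uP k; have := ip_ge0 ipP (v (m k) - u).
  rewrite (ip_sqrB ipP); have [_ -> _] := vP (m k).
  rewrite (ipC ipP _ u) => hge hle.
  rewrite (_ : 1 - ip u u = (1 - 2 * ip u (v (m k)) + ip u u) + 2 * (ip u (v (m k)) - ip u u) + 0); last by ring.
  apply: sm => //; first by rewrite hge.
  by rewrite lexx mulr_ge0//; case/andP: (x01 k).
split=> //; apply/esym/eqP; rewrite -subr_eq0; apply/eqP.
apply: (zero_sq (3 * (1 + 4 * ip (T u) (T u) + K ^+ 2))).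
  by rewrite mulr_ge0// !addr_ge0 ?sqr_ge0// mulr_ge0// (ip_ge0 ipP).
move=> k; have hge := psd_ge0 TP (v (m k) - u).
have hle : q (v (m k) - u) <= K * 4^-1 ^+ k.
  by rewrite (le_trans (psd_le TP _))// ler_wpM2l//; exact: uP.
have [_ v1 hs] := vP (m k).
have hs' : q (v (m k)) <= s.
  by have [Nvm _ _] := vP (m k); have := sP _ Nvm; rewrite v1 mulr1.
rewrite (_ : s - q u = (s - q (v (m k))) + 2 * (ip (T u) (v (m k)) - ip (T u) u) + q (v (m k) - u)).
  apply: sm => //; first rewrite subr_ge0 hs' /= lerBlDl -lerBlDr (le_trans _ (ltW hs))// lerB//.
    rewrite exprVn -natrX lef_pV2 ?posrE ?ltr0n ?expn_gt0// ler_nat.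
    by have [_ Am _] := A_P k; rewrite (leq_trans (Am _ (mP k k (leqnn k)))).
  by rewrite hge.
by rewrite qB (psd_sym TP (v (m k)) u) (ipC ipP (v (m k)) (T u)) /q; ring.
Qed.

End MaxEigenvector.

(** * Diagonalization of an operator from its eigenvalue multiplicities *)

Section EigenvalueSequence.
Context {R : realType} {H : lmodType R}.
Variable ip : H -> H -> R.
Hypothesis ipP : semi_inner ip.
Variables (T : H -> H) (K : R) (tau : nat -> R).
Hypotheses (TP : psd_operator ip T K) (cH : fast_complete ip).
Hypotheses (tau_dec : nonincreasing_seq tau) (tau_ge0 : forall j, 0 <= tau j).

Let eigen (lam : R) v := forall w, ip (T v) w = lam * ip v w.

(** The list t enumerates the positions of lam in tau, and e is a basis, modulo
    null vectors, of the eigenspace of lam. *)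
Hypothesis tau_mult : forall lam, lam != 0 ->
  exists (t : seq nat) (e : 'I_(size t) -> H),
    [/\ uniq t, forall j, (j \in t) = (tau j == lam), forall i, eigen lam (e i),
        forall c : 'I_(size t) -> R,
          let v := \sum_i c i *: e i in ip v v = 0 -> forall i, c i = 0 &
        forall v, eigen lam v ->
          exists c : 'I_(size t) -> R,
            let w := v - \sum_i c i *: e i in ip w w = 0].

Let eigen_comb lam n (c : 'I_n -> R) (e : 'I_n -> H) :
  (forall i, eigen lam (e i)) -> eigen lam (\sum_i c i *: e i).
Proof.
move=> he w; rewrite (psd_sym TP) !(ip_suml ipP) mulr_sumr; apply: eq_bigr => i _.
by rewrite !(ipZl ipP) -(psd_sym TP) he; ring.
Qed.

Let eigen_orth lam lam' v w : lam != lam' -> eigen lam v -> eigen lam' w -> ip v w = 0.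
Proof.
move=> ll' hv hw; apply/eqP; have : (lam - lam') * ip v w = 0.
  by rewrite mulrBl -hv (psd_sym TP) (ipC ipP v (T w)) hw (ipC ipP w); ring.
by move/eqP; rewrite mulf_eq0 subr_eq0 (negbTE ll').
Qed.

(** s can be the beginning of an eigenbasis listed in the order of tau. *)
Let good (s : seq H) :=
  (forall i j, (i < size s)%N -> (j < size s)%N ->
     ip s`_i s`_j = (i == j)%:R * (0 < tau i)%R%:R) /\
  (forall i, (i < size s)%N -> eigen (tau i) s`_i).

(** The value tau_j has more positions in tau than vectors already chosen for
    it, so its eigenspace contains a vector orthogonal to all of these. *)
Let extend s : good s -> exists x, good (rcons s x).
Proof.
move=> [on eg]; pose j := size s.
suff [x [xx xs xe]] : exists x, [/\ ip x x = (0 < tau j)%R%:R,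
    forall i, (i < j)%N -> ip s`_i x = 0 & eigen (tau j) x].
  exists x; split=> [i l|i]; rewrite size_rcons !ltnS !nth_rcons => ij.
    move=> lj; have [iltj|ji] := ltnP i (size s); have [lltj|jl] := ltnP l (size s).
    - exact: on.
    - have -> : l = j by apply/eqP; rewrite eqn_leq lj.
      by rewrite eqxx xs// (ltn_eqF iltj) mul0r.
    - have -> : i = j by apply/eqP; rewrite eqn_leq ij.
      by rewrite eqxx (ipC ipP) xs// (gtn_eqF lltj) mul0r.
    - have -> : i = j by apply/eqP; rewrite eqn_leq ij.
      have -> : l = j by apply/eqP; rewrite eqn_leq lj.
      by rewrite eqxx xx mul1r.
  have [iltj|ji] := ltnP i (size s); first exact: eg.
  have -> : i = j by apply/eqP; rewrite eqn_leq ij.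
  by rewrite eqxx.
have [tj0|tj0] := eqVneq (tau j) 0.
  exists 0; split=> [|i ij|w]; rewrite ?(ip0r ipP) ?tj0 ?ltxx//.
  by rewrite (psd_sym TP) !(ip0l ipP) mulr0.
have [t [e [ut tE ee free _]]] := tau_mult tj0.
pose r := [seq i <- iota 0 j | tau i == tau j].
have rt : (size r < size t)%N.
  rewrite -[(size r).+1]/(size (j :: r)); apply: uniq_leq_size.
    by rewrite /= filter_uniq ?iota_uniq// mem_filter mem_iota ltnn !andbF.
  move=> i; rewrite inE tE => /predU1P[->//|].
  by rewrite mem_filter => /andP[].
have [c [[i0 ci0] corth]] := exists_comb_orth ipP e
  (fun l : 'I_(size r) => s`_(nth 0%N r l)) rt.
set x := \sum_i _ in corth.
have xx0 : ip x x != 0 by apply: contraNneq ci0 => /free /(_ i0) ->.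
have xx : 0 < ip x x by rewrite lt_neqAle eq_sym xx0 (ip_ge0 ipP).
have xe : eigen (tau j) x by exact: eigen_comb.
have xs i : (i < j)%N -> ip s`_i x = 0.
  move=> ij; have [tij|tij] := eqVneq (tau i) (tau j).
    have ir : i \in r by rewrite mem_filter tij eqxx mem_iota.
    have h : (index i r < size r)%N by rewrite index_mem.
    by have := corth (Ordinal h); rewrite /= nth_index.
  exact: (eigen_orth tij (eg _ ij) xe).
exists ((Num.sqrt (ip x x))^-1 *: x); split.
- rewrite (ipZl ipP) (ipZr ipP) mulrA -expr2 exprVn sqr_sqrtr ?ltW// mulVf//.
  by rewrite lt_neqAle eq_sym tj0 tau_ge0.
- by move=> i ij; rewrite (ipZr ipP) xs// mulr0.
- by move=> w; rewrite (psd_sym TP) !(ipZl ipP) -(psd_sym TP) xe; ring.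
Qed.

(** If the form exceeded tau_j on the complement of f_0, ..., f_(j-1), its maximum
    there would be an eigenvalue s > tau_j.  All vectors of f with eigenvalue s
    precede f_j, so the maximizer is orthogonal to them, and the eigenspace of s
    would be larger than its multiplicity. *)
Let tail_bound (f : nat -> H) :
  (forall i j, ip (f i) (f j) = (i == j)%:R * (0 < tau i)%R%:R) ->
  (forall i, eigen (tau i) (f i)) ->
  forall j v, (forall i, (i < j)%N -> ip (f i) v = 0) ->
    ip (T v) v <= tau j * ip v v.
Proof.
move=> on eg j v fv; have [vgt0|] := ltP 0 (ip v v); last first.
  rewrite le_eqVlt ltNge (ip_ge0 ipP) orbF => /eqP v0.
  by rewrite v0 mulr0 (ipC ipP) (ip_null ipP).
have [|u [s [Nu u1 s0 us sP]]] := @max_eigenvector _ _ _ ipP T K TP cH j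
    (fun i => f i) (fun i => tau i) (fun i => eg i).
  by exists v; split=> // i; exact: fv.
have {}sP : ip (T v) v <= s * ip v v by apply: sP => i; exact: fv.
have [sj|js] := leP s (tau j).
  by rewrite (le_trans sP)// ler_wpM2r// ltW.
exfalso; have sgt0 : 0 < s by rewrite (le_lt_trans (tau_ge0 j)).
have [t [e [ut tE ee free spn]]] := tau_mult (lt0r_neq0 sgt0).
have tj i : i \in t -> (i < j)%N.
  rewrite tE => /eqP ti; rewrite ltnNge; apply/negP => ji.
  by move: js; rewrite -ti ltNge tau_dec.
(* the vectors of f with eigenvalue s, then the maximizer: one too many *)
pose y (i : 'I_(size t).+1) := nth u [seq f k | k <- t] i.
have ylt (i : 'I_(size t).+1) (h : (i < size t)%N) : y i = f (nth 0%N t i).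
  by rewrite /y (nth_map 0%N).
have yge (i : 'I_(size t).+1) : (size t <= i)%N -> y i = u.
  by move=> h; rewrite /y nth_default// size_map.
have te (i : 'I_(size t).+1) (h : (i < size t)%N) : tau (nth 0%N t i) = s.
  by apply/eqP; rewrite -tE mem_nth.
have yy i l : ip (y i) (y l) = (i == l)%:R * 1.
  rewrite mulr1; have [ilt|ige] := ltnP i (size t); have [llt|lge] := ltnP l (size t).
  - by rewrite !ylt// on te// sgt0 mulr1 nth_uniq.
  - rewrite (ylt _ ilt) (yge _ lge) (Nu (Ordinal (tj _ (mem_nth 0%N ilt)))).
    by rewrite -val_eqE/= ltn_eqF// (leq_trans ilt).
  - rewrite (ylt _ llt) (yge _ ige) (ipC ipP) (Nu (Ordinal (tj _ (mem_nth 0%N llt)))).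
    by rewrite -val_eqE/= gtn_eqF// (leq_trans llt).
  - rewrite !yge// u1 -val_eqE/=.
    have -> : i = size t :> nat by apply/eqP; rewrite eqn_leq ige -ltnS ltn_ord.
    have -> : l = size t :> nat by apply/eqP; rewrite eqn_leq lge -ltnS ltn_ord.
    by rewrite eqxx.
have ye i : eigen s (y i).
  have [ilt|ige] := ltnP i (size t); last by rewrite yge.
  by rewrite ylt// -(te _ ilt).
have [c [[i0 ci0] corth]] := exists_comb_orth ipP y e (ltnSn _).
set z := \sum_i _ in corth.
have zz : 0 < ip z z.
  rewrite (ip_sum_sum ipP _ yy) (bigD1 i0)//= mulr1 ltr_pwDl ?exprn_even_gt0//.
  by apply: sumr_ge0 => i _; rewrite mulr1 sqr_ge0.
have [d /= dP] := spn z (eigen_comb c ye).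
have dz : ip (\sum_i d i *: e i) z = 0.
  by rewrite (ip_suml ipP) big1// => i _; rewrite (ipZl ipP) corth mulr0.
have := ip_null ipP z dP; rewrite (ipBl ipP) dz subr0 => z0.
by rewrite z0 ltxx in zz.
Qed.

(** The spectral theorem in variational form: the eigenvectors are chosen one by
    one with [extend], and [tail_bound] excludes any further spectrum. *)
Lemma eigenvalue_seq_diagonalizes :
  exists f, diagonalizes ip (fun v => ip (T v) v) f tau.
Proof.
pose gs := {s | good s}.
have /choice[x xP] : forall s : gs, exists x, good (rcons (sval s) x).
  by move=> [s gs_s]; exact: extend.
have g0 : good [::] by split.
pose S k : gs := iter k (fun s : gs => exist good (rcons (sval s) (x s)) (xP s)) (exist good [::] g0).
have sS k : size (sval (S k)) = k.
  by elim: k => // k IH; rewrite /= size_rcons IH.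
have nthS k i : (i < k)%N -> (sval (S k))`_i = (sval (S i.+1))`_i.
  elim: k => // k IH; rewrite ltnS leq_eqVlt => /predU1P[->//|ik].
  by rewrite -(IH ik) /= nth_rcons sS ik.
pose f k := (sval (S k.+1))`_k.
have on i j : ip (f i) (f j) = (i == j)%:R * (0 < tau i)%R%:R.
  have [h _] := svalP (S (maxn i j).+1).
  rewrite /f -(@nthS (maxn i j).+1 i) ?ltnS ?leq_maxl//.
  rewrite -(@nthS (maxn i j).+1 j) ?ltnS ?leq_maxr//.
  by apply: h; rewrite sS ltnS ?leq_maxl ?leq_maxr.
have eg i : eigen (tau i) (f i).
  by have [_ h] := svalP (S i.+1); apply: h; rewrite sS.
exists f; split=> //; last exact: tail_bound.
move=> j c; rewrite (psd_sym TP) (ip_suml ipP); apply: eq_bigr => i _.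
rewrite (ipZl ipP) -(psd_sym TP) eg (ip_sumr ipP) (bigD1 i)//= big1 => [|l li].
  rewrite (ipZr ipP) on eqxx addr0 mul1r.
  have [//|ti] := eqVneq (tau i) 0; first by move=> ->; rewrite mul0r !mulr0.
  by rewrite lt_neqAle eq_sym ti tau_ge0/= mulr1; ring.
have il : (i == l :> nat) = false by apply/negbTE; rewrite eq_sym; exact: li.
by rewrite (ipZr ipP) on il mul0r mulr0.
Qed.

End EigenvalueSequence.

(** * Eigenvalues of Gram matrices *)

Section RowVectors.
Context {R : realType} {n : nat}.
Notation V := 'rV[R]_n.

Definition dot (u v : V) : R := \sum_i u 0 i * v 0 i.

Lemma semi_inner_dot : semi_inner dot.
Proof.
split=> [u v|a u v w|u].
- by apply: eq_bigr => i _; rewrite mulrC.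
- rewrite /dot mulr_sumr -big_split/=; apply: eq_bigr => i _.
  by rewrite !mxE mulrDl mulrA.
- by apply: sumr_ge0 => i _; rewrite -expr2 sqr_ge0.
Qed.
Let dP := semi_inner_dot.

Lemma dot_fast_complete : fast_complete dot.
Proof.
move=> w hw.
have le1 (u : V) i : u 0 i ^+ 2 <= dot u u.
  rewrite /dot (bigD1 i)//= expr2 lerDl sumr_ge0// => j _.
  by rewrite -expr2 sqr_ge0.
have cw i : cvgn (fun k => w k 0 i).
  apply: cauchy_cvg; apply/cauchy_exP => e e0.
  have : (fun k => (4^-1 : R) ^+ k) @ \oo --> (0 : R).
    by apply: cvg_expr; rewrite gtr0_norm// invf_lt1// ltr1n.
  have e2 : 0 < e ^+ 2 by rewrite exprn_gt0.
  move=> /cvgrPdist_lt/(_ _ e2)[k0 _ hk0]; exists (w k0 0 i), k0 => // k /= k0k.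
  change (`|(w k0 0 i - w k 0 i : R)| < e).
  rewrite -ltr_sqr ?nnegrE ?(ltW e0)//. rewrite real_normK ?num_real//.
  have := le1 (w k0 - w k) i; rewrite !mxE => /le_lt_trans; apply.
  apply: le_lt_trans (hw _ _ k0k) _.
  by have := hk0 k0 (leqnn _); rewrite sub0r normrN; apply: le_lt_trans; rewrite ler_norm.
pose u : V := \row_i limn (fun k => w k 0 i).
exists u => k.
have : (fun l => dot (w k - w l) (w k - w l)) @ \oo --> dot (w k - u) (w k - u).
  apply: cvg_big => [|i _]; first exact: add_continuous.
  have h : (fun l => (w k - w l) 0 i) @ \oo --> (w k - u) 0 i.
    rewrite !mxE; under eq_fun do rewrite !mxE.
    by apply: cvgB; [exact: cvg_cst|exact: cw].
  exact: cvgM.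
move=> h; apply: (cvgr_to_le h); exists k => // l /= kl; exact: hw.
Qed.

Lemma dot_norm_compact (q : V -> R) (K : R) : 0 <= K ->
  (forall v, q v <= K * dot v v) -> quasi_compact dot q.
Proof.
move=> K0 qK eps eps0; exists n, (fun i => Num.sqrt K *: delta_mx 0 i) => v.
rewrite (le_trans (qK v))// ler_wpDl ?mulr_ge0 ?(ip_ge0 dP) ?(ltW eps0)//.
rewrite /dot mulr_sumr; apply: ler_sum => i _.
rewrite (_ : \sum_j _ = Num.sqrt K * v 0 i).
  by rewrite exprMn sqr_sqrtr// -expr2.
rewrite (bigD1 i)//= big1 => [|j ji]; first by rewrite !mxE !eqxx mulr1 addr0.
by rewrite !mxE eqxx (negbTE ji) mulr0 mul0r.
Qed.

End RowVectors.

Section SymmetricMatrix.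
Context {R : realType} {n : nat}.
Notation V := 'rV[R]_n.
Variable A : 'M[R]_n.
Hypothesis Asym : A^T = A.
Hypothesis Apsd : forall v : V, 0 <= dot (v *m A) v.

Let dP : semi_inner (@dot R n) := semi_inner_dot.

Let dotE (u v : V) : dot u v = (u *m v^T) 0 0.
Proof. by rewrite mxE; apply: eq_bigr => i _; rewrite mxE. Qed.

Let TP : exists K, psd_operator (@dot R n) (mulmxr A) K.
Proof.
have sym (u v : V) : dot (u *m A) v = dot u (v *m A).
  by rewrite !dotE trmx_mul Asym mulmxA.
exists (\sum_i \sum_j `|A i j|).
have bd (v : V) : dot (v *m A) v <= (\sum_i \sum_j `|A i j|) * dot v v.
  have sq (i : 'I_n) : `|v 0 i| ^+ 2 <= dot v v.
    rewrite real_normK ?num_real// /dot (bigD1 i)//= expr2 lerDl sumr_ge0// => j _.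
    by rewrite -expr2 sqr_ge0.
  rewrite exchange_big/= mulr_suml {1}/dot; apply: ler_sum => i _.
  rewrite mxE !mulr_suml; apply: ler_sum => j _.
  rewrite (mulrC (v 0 j)) -mulrA (le_trans (ler_norm _))// normrM ler_wpM2l// normrM.
  have := sq i; have := sq j; have := sqr_ge0 (`|v 0 i| - `|v 0 j|).
  rewrite sqrrB; move: `|v 0 i| `|v 0 j| (dot v v) => x y d; lra.
split=> //.
apply: dot_norm_compact bd.
by apply: sumr_ge0 => i _; apply: sumr_ge0.
Qed.

Let q (v : V) := dot (v *m A) v.

(** Each new eigenvector maximizes the form on the complement of the previous
    ones; this lists the eigenvalues in nonincreasing order. *)
Let greedy k : (k <= n)%N -> exists (f : nat -> V) (lam : nat -> R),
  [/\ forall i j, (i < k)%N -> (j < k)%N -> dot (f i) (f j) = (i == j)%:R,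
      forall i, (i < k)%N -> f i *m A = lam i *: f i,
      forall i, (i < k)%N -> 0 <= lam i &
      forall j v, (j < k)%N -> (forall i, (i < j)%N -> dot (f i) v = 0) ->
        q v <= lam j * dot v v].
Proof.
elim: k => [_|k IH kn]; first by exists (fun=> 0), (fun=> 0).
have [f [lam [on eg l0 tl]]] := IH (ltnW kn).
have [K TK] := TP.
have eg' (i : 'I_k) v : dot (f i *m A) v = lam i * dot (f i) v.
  by rewrite eg// (ipZl dP).
have [|u [s [Nu u1 s0 us sP]]] := max_eigenvector dP TK dot_fast_complete eg'.
  have kn' : (k < n)%N by [].
  have [c [[i0 ci0] corth]] := exists_comb_orth dP (fun i : 'I_n => delta_mx 0 i : V) (fun i : 'I_k => f i) kn'.
  exists (\sum_i c i *: delta_mx 0 i); split=> //.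
  rewrite (ip_sum_sum dP _ (k := fun=> 1)) => [|i j].
    rewrite (bigD1 i0)//= mulr1 ltr_pwDl ?exprn_even_gt0//.
    by apply: sumr_ge0 => i _; rewrite mulr1 sqr_ge0.
  rewrite mulr1 /dot (bigD1 i)//= big1 => [|l li].
    by rewrite !mxE !eqxx mul1r addr0.
  by rewrite !mxE (negbTE li) mul0r.
have egu : u *m A = s *: u.
  apply/rowP => j; have := us (delta_mx 0 j).
  have dd (w : V) : dot w (delta_mx 0 j) = w 0 j.
    rewrite /dot (bigD1 j)//= big1 => [|l li]; first by rewrite !mxE !eqxx mulr1 addr0.
    by rewrite !mxE (negbTE li) andbF mulr0.
  by rewrite !dd /= => ->; rewrite mxE.
exists (fun i => if i == k then u else f i), (fun i => if i == k then s else lam i).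
have neq i : (i < k)%N -> (i == k) = false by move=> ik; rewrite ltn_eqF.
split=> [i j|i|i|j v].
- rewrite !ltnS => ik jk; have [ie|ine] := eqVneq i k; have [je|jne] := eqVneq j k.
  + by rewrite u1 ie je eqxx.
  + have jk' : (j < k)%N by rewrite ltn_neqAle jne.
    by rewrite (ipC dP) (Nu (Ordinal jk')) ie eq_sym neq.
  + have ik' : (i < k)%N by rewrite ltn_neqAle ine.
    by rewrite (Nu (Ordinal ik')) je neq.
  + by apply: on; rewrite ltn_neqAle ?ine ?jne.
- by rewrite ltnS => ik; have [_//|ine] := eqVneq i k; apply: eg; rewrite ltn_neqAle ine.
- by rewrite ltnS => ik; have [_//|ine] := eqVneq i k; apply: l0; rewrite ltn_neqAle ine.
- rewrite ltnS => jk hv; have [je|jne] := eqVneq j k.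
    apply: sP => i; have := hv i; rewrite je ltn_ord neq//; exact.
  have jk' : (j < k)%N by rewrite ltn_neqAle jne.
  apply: tl => // i ij; have := hv i ij; rewrite neq//.
  exact: ltn_trans jk'.
Qed.

(** The orthogonal matrix of the vectors found greedily diagonalizes A, which
    identifies the roots of the characteristic polynomial, hence the sorted list
    of them. *)
Lemma eigenvaluesP : size (eigenvalues A) = n /\
  exists f : 'I_n -> V, let lam i := eigenvalue_nth A i in
  [/\ forall i j, dot (f i) (f j) = (i == j)%:R,
      forall i : 'I_n, f i *m A = lam i *: f i,
      forall j : nat, 0 <= lam j & nonincreasing_seq lam].
Proof.
have [f [lam [on eg l0 tl]]] := greedy (leqnn n).
have dec i j : (i <= j)%N -> (j < n)%N -> lam j <= lam i.
  move=> ij jn; have in' := leq_ltn_trans ij jn.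
  have := tl i (f j) in'; rewrite /q eg// (ipZl dP) on// eqxx !mulr1; apply.
  by move=> l li; rewrite on ?(ltn_trans li)// ltn_eqF// (leq_trans li).
pose s := [seq lam i | i <- iota 0 n].
have ss : size s = n by rewrite size_map size_iota.
have sn i : (i < n)%N -> s`_i = lam i.
  by move=> h; rewrite (nth_map 0%N) ?size_iota// nth_iota// add0n.
have sorteds : sorted >=%R s.
  apply/(sortedP 0) => i; rewrite ss => h; rewrite !sn ?(ltnW h)//.
  exact: dec.
pose P : 'M[R]_n := \matrix_(i, j) f i 0 j.
have PP : P *m P^T = 1%:M.
  apply/matrixP => i j; rewrite !mxE -(on i j)//.
  by apply: eq_bigr => l _; rewrite !mxE.
have PA : P *m A = diag_mx (\row_i lam i) *m P.
  apply/row_matrixP => i; rewrite !row_mul row_diag_mx -scalemxAl -rowE mxE.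
  have -> : row i P = f i by apply/rowP => j; rewrite !mxE.
  exact: eg.
have detP : \det P != 0.
  have := congr1 determinant PP; rewrite det_mulmx det_tr det1 => h.
  by apply/eqP => P0; move: h; rewrite P0 mul0r => /esym/eqP; rewrite oner_eq0.
have chA : char_poly A = \prod_(a <- s) ('X - a%:P).
  pose Q := map_mx polyC P.
  have QA : Q *m char_poly_mx A = char_poly_mx (diag_mx (\row_i lam i)) *m Q.
    by rewrite /char_poly_mx mulmxBr mulmxBl scalar_mxC -!map_mxM PA.
  have := congr1 determinant QA; rewrite !det_mulmx mulrC.
  have Q0 : \det Q != 0 by rewrite det_map_mx polyC_eq0.
  move/(mulIf Q0); rewrite -/(char_poly A) -/(char_poly _) => ->.
  rewrite char_poly_trig ?diag_mx_is_trig//.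
  rewrite (eq_bigr (fun i : 'I_n => 'X - (lam i)%:P)) => [|i _]; last first.
    by rewrite !mxE eqxx.
  by rewrite -(big_mkord xpredT (fun i => 'X - (lam i)%:P)) /s big_map /index_iota subn0.
have sE : eigenvalues A = s.
  rewrite /eigenvalues; case: xgetP => [t _ [st cht]|/(_ s)]; last first.
    by move=> h; exfalso; apply: h; split.
  apply: (@sorted_eq _ >=%R) => //.
  - by move=> x y z xy yz; exact: le_trans yz xy.
  - by move=> x y; rewrite andbC; exact: le_anti.
  - by rewrite prod_XsubC_eq// -cht chA.
split; first by rewrite sE.
have lamE i : (i < n)%N -> eigenvalue_nth A i = lam i.
  by move=> h; rewrite /eigenvalue_nth sE sn.
have lam0 i : (n <= i)%N -> eigenvalue_nth A i = 0.
  by move=> h; rewrite /eigenvalue_nth nth_default// sE ss.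
have pos j : 0 <= eigenvalue_nth A j.
  by have [jn|nj] := ltnP j n; [rewrite lamE// l0|rewrite lam0].
exists (fun i : 'I_n => f i); split=> //=.
- by move=> i j; rewrite on.
- by move=> i; rewrite eg// lamE.
move=> i j ij; have [jn|nj] := ltnP j n; last by rewrite [leLHS]lam0.
by rewrite !lamE ?dec// (leq_ltn_trans ij).
Qed.

End SymmetricMatrix.

Section GramSpectrum.
Context {R : realType} {H : lmodType R}.
Variable ip : H -> H -> R.
Hypothesis ipP : semi_inner ip.
Variables (M : nat) (z : 'I_M -> H).

Let G : 'M[R]_M := \matrix_(m, l) ip (z m) (z l).

(** With orthonormal eigenvectors u_i of the Gram matrix, the vectors
    sum_m u_i(m) z_m are orthogonal with squared lengths lambda_i, and they
    diagonalize v |-> sum_m <z_m, v>^2. *)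
Lemma gram_diagonalizes (k : R) : 0 < k -> exists f,
  diagonalizes ip (fun v => k * \sum_m ip (z m) v ^+ 2) f
    (fun j => k * eigenvalue_nth G j).
Proof.
move=> k0.
have Gsym : G^T = G by apply/matrixP => i j; rewrite !mxE (ipC ipP).
pose psi (u : 'rV[R]_M) := \sum_m u 0 m *: z m.
have psiG u v : ip (psi u) (psi v) = dot (u *m G) v.
  rewrite /psi (ip_sumr ipP); apply: eq_bigr => j _.
  rewrite (ipZr ipP) (ip_suml ipP) mxE mulrC; congr (_ * _).
  by apply: eq_bigr => i _; rewrite (ipZl ipP) mxE.
have Gpsd (v : 'rV[R]_M) : 0 <= dot (v *m G) v by rewrite -psiG (ip_ge0 ipP).
have [sE [u [on eg pos dec]]] := eigenvaluesP Gsym Gpsd.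
set lam := eigenvalue_nth G in on eg pos dec *.
have lam0 j : (M <= j)%N -> lam j = 0.
  by move=> Mj; rewrite /lam /eigenvalue_nth nth_default// sE.
have psipsi i j : ip (psi (u i)) (psi (u j)) = (i == j)%:R * lam i.
  by rewrite psiG eg (ipZl semi_inner_dot) on mulrC.
pose c (v : H) : 'rV[R]_M := \row_m ip (z m) v.
have psic w v : ip (psi w) v = dot w (c v).
  rewrite (ip_suml ipP); apply: eq_bigr => m _.
  by rewrite (ipZl ipP) mxE.
have parseval v : \sum_m ip (z m) v ^+ 2 = \sum_i ip (psi (u i)) v ^+ 2.
  pose P : 'M[R]_M := \matrix_(i, j) u i 0 j.
  have PP : P *m P^T = 1%:M.
    apply/matrixP => i j; rewrite !mxE -(on i j).
    by apply: eq_bigr => l _; rewrite !mxE.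
  have PP' : P^T *m P = 1%:M by apply: mulmx1C.
  have h1 : \sum_m ip (z m) v ^+ 2 = (c v *m (c v)^T) 0 0.
    by rewrite mxE; apply: eq_bigr => m _; rewrite !mxE expr2.
  have h2 : \sum_i ip (psi (u i)) v ^+ 2 = (c v *m P^T *m (c v *m P^T)^T) 0 0.
    rewrite mxE; apply: eq_bigr => i _; rewrite [X in _ = _ * X]mxE -expr2 psic; congr (_ ^+ 2).
    by rewrite mxE; apply: eq_bigr => m _; rewrite !mxE mulrC.
  by rewrite h1 h2 trmx_mul trmxK mulmxA -(mulmxA _ P^T) PP' mulmx1.
pose f (j : nat) : H := if insub j is Some i then
  (if 0 < lam j then (Num.sqrt (lam j))^-1 *: psi (u i) else 0) else 0.
have fE (i : 'I_M) : f i = if 0 < lam i then (Num.sqrt (lam i))^-1 *: psi (u i) else 0.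
  by rewrite /f valK.
have f0 j : (M <= j)%N -> f j = 0 by move=> h; rewrite /f insubN// -leqNgt.
have fon i j : ip (f i) (f j) = (i == j)%:R * (0 < k * lam i)%R%:R.
  rewrite pmulr_rgt0//.
  have [iM|Mi] := ltnP i M; last by rewrite f0// (ip0l ipP) lam0// ltxx mulr0.
  have [<-{j}|ij] := eqVneq i j.
    rewrite (fE (Ordinal iM)) /=.
    have [li|li] := ltrP 0 (lam i); last by rewrite (ip0l ipP) mulr0.
    rewrite (ipZl ipP) (ipZr ipP) psipsi eqxx !mul1r.
    by rewrite mulrA -expr2 exprVn sqr_sqrtr ?ltW// mulVf// gt_eqF.
  have [jM|Mj] := ltnP j M; last by rewrite (f0 j)// (ip0r ipP) mul0r.
  rewrite (fE (Ordinal iM)) (fE (Ordinal jM)) /= mul0r.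
  case: ifP => _; last by rewrite (ip0l ipP).
  case: ifP => _; last by rewrite (ip0r ipP).
  by rewrite (ipZl ipP) (ipZr ipP) psipsi -val_eqE/= (negbTE ij) mul0r !mulr0.
have psif (i : 'I_M) v : ip (psi (u i)) v = Num.sqrt (lam i) * ip (f i) v.
  rewrite fE; have [li|li] := ltrP 0 (lam i).
    by rewrite (ipZl ipP) mulrA mulfV ?mul1r// sqrtr_eq0 -ltNge.
  rewrite (ip0l ipP) mulr0 (ip_null ipP)// psipsi eqxx mul1r.
  by apply: le_anti; rewrite li pos.
have qE N v : (M <= N)%N ->
    k * \sum_m ip (z m) v ^+ 2 = \sum_(i < N) k * lam i * ip (f i) v ^+ 2.
  move=> MN; rewrite parseval mulr_sumr [RHS](bigID (fun i : 'I_N => (i < M)%N))/=.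
  rewrite [X in _ + X]big1 => [|i]; last first.
    by rewrite -leqNgt => Mi; rewrite lam0// mulr0 mul0r.
  rewrite addr0 -(big_ord_widen N (fun i => k * lam i * ip (f i) v ^+ 2))//.
  by apply: eq_bigr => i _; rewrite psif exprMn sqr_sqrtr// mulrA.
exists f; split=> //.
- split; last by move=> j; rewrite mulr_ge0// ltW.
  by move=> i j ij; rewrite ler_pM2l// dec.
- move=> j cc; rewrite (qE (M + j)%N) ?leq_addr//.
  pose F (i : nat) := oapp cc 0 (insub i) ^+ 2 * (k * lam i).
  rewrite [RHS](eq_bigr (fun i : 'I_j => F i)) => [|i _]; last by rewrite /F valK.
  rewrite (big_ord_widen (M + j) F) ?leq_addl// [RHS]big_mkcond/=; apply: eq_bigr.
  move=> i _; rewrite (ip_sumr ipP).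
  have [ij|ji] := ltnP i j.
    rewrite /F insubT/= (bigD1 (Ordinal ij))//= big1 => [|l li].
      rewrite addr0 (ipZr ipP) fon eqxx mul1r [RHS]mulrC.
      have [//|nl] := ltrP 0 (k * lam i); first by rewrite mulr1.
      have -> : k * lam i = 0 by apply: le_anti; rewrite nl mulr_ge0// ltW.
      by rewrite !mul0r.
    have il : (i == l :> nat) = false by apply/negbTE; rewrite eq_sym; exact: li.
    by rewrite (ipZr ipP) fon il mul0r mulr0.
  rewrite big1 ?expr0n ?mulr0// => l _.
  by rewrite (ipZr ipP) fon gtn_eqF ?mul0r ?mulr0// (leq_trans (ltn_ord l)).
- move=> j v hv; rewrite -mulrA ler_wpM2l ?(ltW k0)// parseval.
  pose e (i : 'I_M) := if (i < j)%N then 0 else psi (u i).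
  rewrite (eq_bigr (fun i => ip (e i) v ^+ 2)); last first.
    by move=> i _; rewrite /e; case: ltnP => // ij; rewrite psif hv// mulr0 (ip0l ipP).
  apply: (bessel ipP (k := fun i => if (i < j)%N then 0 else lam i)) => // i.
    by case: ltnP => ij; rewrite ?lexx ?pos// dec.
  move=> l; rewrite /e; case: ltnP => ij; first by rewrite (ip0l ipP) mulr0.
  case: ltnP => lj; last by rewrite psipsi.
  rewrite (ip0r ipP) -val_eqE/= gtn_eqF ?mul0r//.
  exact: leq_trans lj _.
Qed.

End GramSpectrum.

(** * The space L^2 of a probability measure *)

Notation rintegrable mu f := (mu.-integrable setT (EFin \o f)).
Notation Hspace mu := (LfunType mu (lee1n 2)).

Section RealIntegrals.
Context {d} {X : measurableType d} {R : realType}.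
Variable mu : {measure set X -> \bar R}.
Implicit Types f g : X -> R.

Lemma rintegrable_measurable f : rintegrable mu f -> measurable_fun setT f.
Proof. by move=> /measurable_int /measurable_EFinP. Qed.

Lemma rintegrable_EFin f : rintegrable mu f ->
  (\int[mu]_x (f x)%:E)%E = (\int[mu]_x f x)%R%:E.
Proof. by move=> fi; rewrite /Rintegral fineK//; exact: integrable_fin_num. Qed.

Lemma rintegrable_le f g : measurable_fun setT f -> rintegrable mu g ->
  (forall x, `|f x| <= g x) -> rintegrable mu f.
Proof.
move=> mf ig fg; apply: (le_integrable _ _ _ ig) => //; first exact/measurable_EFinP.
by move=> x _ /=; rewrite lee_fin (le_trans (fg x))// ler_norm.
Qed.

Lemma rintegrableD f g : rintegrable mu f -> rintegrable mu g ->
  rintegrable mu (fun x => f x + g x).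
Proof. by move=> fi gi; have := integrableD measurableT fi gi. Qed.

Lemma rintegrableB f g : rintegrable mu f -> rintegrable mu g ->
  rintegrable mu (fun x => f x - g x).
Proof. by move=> fi gi; have := integrableB measurableT fi gi. Qed.

Lemma rintegrableZl f r : rintegrable mu f -> rintegrable mu (fun x => r * f x).
Proof. by move=> fi; have := integrableZl measurableT r fi. Qed.

Lemma rintegrable_sum (I : Type) (s : seq I) (P : pred I) (f : I -> X -> R) :
  (forall i, rintegrable mu (f i)) ->
  rintegrable mu (fun x => \sum_(i <- s | P i) f i x).
Proof.
move=> fi; have := @integrable_sum _ _ _ mu _ measurableT I s P (fun i => EFin \o f i).
move=> /(_ (fun i _ => fi i)); apply: eq_integrable => // x _.
by rewrite /= sumEFin.
Qed.

Lemma Rintegral_sum (I : Type) (s : seq I) (P : pred I) (f : I -> X -> R) :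
  (forall i, rintegrable mu (f i)) ->
  \int[mu]_x (\sum_(i <- s | P i) f i x) = \sum_(i <- s | P i) \int[mu]_x f i x.
Proof.
move=> fi; apply: EFin_inj; rewrite -rintegrable_EFin; last exact: rintegrable_sum.
under eq_integral do rewrite -sumEFin.
rewrite integral_sum//.
by rewrite -sumEFin; apply: eq_bigr => i Pi; rewrite rintegrable_EFin.
Qed.

Lemma Rintegral_ae_eq f g : measurable_fun setT f -> measurable_fun setT g ->
  f = g %[ae mu] -> \int[mu]_x f x = \int[mu]_x g x.
Proof.
move=> mf mg fg; congr fine; apply: ae_eq_integral => //.
- exact/measurable_EFinP.
- exact/measurable_EFinP.
- by apply: filterS fg => x /= -> // _.
Qed.

End RealIntegrals.

Section BoundedIntegrable.
Context {d} {X : measurableType d} {R : realType}.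
Variable mu : probability X R.
Implicit Types f g : X -> R.

Lemma rintegrable_cst (K : R) : rintegrable mu (fun=> K).
Proof. exact: finite_measure_integrable_cst. Qed.

Lemma rintegrable_bounded f K : measurable_fun setT f -> (forall x, `|f x| <= K) ->
  rintegrable mu f.
Proof. by move=> mf; exact: rintegrable_le (rintegrable_cst K). Qed.

Lemma Rintegral_bounded f K : measurable_fun setT f -> (forall x, f x <= K) ->
  rintegrable mu f -> \int[mu]_x f x <= K.
Proof.
move=> mf fK fi; have -> : K = \int[mu]_x (cst K x).
  by rewrite Rintegral_cst// [X in fine X]probability_setT mulr1.
by apply: le_Rintegral => //; exact: rintegrable_cst.
Qed.

End BoundedIntegrable.

Section L2Space.
Context {d} {X : measurableType d} {R : realType}.
Variable mu : probability X R.
Notation H := (Hspace mu).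
Implicit Types f g : X -> R.

Lemma L2_sqr f : L2 mu f -> rintegrable mu (fun x => f x ^+ 2).
Proof. exact: Lfun2_integrable_sqr. Qed.

Lemma L2_measurable f : L2 mu f -> measurable_fun setT f.
Proof. by rewrite /L2/= inE => /andP[] /[!inE]. Qed.

Lemma L2_mul f g : L2 mu f -> L2 mu g -> rintegrable mu (fun x => f x * g x).
Proof. by move=> hf hg; apply/Lfun1_integrable; exact: Lfun2_mul_Lfun1. Qed.

Lemma L2norm_sqr f : rintegrable mu (fun x => f x ^+ 2) ->
  L2norm mu f = (Num.sqrt (L2inner mu f f))%:E.
Proof.
move=> fi; rewrite /L2norm unlock.
rewrite (eq_integral (fun x => (f x ^+ 2)%:E)) => [|x _]; last first.
  by rewrite /= powR_mulrn// -normrX ger0_norm// sqr_ge0.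
rewrite rintegrable_EFin// poweR_EFin powR12_sqrt; last first.
  by apply: Rintegral_ge0 => x _; exact: sqr_ge0.
by congr (Num.sqrt _)%:E; apply: eq_Rintegral => x _; rewrite expr2.
Qed.

Lemma L2I f : measurable_fun setT f -> rintegrable mu (fun x => f x ^+ 2) -> L2 mu f.
Proof.
move=> mf fi; rewrite /L2/= inE; apply/andP; split; rewrite inE//=.
by rewrite /finite_norm -/(L2norm mu f) L2norm_sqr// ltry.
Qed.

Lemma L2normE f : L2 mu f -> L2norm mu f = (Num.sqrt (L2inner mu f f))%:E.
Proof. by move=> /L2_sqr; exact: L2norm_sqr. Qed.

Lemma L2_integrable f : L2 mu f -> rintegrable mu f.
Proof.
move=> hf; apply/Lfun1_integrable; apply: Lfun_subset12 hf.
exact: fin_num_measure.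
Qed.

Lemma L2_le f g : measurable_fun setT f -> L2 mu g -> (forall x, `|f x| <= `|g x|) ->
  L2 mu f.
Proof.
move=> mf hg fg; apply: L2I => //; apply: rintegrable_le (L2_sqr hg) _.
  exact: measurable_funX.
by move=> x; rewrite normrX -[leRHS]ger0_norm ?sqr_ge0// normrX lerXn2r ?nnegrE.
Qed.

Lemma L2_cst (r : R) : L2 mu (fun=> r).
Proof. exact: Lfun_cst. Qed.

(** The bundled form of a square-integrable function: the results on semi-inner
    products apply to the module of such functions. *)
Definition toH f (hf : L2 mu f) : H := Lfun_Sub (lee1n 2) hf.

Lemma HL2 (v : H) : L2 mu v. Proof. exact: LfunP. Qed.

Definition hip (u v : H) : R := L2inner mu u v.

Lemma semi_inner_hip : semi_inner hip.
Proof.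
split=> [u v|a u v w|u].
- by apply: eq_Rintegral => x _; rewrite mulrC.
- rewrite /hip /L2inner -RintegralZl//; last exact/L2_mul/HL2/HL2.
  rewrite -RintegralD//; last 2 first.
  - by apply: rintegrableZl; exact/L2_mul/HL2/HL2.
  - exact/L2_mul/HL2/HL2.
  by apply: eq_Rintegral => x _ /=; rewrite mulrA -mulrDl.
- by apply: Rintegral_ge0 => x _; rewrite -expr2 sqr_ge0.
Qed.

Lemma sum_hE n (c : 'I_n -> R) (e : 'I_n -> H) (P : pred 'I_n) :
  (\sum_(i | P i) c i *: e i : H) = (fun x => \sum_(i | P i) c i * e i x) :> (X -> R).
Proof.
apply/funext => x; elim/big_ind2 : _ => // u a v b; first by move=> <- <-.
Qed.

Lemma L2_comb n (c : 'I_n -> R) (e : 'I_n -> X -> R) :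
  (forall i, L2 mu (e i)) -> L2 mu (fun x => \sum_i c i * e i x).
Proof.
move=> he; rewrite -(sum_hE c (fun i => toH (he i))) ; exact: HL2.
Qed.

Lemma L2inner_ae_eq f f' g : L2 mu f -> L2 mu f' -> L2 mu g ->
  f = f' %[ae mu] -> L2inner mu f g = L2inner mu f' g.
Proof.
move=> hf hf' hg ff'; apply: Rintegral_ae_eq.
- by apply: measurable_funM; exact: L2_measurable.
- by apply: measurable_funM; exact: L2_measurable.
- by apply: filterS ff' => x /= ->.
Qed.

Lemma L2inner0_ae f : L2 mu f -> L2inner mu f f = 0 -> f = (fun=> 0) %[ae mu].
Proof.
move=> hf f0; apply: (@fine_Lnormr_eq0 _ _ _ mu 2%:E (lee1n 2) (toH hf)).
by rewrite -/(L2norm mu f) L2normE// f0 sqrtr0.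
Qed.

Lemma L2inner_cs f g : L2 mu f -> L2 mu g ->
  L2inner mu f g ^+ 2 <= L2inner mu f f * L2inner mu g g.
Proof. by move=> hf hg; exact: (cauchy_schwarz semi_inner_hip (toH hf) (toH hg)). Qed.

(** Riesz-Fischer: the increments are summable in L^1, so the sequence converges
    almost everywhere, and Fatou's lemma carries the distances to the limit. *)
Lemma hip_fast_complete : fast_complete hip.
Proof.
move=> w hw.
pose g k x := `|w k.+1 x - w k x|.
have hP := semi_inner_hip.
have gL2 k : L2 mu (g k).
  apply: (L2_le _ (HL2 (w k.+1 - w k))); last by move=> x; rewrite normr_id.
  by apply: measurableT_comp => //; apply: measurable_funB; exact/L2_measurable/HL2.
have gm k : measurable_fun setT (EFin \o g k) by exact/measurable_EFinP/L2_measurable.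
have ig k : (\int[mu]_x (g k x)%:E <= (2^-1 ^+ k)%:E)%E.
  rewrite rintegrable_EFin; last exact: L2_integrable.
  rewrite lee_fin -ler_sqr ?nnegrE ?exprn_ge0//; last first.
    by apply: Rintegral_ge0 => x _; exact: normr_ge0.
  have -> : \int[mu]_x g k x = L2inner mu (g k) (fun=> 1).
    by apply: eq_Rintegral => x _; rewrite mulr1.
  apply: (le_trans (L2inner_cs (gL2 k) (L2_cst 1))).
  have -> : L2inner mu (fun=> 1) (fun=> 1) = 1.
    by rewrite /L2inner mulr1 Rintegral_cst// [X in fine X]probability_setT mulr1.
  rewrite mulr1 -exprM mulnC exprM exprVn -natrX.
  have -> : L2inner mu (g k) (g k) = hip (w k - w k.+1) (w k - w k.+1).
    apply: eq_Rintegral => x _; rewrite -!expr2 /g real_normK ?num_real//=.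
    by rewrite -sqrrN opprB.
  exact: hw.
pose S x := (\sum_(k <oo) (g k x)%:E)%E.
have g0 k x : (0 <= (g k x)%:E)%E by rewrite lee_fin normr_ge0.
have mS : measurable_fun setT S.
  apply: (@ge0_emeasurable_sum _ X R setT (fun k x => (g k x)%:E) predT) => //.
  by move=> k _; exact: gm.
have S0 x : (0 <= S x)%E by apply: nneseries_ge0 => k _ _; exact: g0.
have iS : mu.-integrable setT S.
  apply/integrableP; split=> //.
  under eq_integral do rewrite gee0_abs//.
  rewrite integral_nneseries//.
  apply: (@le_lt_trans _ _ (\sum_(k <oo) (2^-1 ^+ k)%:E)%E).
    by apply: lee_nneseries => [k _ _|k _]; [apply: integral_ge0|exact: ig].
  have -> : (\sum_(k <oo) (2^-1 ^+ k)%:E)%E = (1 * (1 - 2^-1)^-1)%:E :> \bar R.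
    apply/cvg_lim => //.
    rewrite (_ : (fun n => _) = EFin \o series (geometric 1 2^-1)).
      apply: cvg_EFin; first exact: nearW.
      by apply: cvg_geometric_series; rewrite gtr0_norm// invf_lt1// ltr1n.
    apply/funext => m; rewrite /= -sumEFin /series/=.
    by apply: eq_bigr => i _; rewrite /= mul1r.
  exact: ltry.
pose E := [set x | S x \is a fin_num].
have mE : measurable E by rewrite -[E]setTI; exact: emeasurable_fin_num.
have aeE : {ae mu, forall x, E x}.
  by apply: filterS (integrable_ae measurableT iS) => x /(_ I).
have cw x : E x -> cvgn (fun k => w k x).
  move=> Ex; have cg : cvgn (series (fun k => w k.+1 x - w k x)).
    apply: normed_cvg; apply: nondecreasing_is_cvgn.
      by apply: nondecreasing_series => k _ _; exact: normr_ge0.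
    exists (fine (S x)) => _ [m _ <-]; rewrite -lee_fin fineK// /series/= -sumEFin.
    by apply: nneseries_lim_ge => k _ _; exact: g0.
  have : cvgn (fun k => series (fun k => w k.+1 x - w k x) k + w 0%N x).
    by apply: is_cvgD => //; exact: is_cvg_cst.
  rewrite (_ : (fun k => _) = (fun k => w k x))//; apply/funext => k.
  by rewrite /series/= (telescope_sumr (fun k => w k x))// subrK.
pose u x := if x \in E then limn (fun k => w k x) else 0.
have wu x : E x -> (fun k => w k x) @ \oo --> u x.
  by move=> Ex; rewrite /u mem_set//; exact: cw.
have mu_ : measurable_fun setT u.
  apply: (@measurable_fun_cvg _ _ _ _ (fun k x => w k x * \1_E x)).
    move=> k; apply: measurable_funM; first exact/L2_measurable/HL2.
    exact: measurable_indic.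
  move=> x _; have [Ex|nEx] := pselect (E x).
    rewrite (_ : (fun k => _) = (fun k => w k x)); first exact: wu.
    by apply/funext => k; rewrite indicE mem_set// mulr1.
  rewrite /u memNset// (_ : (fun k => _) = cst 0); first exact: cvg_cst.
  by apply/funext => k; rewrite indicE memNset// mulr0.
have fat k : (\int[mu]_x (((w k x - u x) ^+ 2)%:E) <= (4^-1 ^+ k)%:E)%E.
  pose h l x := (((w k x - w l x) ^+ 2)%:E : \bar R).
  have mh l : measurable_fun setT (h l).
    apply/measurable_EFinP/measurable_funX/measurable_funB; exact/L2_measurable/HL2.
  have ->: (\int[mu]_x (((w k x - u x) ^+ 2)%:E) = \int[mu]_x (limn_einf (h ^~ x)))%E.
    apply: ae_eq_integral => //.
    - apply/measurable_EFinP/measurable_funX/measurable_funB; last exact: mu_.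
      exact/L2_measurable/HL2.
    - by apply: measurableT_comp => //; apply: measurable_fun_limn_esup => l; exact: measurableT_comp.
    apply: filterS aeE => x Ex _; apply/esym.
    suff hx : h ^~ x @ \oo --> ((w k x - u x) ^+ 2)%:E.
      by rewrite is_cvg_limn_einfE ?(cvg_lim _ hx)//; apply/cvg_ex; eexists; exact: hx.
    apply: cvg_EFin; first exact: nearW.
    have : (fun l => w k x - w l x) @ \oo --> w k x - u x.
      by apply: cvgB; [exact: cvg_cst|exact: wu].
    by move=> h1; exact: (cvgM h1 h1).
  have h0 l x : setT x -> (0 <= h l x)%E by move=> _; rewrite lee_fin sqr_ge0.
  apply: (le_trans (fatou mu measurableT mh h0)).
  have hl l : (k <= l)%N -> (\int[mu]_x h l x <= (4^-1 ^+ k)%:E)%E.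
    move=> kl; rewrite rintegrable_EFin; last exact: (L2_sqr (HL2 (w k - w l))).
    rewrite lee_fin; apply: le_trans (hw k l kl); rewrite le_eqVlt; apply/orP; left.
    by apply/eqP/eq_Rintegral => x _; rewrite expr2.
  rewrite limn_einf_lim; apply: lime_le; first exact: is_cvg_einfs.
  apply: nearW => m; apply: le_trans (hl (maxn m k) (leq_maxr _ _)).
  by apply: ereal_inf_lbound; exists (maxn m k) => //=; rewrite leq_maxl.
have wuL2 k : L2 mu (fun x => w k x - u x).
  have mwu : measurable_fun setT (fun x => w k x - u x).
    by apply: measurable_funB => //; exact/L2_measurable/HL2.
  apply: L2I => //; apply/integrableP; split.
    exact/measurable_EFinP/measurable_funX.
  apply: le_lt_trans (ltry _); apply: le_trans (fat k).
  by under eq_integral do rewrite gee0_abs ?lee_fin ?sqr_ge0//.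
have uL2 : L2 mu u.
  have -> : u = (w 0%N - toH (wuL2 0%N) : H).
    by apply/funext => x /=; rewrite opprB addrC subrK.
  exact: HL2.
exists (toH uL2) => k; rewrite -lee_fin; apply: le_trans (fat k).
rewrite rintegrable_EFin; last exact: (L2_sqr (wuL2 k)).
by rewrite lee_fin le_eqVlt; apply/orP; left; apply/eqP/eq_Rintegral => x _; rewrite expr2.
Qed.

End L2Space.

(** * Product probabilities and Fubini's theorem *)

Section ProductProbability.
Context {d1 d2} {T1 : measurableType d1} {T2 : measurableType d2} {R : realType}.
Variables (P1 : probability T1 R) (P2 : probability T2 R).

(** The product measure as a probability, so that the results on L^2 apply to it. *)
Definition prodP : set (T1 * T2) -> \bar R := (P1 \x P2)%E.

HB.instance Definition _ := Measure.on prodP.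

Let prodP_setT : prodP setT = 1%E.
Proof.
by rewrite -setXTT /prodP product_measure1E// ![X in (X * _)%E]probability_setT mul1e
  [LHS]probability_setT.
Qed.

HB.instance Definition _ := Measure_isProbability.Build _ _ _ prodP prodP_setT.

End ProductProbability.

Section RealFubini.
Context {d1 d2} {T1 : measurableType d1} {T2 : measurableType d2} {R : realType}.

Lemma measurable_Rintegral_section (P2 : probability T2 R) (f : T1 -> T2 -> R) :
  measurable_fun setT (fun p : T1 * T2 => f p.1 p.2) ->
  measurable_fun setT (fun x => \int[P2]_y f x y).
Proof.
move=> mf; pose F (p : T1 * T2) := (f p.1 p.2)%:E.
have mF : measurable_fun setT F by exact/measurable_EFinP.
apply: (@measurableT_comp _ _ _ _ _ _ fine _ (fun x => \int[P2]_y F (x, y))%E) => //.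
rewrite (_ : (fun x => _) = (fun x => \int[P2]_y (F^\+ (x, y)) - \int[P2]_y (F^\- (x, y)))%E).
  apply: emeasurable_funB; apply: measurable_fun_fubini_tonelli_F => //.
    exact: measurable_funepos.
  exact: measurable_funeneg.
apply/funext => x; rewrite integralE.
by congr (_ - _)%E; apply: eq_integral => y _; rewrite (funepos_comp, funeneg_comp).
Qed.

Lemma measurable_section1 (f : T1 -> T2 -> R) x :
  measurable_fun setT (fun p : T1 * T2 => f p.1 p.2) -> measurable_fun setT (f x).
Proof. by move=> mf; exact: (measurableT_comp mf (pair1_measurable x)). Qed.

Lemma measurable_section2 (f : T1 -> T2 -> R) y :
  measurable_fun setT (fun p : T1 * T2 => f p.1 p.2) -> measurable_fun setT (f^~ y).
Proof. by move=> mf; exact: (measurableT_comp mf (pair2_measurable y)). Qed.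

Variables (P1 : probability T1 R) (P2 : probability T2 R) (f : T1 -> T2 -> R) (K : R).
Hypotheses (mf : measurable_fun setT (fun p : T1 * T2 => f p.1 p.2))
  (f1 : forall x, rintegrable P2 (f x)) (f2 : forall y, rintegrable P1 (f^~ y))
  (fK : forall x, \int[P2]_y `|f x y| <= K).

Let rint_abs x : rintegrable P2 (fun y => `|f x y|).
Proof. exact: integrable_norm (f1 x). Qed.

Lemma rintegrable_prod : rintegrable (prodP P1 P2) (fun p => f p.1 p.2).
Proof.
apply/(integrable12ltyP P1 P2); first exact/measurable_EFinP.
apply: (@le_lt_trans _ _ (\int[P1]_x (K%:E))%E); last first.
  by rewrite integral_cst// [X in (_ * X)%E]probability_setT mule1 ltry.
apply: ge0_le_integral => //.
- by move=> x _; apply: integral_ge0.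
- have := @measurable_fun_fubini_tonelli_F _ _ T1 T2 R P2 (fun p => `|f p.1 p.2|%:E).
  apply => //; apply/measurable_EFinP; exact: measurableT_comp.
- by move=> x _ /=; rewrite (rintegrable_EFin (rint_abs x)) lee_fin.
Qed.

Let eF1 x : (\int[P2]_y (f x y)%:E)%E = (\int[P2]_y f x y)%:E.
Proof. exact: rintegrable_EFin. Qed.

Let eF2 y : (\int[P1]_x (f x y)%:E)%E = (\int[P1]_x f x y)%:E.
Proof. exact: rintegrable_EFin. Qed.

Lemma rintegrable_Rintegral1 : rintegrable P1 (fun x => \int[P2]_y f x y).
Proof.
have := integrable_fubini_F rintegrable_prod.
by apply: eq_integrable => // x _; rewrite /fubini_F /= eF1.
Qed.

Lemma rintegrable_Rintegral2 : rintegrable P2 (fun y => \int[P1]_x f x y).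
Proof.
have h := integral21_prod_meas1 rintegrable_prod.
have : P2.-integrable setT (fubini_G P1 (EFin \o fun p : T1 * T2 => f p.1 p.2)).
  apply/integrableP; split; first exact: measurable_fubini_G rintegrable_prod.
  have /(integrable21ltyP P1 P2) := rintegrable_prod.
  move=> /(_ (proj2 (measurable_EFinP _ _) mf)); apply: le_lt_trans.
  apply: ge0_le_integral => //.
  - apply: measurableT_comp => //; exact: measurable_fubini_G rintegrable_prod.
  - have := @measurable_fun_fubini_tonelli_G _ _ T1 T2 R P1 (fun p => `|f p.1 p.2|%:E).
    apply => //; apply/measurable_EFinP; exact: measurableT_comp.
  - move=> y _; apply: le_abse_integral => //.
    by apply/measurable_EFinP; exact: measurable_section2.
by apply: eq_integrable => // y _; rewrite /fubini_G /= eF2.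
Qed.

Lemma Rfubini : \int[P1]_x (\int[P2]_y f x y) = \int[P2]_y (\int[P1]_x f x y).
Proof.
congr fine; have := Fubini rintegrable_prod => /=.
under eq_integral do rewrite eF1.
by under [RHS]eq_integral do rewrite eF2.
Qed.

Lemma Rfubini_prod :
  \int[prodP P1 P2]_p f p.1 p.2 = \int[P1]_x (\int[P2]_y f x y).
Proof.
congr fine; have := integral12_prod_meas1 rintegrable_prod => /= <-.
by apply: eq_integral => x _; rewrite /fubini_F /= eF1.
Qed.

End RealFubini.

(** * Random elements of L^2 *)

Section Fields.
Context {d1 d2} {Th : measurableType d1} {X : measurableType d2} {R : realType}.
Variables (rho : probability Th R) (mu : probability X R).

(** Joint measurability and the bound b, uniform in the parameter, give meaning to
    the mean at every point and allow the integrals to be exchanged; C plays the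
    role of R_zeta. *)
Record bounded_field (Z : Th -> X -> R) (b : X -> R) (C : R) : Prop := BoundedField {
  field_measurable : measurable_fun setT (fun p : Th * X => Z p.1 p.2) ;
  field_bound : forall t x, `|Z t x| <= b x ;
  field_L2 : forall t, L2 mu (Z t) ;
  field_sqnorm : forall t, L2inner mu (Z t) (Z t) <= C }.

Definition field_mean (Z : Th -> X -> R) (x : X) : R := \int[rho]_t Z t x.

Section OneField.
Variables (Z : Th -> X -> R) (b : X -> R) (C : R).
Hypothesis ZP : bounded_field Z b C.

Let mZ := field_measurable ZP.

Lemma field_C_ge0 : 0 <= C.
Proof.
apply: le_trans (field_sqnorm ZP point).
by apply: Rintegral_ge0 => x _; rewrite -expr2 sqr_ge0.
Qed.

Lemma field_rintegrable2 x : rintegrable rho (Z^~ x).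
Proof.
apply: (@rintegrable_bounded _ _ _ rho _ (b x)); first exact: measurable_section2.
by move=> t; exact: (field_bound ZP).
Qed.

Lemma field_sqr_rintegrable2 x : rintegrable rho (fun t => Z t x ^+ 2).
Proof.
apply: (@rintegrable_bounded _ _ _ rho _ (b x ^+ 2)).
  by apply: measurable_funX; exact: measurable_section2.
move=> t; rewrite normrX lerXn2r ?nnegrE//; last exact: (field_bound ZP).
exact: le_trans (field_bound ZP t x).
Qed.

Lemma measurable_field_mul (u : X -> R) : measurable_fun setT u ->
  measurable_fun setT (fun p : Th * X => Z p.1 p.2 * u p.2).
Proof.
by move=> hu; apply: measurable_funM => //; exact: measurableT_comp hu measurable_snd.
Qed.

Lemma measurable_field_inner (u : X -> R) : L2 mu u ->
  measurable_fun setT (fun t => L2inner mu (Z t) u).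
Proof.
move=> hu; apply: (@measurable_Rintegral_section _ _ Th X R mu (fun t x => Z t x * u x)).
by apply: measurable_field_mul; exact: L2_measurable hu.
Qed.

Lemma field_inner_le (u : X -> R) t : L2 mu u ->
  L2inner mu (Z t) u ^+ 2 <= C * L2inner mu u u.
Proof.
move=> hu; rewrite (le_trans (L2inner_cs (field_L2 ZP t) hu))//.
rewrite ler_wpM2r//; last exact: (field_sqnorm ZP).
by apply: Rintegral_ge0 => x _; rewrite -expr2 sqr_ge0.
Qed.

Lemma field_inner_abs (u : X -> R) t : L2 mu u ->
  `|L2inner mu (Z t) u| <= Num.sqrt (C * L2inner mu u u).
Proof.
by move=> hu; rewrite -sqrtr_sqr ler_wsqrtr// field_inner_le.
Qed.

(** Fubini applies because |Z u| <= Z^2 + u^2, whose integral over X is bounded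
    uniformly in the parameter. *)
Lemma field_mean_inner (u : X -> R) : L2 mu u ->
  L2inner mu (field_mean Z) u = \int[rho]_t L2inner mu (Z t) u.
Proof.
move=> hu; rewrite /L2inner.
rewrite (@Rfubini _ _ _ _ _ rho mu (fun t x => Z t x * u x) (C + L2inner mu u u)) //.
- apply: eq_Rintegral => x _; rewrite -RintegralZr//; exact: field_rintegrable2.
- by apply: measurable_field_mul; exact: L2_measurable hu.
- move=> t; exact/L2_mul/hu/(field_L2 ZP).
- move=> x; have := rintegrableZl (u x) (field_rintegrable2 x).
  by apply: eq_integrable => // t _ /=; rewrite mulrC.
move=> t; apply: (@le_trans _ _ (\int[mu]_x (Z t x ^+ 2 + u x ^+ 2))).
  apply: le_Rintegral => //.
  - exact/integrable_norm/L2_mul/hu/(field_L2 ZP).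
  - by apply: rintegrableD; apply: L2_sqr => //; exact: (field_L2 ZP).
  - move=> x _; rewrite normrM; have := sqr_ge0 (`|Z t x| - `|u x|).
    rewrite sqrrB !real_normK ?num_real//.
    have := sqr_ge0 (Z t x); have := sqr_ge0 (u x); move: (`|_| * _) => r; lra.
rewrite RintegralD//; last 2 first.
- exact/L2_sqr/(field_L2 ZP).
- exact: L2_sqr.
rewrite lerD//; apply: le_trans (field_sqnorm ZP t);
  by rewrite /L2inner; under eq_Rintegral do rewrite expr2.
Qed.

Lemma field_sqr_fubini : [/\ rintegrable rho (fun t => L2inner mu (Z t) (Z t)),
  rintegrable mu (fun x => \int[rho]_t (Z t x ^+ 2)) &
  \int[rho]_t L2inner mu (Z t) (Z t) = \int[mu]_x (\int[rho]_t (Z t x ^+ 2))].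
Proof.
have m2 : measurable_fun setT (fun p : Th * X => Z p.1 p.2 ^+ 2).
  exact: measurable_funX.
have h1 t : rintegrable mu (fun x => Z t x ^+ 2) by exact/L2_sqr/(field_L2 ZP).
have hK t : \int[mu]_x `|Z t x ^+ 2| <= C.
  apply: le_trans (field_sqnorm ZP t); rewrite le_eqVlt; apply/orP; left; apply/eqP.
  by apply: eq_Rintegral => x _; rewrite ger0_norm ?sqr_ge0// expr2.
have e t : L2inner mu (Z t) (Z t) = \int[mu]_x (Z t x ^+ 2).
  by apply: eq_Rintegral => x _; rewrite expr2.
split.
- by under eq_fun do rewrite e; exact: rintegrable_Rintegral1 m2 h1 hK.
- exact: rintegrable_Rintegral2 m2 h1 field_sqr_rintegrable2 hK.
- by under eq_Rintegral do rewrite e; exact: Rfubini m2 h1 field_sqr_rintegrable2 hK.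
Qed.

Lemma field_mean_measurable : measurable_fun setT (field_mean Z).
Proof.
apply: (@measurable_Rintegral_section _ _ X Th R rho (fun x t => Z t x)).
have ms : measurable_fun setT (fun p : X * Th => (p.2, p.1)) by exact: measurable_swap.
exact: (measurableT_comp mZ ms).
Qed.

Lemma field_mean_sqr_le x : field_mean Z x ^+ 2 <= \int[rho]_t (Z t x ^+ 2).
Proof.
have hz : L2 rho (Z^~ x).
  by apply: L2I; [exact: measurable_section2|exact: field_sqr_rintegrable2].
have := L2inner_cs hz (L2_cst rho 1).
have -> : L2inner rho (Z^~ x) (fun=> 1) = field_mean Z x.
  by apply: eq_Rintegral => t _; rewrite mulr1.
have -> : L2inner rho (fun=> 1) (fun=> 1) = 1.
  by rewrite /L2inner mulr1 Rintegral_cst// [X in fine X]probability_setT mulr1.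
by rewrite mulr1 /L2inner; under eq_Rintegral do rewrite -expr2.
Qed.

(** Jensen's inequality at each point, integrated over X. *)
Lemma field_mean_L2 : L2 mu (field_mean Z) /\
  L2inner mu (field_mean Z) (field_mean Z) <= \int[rho]_t L2inner mu (Z t) (Z t).
Proof.
have [i1 i2 e] := field_sqr_fubini.
have im : rintegrable mu (fun x => field_mean Z x ^+ 2).
  apply: rintegrable_le i2 _; first exact/measurable_funX/field_mean_measurable.
  by move=> x; rewrite ger0_norm ?sqr_ge0// field_mean_sqr_le.
split; first by apply: L2I => //; exact: field_mean_measurable.
rewrite e /L2inner; under eq_Rintegral do rewrite -expr2.
by apply: le_Rintegral => // x _; exact: field_mean_sqr_le.
Qed.

Lemma field_sqnorm_mean : \int[rho]_t L2inner mu (Z t) (Z t) <= C.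
Proof.
have [i1 _ _] := field_sqr_fubini.
apply: Rintegral_bounded => //; first exact: rintegrable_measurable i1.
by move=> t; exact: (field_sqnorm ZP).
Qed.

Lemma field_scale (g : Th -> R) (K : R) : measurable_fun setT g ->
  (forall t, `|g t| <= K) ->
  bounded_field (fun t x => g t * Z t x) (fun x => K * b x) (K ^+ 2 * C).
Proof.
move=> mg gK.
have K0 : 0 <= K := le_trans (normr_ge0 _) (gK point).
split.
- apply: measurable_funM => //; exact: measurableT_comp mg measurable_fst.
- by move=> t x; rewrite normrM ler_pM// (field_bound ZP).
- by move=> t; have := HL2 (g t *: toH (field_L2 ZP t)).
- move=> t.
  have -> : L2inner mu (fun x => g t * Z t x) (fun x => g t * Z t x) = g t ^+ 2 * L2inner mu (Z t) (Z t).
    rewrite /L2inner -RintegralZl//; last exact: (L2_mul (field_L2 ZP t) (field_L2 ZP t)).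
    by apply: eq_Rintegral => x _; ring.
  apply: ler_pM; rewrite ?sqr_ge0//.
  + by apply: Rintegral_ge0 => x _; rewrite -expr2 sqr_ge0.
  + by rewrite -real_normK ?num_real// lerXn2r ?nnegrE.
  + exact: (field_sqnorm ZP).
Qed.

End OneField.
End Fields.

Section FieldOps.
Context {d1 d2} {Th : measurableType d1} {X : measurableType d2} {R : realType}.
Variables (rho : probability Th R) (mu : probability X R).

Let hP := semi_inner_hip mu.

Lemma L2_sqrD (f g : X -> R) : L2 mu f -> L2 mu g ->
  L2 mu (fun x => f x + g x) /\
  L2inner mu (fun x => f x + g x) (fun x => f x + g x) <=
  2 * L2inner mu f f + 2 * L2inner mu g g.
Proof.
move=> hf hg; split; first exact: (HL2 (toH hf + toH hg)).
exact: (ip_sqrD_le hP (toH hf) (toH hg)).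
Qed.

Lemma fieldD (Z Z' : Th -> X -> R) b b' C C' :
  bounded_field mu Z b C -> bounded_field mu Z' b' C' ->
  bounded_field mu (fun t x => Z t x + Z' t x) (fun x => b x + b' x) (2 * C + 2 * C').
Proof.
move=> ZP ZP'; split.
- by apply: measurable_funD; [exact: field_measurable ZP|exact: field_measurable ZP'].
- move=> t x; rewrite (le_trans (ler_normD _ _))// lerD//.
    exact: (field_bound ZP).
  exact: (field_bound ZP').
- by move=> t; case: (L2_sqrD (field_L2 ZP t) (field_L2 ZP' t)).
- move=> t; have [_ /le_trans] := L2_sqrD (field_L2 ZP t) (field_L2 ZP' t); apply.
  by rewrite lerD// ler_wpM2l//; [exact: field_sqnorm ZP _|exact: field_sqnorm ZP' _].
Qed.

Lemma field_cst (v : X -> R) : L2 mu v ->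
  bounded_field mu (fun _ : Th => v) (fun x => `|v x|) (L2inner mu v v).
Proof.
move=> hv; split=> //; exact: measurableT_comp (L2_measurable hv) measurable_snd.
Qed.

Lemma field_prod (Z : Th -> X -> R) b C : bounded_field mu Z b C ->
  let f := fun p : Th * X => Z p.1 p.2 in
  L2 (prodP rho mu) f /\
  L2inner (prodP rho mu) f f = \int[rho]_t L2inner mu (Z t) (Z t).
Proof.
move=> ZP f.
have m2 : measurable_fun setT (fun p : Th * X => Z p.1 p.2 ^+ 2).
  by apply: measurable_funX; exact: field_measurable ZP.
have h1 t : rintegrable mu (fun x => Z t x ^+ 2) by exact/L2_sqr/(field_L2 ZP).
have e t : L2inner mu (Z t) (Z t) = \int[mu]_x (Z t x ^+ 2).
  by apply: eq_Rintegral => x _; rewrite expr2.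
have hK t : \int[mu]_x `|Z t x ^+ 2| <= C.
  apply: le_trans (field_sqnorm ZP t); rewrite le_eqVlt; apply/orP; left; apply/eqP.
  by apply: eq_Rintegral => x _; rewrite ger0_norm ?sqr_ge0// expr2.
split.
  apply: L2I; first exact: field_measurable ZP.
  exact: (rintegrable_prod rho m2 h1 hK).
under [RHS]eq_Rintegral do rewrite e.
rewrite -(Rfubini_prod rho m2 h1 hK).
by apply: eq_Rintegral => p _; rewrite expr2.
Qed.

End FieldOps.

(** * Density of finite sums of 1_A(theta) e(x) *)

Section RectangleSpan.
Context {d1 d2} {Th : measurableType d1} {X : measurableType d2} {R : realType}.
Variables (rho : probability Th R) (mu : probability X R).
Variable B : set (X -> R).
Hypothesis BP : hilbert_basis mu B.

Notation Q := (prodP rho mu).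

Let hP := semi_inner_hip mu.

Let B_L2 e : B e -> L2 mu e. Proof. by case: BP => h _ _ _; exact: h. Qed.

(** Finite sums of c 1_A(t) e(x) with e in the basis.  The first index collects
    the functions e that occur, because orthogonality to them is what matters
    later. *)
Inductive rect_span : seq (X -> R) -> (Th -> X -> R) -> Prop :=
| rect_span0 : rect_span [::] (fun _ _ => 0)
| rect_spanS F g c A e : measurable A -> B e -> rect_span F g ->
    rect_span (e :: F) (fun t x => c * \1_A t * e x + g t x).

Lemma rect_span_lin F g F' g' a : rect_span F g -> rect_span F' g' ->
  exists F'', rect_span F'' (fun t x => a * g t x + g' t x).
Proof.
move=> hg hg'; elim: hg => [|{}F {}g c A e mA Be _ [F'' IH]].
  exists F'; rewrite (_ : (fun t x => _) = g')//.
  by apply/funext => t; apply/funext => x; rewrite mulr0 add0r.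
exists (e :: F''); have := rect_spanS (a * c) mA Be IH.
congr (rect_span _ _); apply/funext => t; apply/funext => x; ring.
Qed.

Lemma rect_span_field F g : rect_span F g -> exists b C, bounded_field mu g b C.
Proof.
elim => [|{}F {}g c A e mA Be _ [b [C IH]]].
  by do 2 eexists; apply: (field_cst (L2_cst mu 0)).
have h1 := field_cst (Th := Th) (B_L2 Be).
have mA' : measurable_fun setT (fun t : Th => c * \1_A t).
  by apply: measurable_funM => //; exact: measurable_indic.
have bA t : `|c * \1_A t : R| <= `|c|.
  by rewrite normrM ler_piMr// indicE ger0_norm// lern1 leq_b1.
by do 2 eexists; apply: fieldD IH; exact: field_scale h1 _ _ mA' bA.
Qed.

Lemma rect_span_sub F g : rect_span F g -> forall e, e \in F -> B e.
Proof.
elim=> // {}F {}g c A e mA Be _ IH e'; rewrite inE => /predU1P[->//|]; exact: IH.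
Qed.

Lemma rect_span_orth F g r t : rect_span F g -> L2 mu r ->
  (forall e, e \in F -> L2inner mu r e = 0) -> L2inner mu r (g t) = 0.
Proof.
move=> hg hr; elim: hg => [|{}F {}g c A e mA Be hg IH] rF.
  by rewrite /L2inner; under eq_Rintegral do rewrite mulr0;
    rewrite Rintegral_cst// mul0r.
have [b [C gP]] := rect_span_field hg.
have := ipDr hP (c * \1_A t *: toH (B_L2 Be)) (toH (field_L2 gP t)) (toH hr).
have re : hip (toH hr) (toH (B_L2 Be)) = 0 by apply: rF; exact: mem_head.
have rg : hip (toH hr) (toH (field_L2 gP t)) = 0.
  by apply: IH => e' e'F; apply: rF; rewrite inE e'F orbT.
by rewrite (ipZr hP) re rg mulr0 addr0.
Qed.

Let prod_fun (g : Th -> X -> R) (p : Th * X) := g p.1 p.2.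

Definition approximable (f : Th * X -> R) : Prop := L2 Q f /\
  forall eps : R, 0 < eps -> exists F g, rect_span F g /\
    let h := fun p => f p - prod_fun g p in L2inner Q h h <= eps.

Let span_L2 F g : rect_span F g -> L2 Q (prod_fun g).
Proof.
by move=> /rect_span_field[b [C gP]]; case: (field_prod rho gP).
Qed.

Let sub_sqr (f g h : Th * X -> R) : L2 Q f -> L2 Q g -> L2 Q h ->
  L2inner Q (fun p => f p - h p) (fun p => f p - h p) <=
  2 * L2inner Q (fun p => f p - g p) (fun p => f p - g p) +
  2 * L2inner Q (fun p => g p - h p) (fun p => g p - h p).
Proof.
move=> hf hg hh.
have h1 : L2 Q (fun p => f p - g p) := HL2 (toH hf - toH hg).
have h2 : L2 Q (fun p => g p - h p) := HL2 (toH hg - toH hh).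
have [_] := L2_sqrD h1 h2; apply: le_trans.
rewrite le_eqVlt; apply/orP; left; apply/eqP; apply: eq_Rintegral => p _; ring.
Qed.

Lemma approximable_limit f : L2 Q f ->
  (forall eps : R, 0 < eps -> exists2 g, approximable g &
     L2inner Q (fun p => f p - g p) (fun p => f p - g p) <= eps) ->
  approximable f.
Proof.
move=> hf h; split=> // eps e0; have e4 : 0 < eps / 4 by rewrite divr_gt0.
have [g [hg /(_ _ e4)[F [g' [hg' gg']]]] fg] := h _ e4.
exists F, g'; split=> //=; apply: le_trans (sub_sqr hf hg (span_L2 hg')) _.
by move: fg gg' => /=; lra.
Qed.

Lemma approximable_lin f g a : approximable f -> approximable g ->
  approximable (fun p => a * f p + g p).
Proof.
move=> [hf af] [hg ag]; split; first exact: (HL2 (a *: toH hf + toH hg)).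
move=> eps e0.
(* chosen so that 2 * (a^2 * eta) + 2 * eta = eps / 2 *)
pose eta := eps / (4 * (1 + a ^+ 2)).
have a0 := sqr_ge0 a.
have a1 : 0 < 1 + a ^+ 2 by rewrite ltr_pwDl.
have eta0 : 0 < eta by rewrite divr_gt0// mulr_gt0.
have [F [f' [sf ff']]] := af _ eta0; have [F' [g' [sg gg']]] := ag _ eta0.
have [F'' sfg] := rect_span_lin a sf sg.
exists F'', (fun t x => a * f' t x + g' t x); split=> //=.
have h1 : L2 Q (fun p => f p - prod_fun f' p) := HL2 (toH hf - toH (span_L2 sf)).
have h2 : L2 Q (fun p => g p - prod_fun g' p) := HL2 (toH hg - toH (span_L2 sg)).
have h1a : L2 Q (fun p => a * (f p - prod_fun f' p)) := HL2 (a *: toH h1).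
have [_ le12] := L2_sqrD h1a h2.
apply: (@le_trans _ _ (2 * (a ^+ 2 * eta) + 2 * eta)).
  apply: le_trans (_ : _ <= _ + 2 * L2inner Q (fun p => g p - prod_fun g' p) (fun p => g p - prod_fun g' p)) _.
    apply: le_trans le12; rewrite le_eqVlt; apply/orP; left; apply/eqP.
    by apply: eq_Rintegral => p _; rewrite /prod_fun; ring.
  rewrite lerD// ler_wpM2l//.
  have -> : L2inner Q (fun p => a * (f p - prod_fun f' p)) (fun p => a * (f p - prod_fun f' p))
    = a ^+ 2 * L2inner Q (fun p => f p - prod_fun f' p) (fun p => f p - prod_fun f' p).
    rewrite /L2inner -RintegralZl//; last exact: (L2_mul h1 h1).
    by apply: eq_Rintegral => p _; ring.
  by rewrite ler_wpM2l.
rewrite (_ : _ + _ = eps / 2); first by rewrite ler_pdivrMr// ler_pMr// ler1n.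
by rewrite /eta; field; rewrite gt_eqF// addrC.
Qed.

Let indic_L2 (E : set (Th * X)) : measurable E -> L2 Q (\1_E).
Proof.
move=> mE; apply: (L2_le _ (L2_cst Q 1)); first exact: measurable_indic.
by move=> p; rewrite indicE normr1 ger0_norm// lern1 leq_b1.
Qed.

Let approximable0 : approximable (fun=> 0).
Proof.
split; first exact: L2_cst.
move=> eps e0; exists [::], (fun _ _ => 0); split; first exact: rect_span0.
rewrite /= /L2inner; under eq_Rintegral do rewrite /prod_fun subr0 mulr0.
by rewrite Rintegral_cst// mul0r ltW.
Qed.

(** On a rectangle the indicator of C is approximated in L^2(mu) by the basis. *)
Let approximable_rect A C : measurable A -> measurable C ->
  approximable (\1_(A `*` C)).
Proof.
move=> mA mC; split; first by apply: indic_L2; exact: measurableX.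
move=> eps e0.
have mc : L2 mu (\1_C).
  apply: (L2_le _ (L2_cst mu 1)); first exact: measurable_indic.
  by move=> p; rewrite indicE normr1 ger0_norm// lern1 leq_b1.
have se : 0 < Num.sqrt eps by rewrite sqrtr_gt0.
have [_ _ _ /(_ _ _ mc se)[n [e [c [eB ec]]]]] := BP.
have sp : exists F, rect_span F (fun t x => \1_A t * \sum_i c i * e i x).
  suff : forall (s : seq 'I_n), exists F, rect_span F (fun t x => \1_A t * \sum_(i <- s) c i * e i x).
    by move=> /(_ (index_enum 'I_n)).
  elim=> [|i s [F IH]].
    exists [::]; rewrite (_ : (fun t x => _) = (fun _ _ => 0)); first exact: rect_span0.
    by apply/funext => t; apply/funext => x; rewrite big_nil mulr0.
  exists (e i :: F); have := rect_spanS (c i) mA (eB i) IH.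
  by congr (rect_span _ _); apply/funext => t; apply/funext => x; rewrite big_cons; ring.
case: sp => F sp; exists F; eexists; split; first exact: sp.
pose r x := \1_C x - \sum_i c i * e i x.
have rL2 : L2 mu r := HL2 (toH mc - toH (L2_comb c (fun i => B_L2 (eB i)))).
have mA' : measurable_fun setT (\1_A : Th -> R) by exact: measurable_indic.
have bA t : `|\1_A t : R| <= 1 by rewrite indicE ger0_norm// lern1 leq_b1.
have rF := field_scale (field_cst (Th := Th) rL2) mA' bA.
have [_ rE] := field_prod rho rF.
have -> : (fun p => \1_(A `*` C) p - prod_fun (fun t x => \1_A t * \sum_i c i * e i x) p)
    = (fun p => \1_A p.1 * r p.2).
  apply/funext => p; rewrite /prod_fun /r mulrBr; congr (_ - _).
  have -> : \1_(A `*` C) p = \1_A p.1 * \1_C p.2 :> R.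
    rewrite !indicE -natrM mulnb; congr (nat_of_bool _)%:R.
    by apply/idP/andP; rewrite !inE.
  by [].
rewrite /= rE; apply: le_trans (field_sqnorm_mean rho rF) _.
rewrite expr1n mul1r.
move: ec; rewrite -/(L2norm mu r) L2normE// lte_fin => ec.
have r0 : 0 <= L2inner mu r r by apply: (ip_ge0 hP (toH rL2)).
by rewrite -(sqr_sqrtr r0) -(sqr_sqrtr (ltW e0)) lerXn2r ?nnegrE ?sqrtr_ge0// ltW.
Qed.

(** Dynkin's lemma: the rectangles are stable under intersection, and the sets
    with an approximable indicator form a lambda-system. *)
Let approximable_indic E : measurable E -> approximable (\1_E).
Proof.
pose LL : set (set (Th * X)) := [set E | measurable E /\ approximable (\1_E)].
suff : measurable `<=` LL by move=> h /h[].
rewrite measurable_prod_measurableType.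
set CC := [set A1 `*` A2 | A1 in measurable & A2 in measurable].
have CI : setI_closed CC.
  move=> X1 Y1 [X2 mX1 [X3 mX2 <-{X1}]] [Y2 mY1 [Y3 mY2 <-{Y1}]].
  exists (X2 `&` Y2); first exact: measurableI.
  by exists (X3 `&` Y3); [exact: measurableI|rewrite setXI].
have CB : CC `<=` LL.
  by move=> _ [A mA [C mC <-]]; split; [exact: measurableX|exact: approximable_rect].
suff lamLL : lambda_system setT LL by exact: lambda_system_subset.
split => //.
- have CT : CC setT by exists setT => //; exists setT => //; rewrite setXTT.
  exact: (CB _ CT).
- move=> E1 E2 E21 [m1 a1] [m2 a2]; split; first exact: measurableD.
  have := approximable_lin (-1) a2 a1; congr approximable.
  apply/funext => p; rewrite !indicE in_setD.
  have [p2|p2] := boolP (p \in E2); have [p1|p1] := boolP (p \in E1) => /=; try by ring.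
  by exfalso; move: p1 => /negP; apply; rewrite inE; apply: E21; rewrite inE in p2.
- move=> G ndG hG; have mG i : measurable (G i) by case: (hG i).
  have mU : measurable (\bigcup_i G i) by exact: bigcupT_measurable.
  split=> //; apply: approximable_limit; first exact: indic_L2.
  move=> eps e0.
  have : (fun i => Q (G i)) @ \oo --> Q (\bigcup_i G i).
    by apply: nondecreasing_cvg_mu.
  have fQ S : measurable S -> Q S = (fine (Q S))%:E.
    by move=> mS; rewrite fineK//; exact: fin_num_measure.
  rewrite (fQ _ mU) => /fine_cvgP[_ /cvgrPdist_le/(_ _ e0)[n _ /(_ n (leqnn n))]] /= hn.
  exists (\1_(G n)); first by case: (hG n).
  have GU : G n `<=` \bigcup_i G i by move=> p Gp; exists n.
  have -> : L2inner Q (fun p => \1_(\bigcup_i G i) p - \1_(G n) p)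
      (fun p => \1_(\bigcup_i G i) p - \1_(G n) p) = \int[Q]_p \1_((\bigcup_i G i) `\` G n) p.
    apply: eq_Rintegral => p _; rewrite !indicE in_setD.
    have [p2|p2] := boolP (p \in G n); have [p1|p1] := boolP (p \in _) => /=; try by ring.
    by exfalso; move: p1 => /negP; apply; rewrite inE; apply: GU; rewrite inE in p2.
  have mD : measurable ((\bigcup_i G i) `\` G n) by exact: measurableD.
  rewrite /Rintegral integral_indic// setIT measureD//; last first.
    by rewrite -ge0_fin_numE//; exact: fin_num_measure.
  rewrite setIidr// fineB; [|exact: fin_num_measure|exact: fin_num_measure].
  by apply: le_trans hn; exact: ler_norm.
Qed.

Let approximable_sum (I : Type) (s : seq I) (c : I -> R) (f : I -> Th * X -> R) :
  (forall i, approximable (f i)) ->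
  approximable (fun p => \sum_(i <- s) c i * f i p).
Proof.
move=> hf; elim: s => [|i s IH].
  by under eq_fun do rewrite big_nil; exact: approximable0.
by under eq_fun do rewrite big_cons; exact: approximable_lin.
Qed.

Import HBNNSimple.

Let approximable_nneg f : L2 Q f -> (forall p, 0 <= f p) -> approximable f.
Proof.
move=> hf f0; apply: approximable_limit => // eps e0.
have mf : measurable_fun setT (EFin \o f) by apply/measurable_EFinP; exact: L2_measurable hf.
pose g := nnsfun_approx measurableT mf.
have gcvg p : (fun n => g n p) @ \oo --> f p.
  have h : EFin \o g^~ p @ \oo --> (f p)%:E.
    apply: (@cvg_nnsfun_approx _ _ R setT measurableT (EFin \o f) mf) => // q _.
    by rewrite lee_fin.
  by have /fine_cvgP[_] := h.
have gle n p : g n p <= f p.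
  rewrite -(cvg_lim _ (gcvg p))//; apply: nondecreasing_cvgn_le; last exact: cvgP (gcvg p).
  move=> m k mk.
  by have /lefP := nd_nnsfun_approx measurableT mf mk; exact.
pose h n p := ((f p - g n p) ^+ 2)%:E : \bar R.
have mg n : measurable_fun setT (g n) by [].
have mh n : measurable_fun setT (h n).
  by apply/measurable_EFinP/measurable_funX/measurable_funB => //; exact: L2_measurable hf.
have hcvg : {ae Q, forall x, setT x -> h ^~ x @ \oo --> (0 : \bar R)}.
  apply: aeW => p _; apply: cvg_EFin; first exact: nearW.
  have h1 : (fun n => f p - g n p) @ \oo --> f p - f p.
    by apply: cvgB => //; exact: cvg_cst.
  by have := cvgM h1 h1; rewrite subrr mulr0; exact.
have hdom : {ae Q, forall x n, setT x -> (`|h n x| <= (f x ^+ 2)%:E)%E}.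
  apply: aeW => p n _; rewrite lee_fin ger0_norm ?sqr_ge0//.
  rewrite lerXn2r ?nnegrE ?subr_ge0 ?gle// gerBl.
  exact: fun_ge0.
have [_ _] := @dominated_convergence _ _ _ Q setT measurableT h (cst 0%E) _
  mh (measurable_cst _) hcvg (L2_sqr hf) hdom.
rewrite integral0 => /fine_cvgP[_ /cvgrPdist_le/(_ _ e0)[n _ /(_ n (leqnn n))]].
rewrite /= sub0r normrN => hn.
exists (g n); last first.
  apply: le_trans hn; apply: le_trans (ler_norm _).
  by rewrite le_eqVlt; apply/orP; left; apply/eqP; apply: eq_Rintegral => p _; rewrite expr2.
rewrite (_ : (g n : _ -> R) = fun p => \sum_(y <- finmap.enum_fset (fset_set (range (g n)))) y * \1_(g n @^-1` [set y]) p).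
  apply: approximable_sum => y; apply: approximable_indic.
  exact: measurable_sfunP.
by apply/funext => p; rewrite {1}fimfunE fsbig_finite.
Qed.

(** From indicators to nonnegative functions by simple functions and dominated
    convergence; f is the difference of |f| + f and |f|. *)
Lemma approximable_L2 f : L2 Q f -> approximable f.
Proof.
move=> hf; have mf := L2_measurable hf.
have ha : L2 Q (fun p => `|f p|).
  by apply: L2_le hf _; [exact: measurableT_comp|move=> p; rewrite normr_id].
have hs : L2 Q (fun p => `|f p| + f p) := HL2 (toH ha + toH hf).
have s0 p : 0 <= `|f p| + f p by rewrite -lerBlDr sub0r -normrN ler_norm.
have := approximable_lin (-1) (approximable_nneg ha (fun p => normr_ge0 _))
  (approximable_nneg hs s0).
congr approximable; apply/funext => p; ring.
Qed.

End RectangleSpan.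

(** * The averaged rank-one operator *)

Section BestApproximation.
Context {R : realType} {H : lmodType R}.
Variable ip : H -> H -> R.
Hypothesis ipP : semi_inner ip.

(** The left-hand side is the squared distance from z to the span of e, to which
    u belongs in the sense of the second hypothesis. *)
Lemma best_approximation n (e : 'I_n -> H) z u :
  (forall i j, ip (e i) (e j) = (i == j)%:R) ->
  (forall r, (forall i, ip r (e i) = 0) -> ip r u = 0) ->
  ip z z - \sum_i ip z (e i) ^+ 2 <= ip (z - u) (z - u).
Proof.
move=> on hu; pose w := \sum_i ip z (e i) *: e i.
set S := \sum_i _.
have zw : ip z w = S.
  by rewrite (ip_sumr ipP); apply: eq_bigr => i _; rewrite (ipZr ipP) expr2.
have ww : ip w w = S.
  rewrite (ip_sum_sum ipP _ (k := fun=> 1)) => [|i j]; last by rewrite on mulr1.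
  by apply: eq_bigr => i _; rewrite mulr1.
have ru : ip (z - w) u = 0.
  apply: hu => i; rewrite (ipBl ipP) (ip_suml ipP) (bigD1 i)//= big1 => [|j ji].
    by rewrite (ipZl ipP) on eqxx mulr1 addr0 subrr.
  by rewrite (ipZl ipP) on (negbTE ji) mulr0.
have zwu : ip (z - u) (z - w) = ip z z - S.
  by rewrite (ipC ipP) (ipBr ipP) ru subr0 (ipBl ipP) (ipC ipP w) zw.
have := ip_ge0 ipP ((z - u) - (z - w)).
by rewrite (ip_sqrB ipP) zwu (ip_sqrB ipP z w) zw ww; lra.
Qed.

End BestApproximation.

Section FieldOperator.
Context {d1 d2} {Th : measurableType d1} {X : measurableType d2} {R : realType}.
Variables (rho : probability Th R) (mu : probability X R).
Variables (Z : Th -> X -> R) (b : X -> R) (C : R).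
Hypothesis ZP : bounded_field mu Z b C.

Let hP := semi_inner_hip mu.
Let C0 := field_C_ge0 ZP.

Definition field_op (v : X -> R) (x : X) : R :=
  \int[rho]_t (L2inner mu (Z t) v * Z t x).

Let scaled v (hv : L2 mu v) := field_scale ZP (measurable_field_inner ZP hv)
  (fun t => field_inner_abs ZP t hv).

Lemma field_op_L2 v : L2 mu v -> L2 mu (field_op v).
Proof. by move=> hv; case: (field_mean_L2 rho (scaled hv)). Qed.

Lemma field_op_inner v u : L2 mu v -> L2 mu u ->
  L2inner mu (field_op v) u = \int[rho]_t (L2inner mu (Z t) v * L2inner mu (Z t) u).
Proof.
move=> hv hu; have := field_mean_inner rho (scaled hv) hu.
rewrite /field_mean -/(field_op v) => ->; apply: eq_Rintegral => t _.
rewrite /L2inner -RintegralZl//; last exact: (L2_mul (field_L2 ZP t) hu).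
by apply: eq_Rintegral => x _; rewrite mulrA.
Qed.

Lemma rintegrable_inner2 v u : L2 mu v -> L2 mu u ->
  rintegrable rho (fun t => L2inner mu (Z t) v * L2inner mu (Z t) u).
Proof.
move=> hv hu; apply: (@rintegrable_bounded _ _ _ rho _
  (Num.sqrt (C * L2inner mu v v) * Num.sqrt (C * L2inner mu u u))).
  by apply: measurable_funM; [exact: (measurable_field_inner ZP hv)|exact: (measurable_field_inner ZP hu)].
by move=> t; rewrite normrM ler_pM// (field_inner_abs ZP).
Qed.

Lemma rintegrable_inner_sqr v : L2 mu v ->
  rintegrable rho (fun t => L2inner mu (Z t) v ^+ 2).
Proof. by move=> hv; under eq_fun do rewrite expr2; exact: rintegrable_inner2. Qed.

Lemma field_op_form v : L2 mu v ->
  L2inner mu (field_op v) v = \int[rho]_t (L2inner mu (Z t) v ^+ 2).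
Proof.
by move=> hv; rewrite field_op_inner//; apply: eq_Rintegral => t _; rewrite expr2.
Qed.

Lemma field_op_form_le v : L2 mu v ->
  L2inner mu (field_op v) v <= C * L2inner mu v v.
Proof.
move=> hv; rewrite field_op_form//; apply: Rintegral_bounded.
- by apply: measurable_funX; exact: (measurable_field_inner ZP hv).
- by move=> t; exact: (field_inner_le ZP _ hv).
- exact: rintegrable_inner_sqr.
Qed.

Definition field_opH (v : Hspace mu) : Hspace mu := toH (field_op_L2 (HL2 v)).

Section Basis.
Variable B : set (X -> R).
Hypothesis BP : hilbert_basis mu B.

Let B_L2 e : B e -> L2 mu e. Proof. by case: BP => h _ _ _; exact: h. Qed.

(** Approximate Z in L^2(rho x mu) by a field with values in the span of finitely
    many basis functions; projecting Z onto this span is at least as good. *)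
Lemma finite_parseval (eps : R) : 0 < eps -> exists n (e : 'I_n -> X -> R),
  [/\ injective e, forall i, B (e i) &
   \int[rho]_t (L2inner mu (Z t) (Z t)) -
     \sum_i \int[rho]_t (L2inner mu (Z t) (e i) ^+ 2) <= eps].
Proof.
move=> e0; have [ZL2 ZE] := field_prod rho ZP.
have [_ /(_ _ e0)[F [g [sg /= hg]]]] := approximable_L2 BP ZL2.
pose G := undup F; pose e (i : 'I_(size G)) := nth (fun=> 0) G i.
have eB i : B (e i).
  by apply: (rect_span_sub sg); rewrite -mem_undup mem_nth.
have einj : injective e.
  by move=> i j /eqP; rewrite nth_uniq ?undup_uniq// => /eqP /val_inj.
exists (size G), e; split=> //.
apply: le_trans hg.
have [b' [C' gP]] := rect_span_field BP sg.
have mg : measurable_fun setT (fun _ : Th => -1 : R) by [].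
have ng := field_scale gP mg (K := 1) (fun _ => _).
have {}ng : bounded_field mu (fun t x => -1 * g t x) (fun x => 1 * b' x) (1 ^+ 2 * C').
  by apply: ng => _; rewrite normrN normr1.
have dP := fieldD ZP ng.
have [_ dE] := field_prod rho dP.
rewrite (_ : L2inner _ _ _ = \int[rho]_t L2inner mu (fun x => Z t x + -1 * g t x) (fun x => Z t x + -1 * g t x)); last first.
  by rewrite -dE; apply: eq_Rintegral => p _ /=; ring.
have [iZ _ _] := field_sqr_fubini rho ZP.
have [iD _ _] := field_sqr_fubini rho dP.
have ie i : rintegrable rho (fun t => L2inner mu (Z t) (e i) ^+ 2).
  by apply/rintegrable_inner_sqr/B_L2/eB.
rewrite -Rintegral_sum// -RintegralB//; last exact: rintegrable_sum.
apply: le_Rintegral => //.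
  by apply: rintegrableB => //; exact: rintegrable_sum.
move=> t _.
have := @best_approximation _ _ _ hP (size G) (fun i => toH (B_L2 (eB i)))
  (toH (field_L2 ZP t)) (toH (field_L2 gP t)).
have [_ B1 B0 _] := BP.
move=> h; apply: le_trans (h _ _) _ => [i j|r rG|].
- have [->|ij] := eqVneq i j; first exact: (B1 _ (eB j)).
  by apply: B0; [exact: eB|exact: eB|move=> /einj/eqP; rewrite (negbTE ij)].
- apply: (rect_span_orth BP t sg (HL2 r)) => f fF.
  have fG : (index f G < size G)%N by rewrite index_mem mem_undup.
  have := rG (Ordinal fG); rewrite /hip /= /e /= nth_index ?mem_undup//.
- rewrite le_eqVlt; apply/orP; left; apply/eqP; apply: eq_Rintegral => x _ /=.
  by rewrite !mulN1r.
Qed.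

(** The sum of <Te, e> over finitely many basis functions is a part of the trace,
    and it exhausts E|Z|^2 by [finite_parseval]. *)
Lemma trace_bound (trT : R) :
  \esum_(e in B) (L2inner mu (field_op e) e)%:E = trT%:E ->
  \int[rho]_t (L2inner mu (Z t) (Z t)) <= trT.
Proof.
move=> trE; apply/ler_addgt0Pr => eps e0.
have [n [e [einj eB he]]] := finite_parseval e0.
apply: (@le_trans _ _ (\sum_i \int[rho]_t (L2inner mu (Z t) (e i) ^+ 2) + eps)).
  by rewrite -lerBlDl.
rewrite lerD2r.
rewrite -lee_fin -trE; apply: esum_ge; exists [set` [seq e i | i <- enum 'I_n]].
  by split; [exact: finite_seq|move=> f /mapP[i _ ->]; exact: eB].
rewrite -fsbig_seq; last by rewrite map_inj_uniq ?enum_uniq.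
rewrite big_map big_enum/= -sumEFin.
by apply: lee_sum => i _; rewrite lee_fin field_op_form//; exact/B_L2/eB.
Qed.

(** <Z, v>^2 is at most 2 |Z - w|^2 |v|^2 + 2 <w, v>^2, where w is the projection
    of Z onto finitely many basis functions; the first mean is small and the
    second is <T Pv, Pv> with Pv the projection of v. *)
Lemma field_op_compact : quasi_compact (hip (mu := mu)) (fun v => hip (field_opH v) v).
Proof.
move=> eps e0; have e2 : 0 < eps / 2 by rewrite divr_gt0.
have [n [e [einj eB he]]] := finite_parseval e2.
have [_ B1 B0 _] := BP.
pose E i : Hspace mu := toH (B_L2 (eB i)).
have on i j : hip (E i) (E j) = (i == j)%:R.
  have [->|ij] := eqVneq i j; first exact: (B1 _ (eB j)).
  by apply: B0; [exact: eB|exact: eB|move=> /einj/eqP; rewrite (negbTE ij)].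
exists n, (fun i => Num.sqrt (2 * C) *: E i) => v.
pose Pv : Hspace mu := \sum_i hip (E i) v *: E i.
have PvE : hip Pv Pv = \sum_i hip (E i) v ^+ 2.
  rewrite (ip_sum_sum hP _ (k := fun=> 1)) => [|i j]; last by rewrite on mulr1.
  by apply: eq_bigr => i _; rewrite mulr1.
have -> : \sum_i hip (Num.sqrt (2 * C) *: E i) v ^+ 2 = 2 * (C * hip Pv Pv).
  rewrite PvE !mulr_sumr; apply: eq_bigr => i _.
  by rewrite (ipZl hP) exprMn sqr_sqrtr ?mulr_ge0// mulrA.
have [iZ _ _] := field_sqr_fubini rho ZP.
have ie i : rintegrable rho (fun t => L2inner mu (Z t) (e i) ^+ 2).
  by apply/rintegrable_inner_sqr/B_L2/eB.
have iP := rintegrable_inner_sqr (HL2 Pv).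
have iD : rintegrable rho (fun t => L2inner mu (Z t) (Z t) - \sum_i L2inner mu (Z t) (e i) ^+ 2).
  by apply: rintegrableB => //; exact: rintegrable_sum.
have pt t : L2inner mu (Z t) v ^+ 2 <= 2 * (hip v v *
    (L2inner mu (Z t) (Z t) - \sum_i L2inner mu (Z t) (e i) ^+ 2))
    + 2 * L2inner mu (Z t) Pv ^+ 2.
  pose z : Hspace mu := toH (field_L2 ZP t).
  pose w : Hspace mu := \sum_i hip z (E i) *: E i.
  have zP : hip z Pv = hip w v.
    rewrite (ip_sumr hP) (ip_suml hP); apply: eq_bigr => i _.
    by rewrite (ipZl hP) (ipZr hP) mulrC.
  have zw : hip (z - w) (z - w) = hip z z - \sum_i hip z (E i) ^+ 2.
    rewrite (ip_sqrB hP) (ip_sum_sum hP _ (k := fun=> 1)) => [|i j]; last by rewrite on mulr1.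
    rewrite (ip_sumr hP) (eq_bigr (fun i => hip z (E i) ^+ 2)) => [|i _]; last first.
      by rewrite (ipZr hP) expr2.
    rewrite [X in _ + X](eq_bigr (fun i => hip z (E i) ^+ 2)) => [|i _]; last by rewrite mulr1.
    ring.
  change (hip z v ^+ 2 <= 2 * (hip v v * (hip z z - \sum_i hip z (E i) ^+ 2)) + 2 * hip z Pv ^+ 2).
  rewrite -zw zP; have := cauchy_schwarz hP (z - w) v.
  rewrite (ipBl hP) => h; have := sqr_ge0 (hip z v - 2 * hip w v).
  move: (hip (z - w) (z - w)) h => x; nra.
rewrite /hip field_op_form; last exact: HL2.
apply: (@le_trans _ _ (\int[rho]_t (2 * (hip v v *
    (L2inner mu (Z t) (Z t) - \sum_i L2inner mu (Z t) (e i) ^+ 2))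
    + 2 * L2inner mu (Z t) Pv ^+ 2))).
  apply: le_Rintegral => //; first exact: (rintegrable_inner_sqr (HL2 v)).
  by apply: rintegrableD; do ?apply: rintegrableZl.
rewrite RintegralD//; last 2 first.
- by do ?apply: rintegrableZl.
- by do ?apply: rintegrableZl.
rewrite RintegralZl//; last exact: rintegrableZl.
rewrite RintegralZl// RintegralZl// RintegralB//; last exact: rintegrable_sum.
rewrite Rintegral_sum// lerD//.
  apply: (@le_trans _ _ (2 * (hip v v * (eps / 2)))).
    by rewrite ler_wpM2l// ler_wpM2l// (ip_ge0 hP).
  by rewrite le_eqVlt; apply/orP; left; apply/eqP; rewrite /hip; field.
rewrite ler_wpM2l// -field_op_form; last exact: HL2.
exact: (field_op_form_le (HL2 Pv)).
Qed.

Lemma psd_field_op : psd_operator (hip (mu := mu)) field_opH C.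
Proof.
split; last exact: field_op_compact.
- move=> u v; rewrite (ipC hP u) /hip /= !field_op_inner; try exact: HL2.
  by apply: eq_Rintegral => t _; rewrite mulrC.
- move=> v; rewrite /hip field_op_form; last exact: HL2.
  by apply: Rintegral_ge0 => t _; exact: sqr_ge0.
- by move=> v; apply: field_op_form_le; exact: HL2.
Qed.

(** Equality almost everywhere amounts to a null difference, so the data of
    [eigenvalue_seq] are those of [eigenvalue_seq_diagonalizes]. *)
Lemma field_op_diagonalizes (tau : nat -> R) : eigenvalue_seq mu field_op tau ->
  exists f, diagonalizes (hip (mu := mu)) (fun v => hip (field_opH v) v) f tau.
Proof.
move=> [dec pos mult].
apply: (eigenvalue_seq_diagonalizes hP psd_field_op) => //.
  exact: hip_fast_complete.
move=> lam /mult[n [e [eL2 ee free spn]] cn].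
have fin : finite_set [set j | tau j = lam] by exists n.
pose t : seq nat := finmap.enum_fset (fset_set [set j | tau j = lam]).
have st : n = size t by apply/esym/card_fset_set.
subst n.
have weak v : field_op (v : Hspace mu) = (fun x => lam * (v : Hspace mu) x) %[ae mu] <->
    forall w, hip (field_opH v) w = lam * hip v w.
  have lv : L2 mu (fun x => lam * v x) := HL2 (lam *: v).
  split=> [h w|h].
    rewrite -(ipZl hP); apply: (L2inner_ae_eq (HL2 (field_opH v)) lv (HL2 w) h).
  have : hip (field_opH v - lam *: v) (field_opH v - lam *: v) = 0.
    by rewrite (ipBl hP) (ipZl hP) h subrr.
  move=> /(L2inner0_ae (HL2 _)); apply: filterS => x h0 xT; apply/eqP.
  by rewrite -subr_eq0; apply/eqP; exact: (h0 xT).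
exists t, (fun i => toH (eL2 i)); split.
- exact: finmap.fset_uniq.
- by move=> j; rewrite in_fset_set// ; apply/idP/eqP; rewrite inE.
- by move=> i; apply/weak; exact: ee.
- move=> c v v0; apply: free; have := L2inner0_ae (HL2 v) v0.
  by rewrite /v sum_hE.
- move=> v /weak /(spn _ (HL2 v))[c hc]; exists c => /=.
  set s := \sum_i _.
  have h : (v : X -> R) = s %[ae mu] by rewrite /s sum_hE.
  rewrite (ipBl hP) (_ : hip v _ = hip s (v - s)) ?subrr//.
  exact: (L2inner_ae_eq (HL2 v) (HL2 s) (HL2 (v - s)) h).
Qed.

End Basis.

End FieldOperator.

(** * The kernel of the sampling error *)

Section TensorIntegral.
Context {d1 d2} {T1 : measurableType d1} {T2 : measurableType d2} {R : realType}.
Variables (P1 : probability T1 R) (P2 : probability T2 R).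

Lemma Rintegral_tensor (f : T1 -> R) (g : T2 -> R) :
  rintegrable P1 f -> rintegrable P2 g ->
  rintegrable (prodP P1 P2) (fun p => f p.1 * g p.2) /\
  \int[prodP P1 P2]_p (f p.1 * g p.2) = (\int[P1]_x f x) * (\int[P2]_y g y).
Proof.
move=> hf hg.
have mfg : measurable_fun setT (fun p : T1 * T2 => f p.1 * g p.2).
  apply: measurable_funM.
    exact: (measurableT_comp (rintegrable_measurable hf) measurable_fst).
  exact: (measurableT_comp (rintegrable_measurable hg) measurable_snd).
have e x : (\int[P2]_y (f x * g y)%:E = (f x * \int[P2]_y g y)%:E)%E.
  by rewrite rintegrable_EFin ?RintegralZl//; exact: rintegrableZl.
have ifg : rintegrable (prodP P1 P2) (fun p => f p.1 * g p.2).
  apply/(integrable12ltyP P1 P2); first exact/measurable_EFinP.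
  rewrite (eq_integral (fun x => (`|f x| * \int[P2]_y `|g y|)%:E)) => [|x _].
    rewrite rintegrable_EFin ?ltry//.
    have := rintegrableZl (\int[P2]_y `|g y|) (integrable_norm hf).
    by apply: eq_integrable => // x _ /=; rewrite mulrC.
  rewrite (eq_integral (fun y => (`|f x| * `|g y|)%:E)) => [|y _].
    rewrite rintegrable_EFin ?RintegralZl//; first exact: (integrable_norm hg).
    by apply: rintegrableZl; exact: (integrable_norm hg).
  by rewrite /= normrM.
split=> //; rewrite -RintegralZr//; congr fine.
rewrite -(integral12_prod_meas1 ifg); apply: eq_integral => x _.
exact: e.
Qed.

Lemma kernel_sqnorm (K : T1 * T2 -> R) : L2 (prodP P1 P2) K ->
  (forall x, L2 P2 (fun y => K (x, y))) ->
  rintegrable P1 (fun x => L2inner P2 (fun y => K (x, y)) (fun y => K (x, y))) /\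
  \int[P1]_x L2inner P2 (fun y => K (x, y)) (fun y => K (x, y)) =
  L2inner (prodP P1 P2) K K.
Proof.
move=> hK hs.
have iK : rintegrable (prodP P1 P2) (fun p => K p * K p) by exact: (L2_mul hK hK).
have e x : fubini_F P2 (EFin \o (fun p => K p * K p)) x =
    (L2inner P2 (fun y => K (x, y)) (fun y => K (x, y)))%:E.
  by rewrite /fubini_F /L2inner -rintegrable_EFin//; exact: (L2_mul (hs x) (hs x)).
split.
  by have := integrable_fubini_F iK; apply: eq_integrable => // x _; rewrite e.
congr fine; rewrite -(integral12_prod_meas1 iK); apply: eq_integral => x _.
by rewrite e.
Qed.

End TensorIntegral.

Section TensorField.
Context {d1 d2} {Th : measurableType d1} {X : measurableType d2} {R : realType}.
Variables (rho : probability Th R) (mu : probability X R).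
Variables (Z : Th -> X -> R) (b : X -> R) (C : R).
Hypothesis ZP : bounded_field mu Z b C.

Notation pi2 := (prodP mu mu).
Let C0 := field_C_ge0 ZP.

Definition tensor_field (t : Th) (p : X * X) : R := Z t p.1 * Z t p.2.

Lemma tensor_field_inner t t' :
  L2inner pi2 (tensor_field t) (tensor_field t') = L2inner mu (Z t) (Z t') ^+ 2.
Proof.
have h := L2_mul (field_L2 ZP t) (field_L2 ZP t').
have [_ e] := Rintegral_tensor h h.
by rewrite expr2 {1 2}/L2inner -e; apply: eq_Rintegral => p _; rewrite /tensor_field; ring.
Qed.

Lemma tensor_fieldP : bounded_field pi2 tensor_field (fun p => b p.1 * b p.2) (C ^+ 2).
Proof.
have mZ := field_measurable ZP.
have m1 : measurable_fun setT (fun q : Th * (X * X) => (q.1, q.2.1)).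
  by apply: measurable_fun_pair => //; exact: (measurableT_comp measurable_fst measurable_snd).
have m2 : measurable_fun setT (fun q : Th * (X * X) => (q.1, q.2.2)).
  by apply: measurable_fun_pair => //; exact: (measurableT_comp measurable_snd measurable_snd).
have mT : measurable_fun setT (fun q : Th * (X * X) => tensor_field q.1 q.2).
  by apply: measurable_funM; [exact: (measurableT_comp mZ m1)|exact: (measurableT_comp mZ m2)].
split=> //.
- by move=> t p; rewrite normrM ler_pM// (field_bound ZP).
- move=> t; apply: L2I; first exact: (measurable_section1 t mT).
  have h := L2_mul (field_L2 ZP t) (field_L2 ZP t).
  have [i _] := Rintegral_tensor h h.
  by apply: eq_integrable i => // p _; rewrite /= /tensor_field; congr EFin; ring.
- move=> t; rewrite tensor_field_inner lerXn2r ?nnegrE//; last exact: (field_sqnorm ZP).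
  by apply: Rintegral_ge0 => x _; rewrite -expr2 sqr_ge0.
Qed.

Let kernel := field_mean rho tensor_field.

(** The kernel of the operator v |-> <Z_t, v> Z_t - T v, the difference of a rank-one operator and its
    mean. *)
Definition centered_field (t : Th) (p : X * X) : R := tensor_field t p + - kernel p.

Let kernelL2 : L2 pi2 kernel.
Proof. by case: (field_mean_L2 rho tensor_fieldP). Qed.

Let kernelNL2 : L2 pi2 (fun p => - kernel p).
Proof. exact: (HL2 (- toH kernelL2)). Qed.

Lemma centered_fieldP : exists b', bounded_field pi2 centered_field b' (4 * C ^+ 2).
Proof.
eexists; have h := fieldD tensor_fieldP (field_cst (Th := Th) kernelNL2).
split; [exact: field_measurable h|exact: field_bound h|exact: field_L2 h|].
move=> t; apply: le_trans (field_sqnorm h t) _.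
apply: (@le_trans _ _ (2 * C ^+ 2 + 2 * C ^+ 2)); last by lra.
rewrite lerD// ler_wpM2l//.
have -> : L2inner pi2 (fun p => - kernel p) (fun p => - kernel p) = L2inner pi2 kernel kernel.
  by apply: eq_Rintegral => p _; rewrite mulrNN.
have [_ /le_trans] := field_mean_L2 rho tensor_fieldP; apply.
exact: (field_sqnorm_mean rho tensor_fieldP).
Qed.

Definition cov (t t' : Th) : R := L2inner pi2 (centered_field t) (centered_field t').

Lemma cov_measurable : measurable_fun setT (fun p : Th * Th => cov p.1 p.2).
Proof.
have [b' yP] := centered_fieldP; have my := field_measurable yP.
apply: (@measurable_Rintegral_section _ _ (Th * Th)%type (X * X)%type R pi2
  (fun p y => centered_field p.1 y * centered_field p.2 y)).
have m1 : measurable_fun setT (fun q : Th * Th * (X * X) => (q.1.1, q.2)).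
  by apply: measurable_fun_pair => //; exact: (measurableT_comp measurable_fst measurable_fst).
have m2 : measurable_fun setT (fun q : Th * Th * (X * X) => (q.1.2, q.2)).
  by apply: measurable_fun_pair => //; exact: (measurableT_comp measurable_snd measurable_fst).
by apply: measurable_funM; [exact: (measurableT_comp my m1)|exact: (measurableT_comp my m2)].
Qed.

Lemma cov_bound t t' : `|cov t t'| <= 4 * C ^+ 2.
Proof.
have [b' yP] := centered_fieldP.
have h := L2inner_cs (field_L2 yP t) (field_L2 yP t').
have c4 : 0 <= 4 * C ^+ 2 by rewrite mulr_ge0// sqr_ge0.
rewrite -ler_sqr ?nnegrE// real_normK ?num_real// (le_trans h)// expr2.
have p0 s : 0 <= L2inner pi2 (centered_field s) (centered_field s).
  by apply: Rintegral_ge0 => x _; rewrite -expr2 sqr_ge0.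
by rewrite ler_pM// (field_sqnorm yP).
Qed.

Lemma cov_mean0 t' : \int[rho]_t cov t t' = 0.
Proof.
have [b' yP] := centered_fieldP.
rewrite /cov -(field_mean_inner rho yP (field_L2 yP t')).
transitivity (\int[pi2]_p (0 : R)); last by rewrite Rintegral_cst// mul0r.
apply: eq_Rintegral => p _; rewrite /field_mean /centered_field RintegralD//.
- by rewrite Rintegral_cst// [X in fine X]probability_setT mulr1 subrr mul0r.
- exact: (field_rintegrable2 rho tensor_fieldP p).
- exact: rintegrable_cst.
Qed.

(** The variance is at most the second moment, and the kernel Z(x) Z(x') has the
    squared norm |Z|^4 <= C |Z|^2. *)
Lemma cov_diag : \int[rho]_t cov t t <= C * \int[rho]_t L2inner mu (Z t) (Z t).
Proof.
have hP := semi_inner_hip pi2.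
have tP := tensor_fieldP.
have e t : cov t t = L2inner pi2 (tensor_field t) (tensor_field t) -
    2 * L2inner pi2 (tensor_field t) kernel + L2inner pi2 kernel kernel.
  exact: (ip_sqrB hP (toH (field_L2 tP t)) (toH kernelL2)).
have [i1 _ _] := field_sqr_fubini rho tP.
have i2 : rintegrable rho (fun t => L2inner pi2 (tensor_field t) kernel).
  apply: (@rintegrable_bounded _ _ _ rho _ (Num.sqrt (C ^+ 2 * L2inner pi2 kernel kernel))).
    exact: (measurable_field_inner tP kernelL2).
  by move=> t; exact: (field_inner_abs tP).
have i3 : rintegrable rho (fun=> L2inner pi2 kernel kernel) by exact: rintegrable_cst.
under eq_Rintegral do rewrite e.
rewrite RintegralD//; last by apply: rintegrableB => //; exact: rintegrableZl.
rewrite RintegralB//; last exact: rintegrableZl.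
rewrite RintegralZl// -(field_mean_inner rho tP kernelL2) -/kernel.
rewrite Rintegral_cst// [X in fine X]probability_setT mulr1.
have k0 : 0 <= L2inner pi2 kernel kernel by apply: (ip_ge0 hP (toH kernelL2)).
apply: (@le_trans _ _ (\int[rho]_t L2inner pi2 (tensor_field t) (tensor_field t))).
  by move: (Rintegral _ _ _) (L2inner pi2 kernel kernel) k0 => r k k0; lra.
have [iz _ _] := field_sqr_fubini rho ZP.
rewrite -RintegralZl//; apply: le_Rintegral => //; first exact: rintegrableZl.
move=> t _; rewrite tensor_field_inner expr2 ler_wpM2r//; last exact: (field_sqnorm ZP).
by apply: Rintegral_ge0 => x _; rewrite -expr2 sqr_ge0.
Qed.

Lemma field_section x :
  bounded_field mu (fun t x' => Z t x * Z t x') (fun x' => b x * b x') (b x ^+ 2 * C).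
Proof.
apply: (field_scale ZP (g := Z^~ x)); first exact: measurable_section2 (field_measurable ZP).
by move=> t; exact: (field_bound ZP).
Qed.

(** The averaged rank-one operators form the integral operator with the
    averaged kernel: Fubini for the section of the field at x. *)
Lemma field_op_kernel v x : L2 mu v ->
  L2inner mu (field_mean rho (fun t x' => Z t x * Z t x')) v = field_op rho mu Z v x.
Proof.
move=> hv; rewrite (field_mean_inner rho (field_section x) hv).
apply: eq_Rintegral => t _.
rewrite /L2inner /= -RintegralZr//; last exact: (L2_mul (field_L2 ZP t) hv).
by apply: eq_Rintegral => x' _; ring.
Qed.

Section Sample.
Variables (th : nat -> Th) (M : nat).

(** The squared norm of the kernel of S_M / M - T in L^2(mu x mu), expanded. *)
Definition sample_error : R := M%:R ^- 2 * \sum_(m < M) \sum_(l < M) cov (th m) (th l).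

Let K (p : X * X) : R := M%:R^-1 * \sum_(m < M) centered_field (th m) p.

Let KL2 : L2 pi2 K.
Proof.
have [b' yP] := centered_fieldP.
have -> : K = (fun p => \sum_(m < M) M%:R^-1 * centered_field (th m) p).
  by apply/funext => p; rewrite /K mulr_sumr.
by apply: (L2_comb (fun=> M%:R^-1)) => m; exact: (field_L2 yP).
Qed.

Let KK : L2inner pi2 K K = sample_error.
Proof.
have [b' yP] := centered_fieldP.
have hP := semi_inner_hip pi2.
pose y (m : 'I_M) := toH (field_L2 yP (th m)).
have -> : L2inner pi2 K K = hip (\sum_m M%:R^-1 *: y m) (\sum_m M%:R^-1 *: y m).
  apply: eq_Rintegral => p _; rewrite !sum_hE.
  have KE : K p = \sum_m M%:R^-1 * y m p by rewrite /K mulr_sumr.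
  by rewrite KE.
rewrite (ip_suml hP) /sample_error mulr_sumr; apply: eq_bigr => m _.
rewrite (ip_sumr hP) mulr_sumr; apply: eq_bigr => l _.
by rewrite (ipZl hP) (ipZr hP) mulrA -invfM -expr2.
Qed.

Lemma sample_error_ge0 : 0 <= sample_error.
Proof. by rewrite -KK; apply: (ip_ge0 (semi_inner_hip pi2) (toH KL2)). Qed.

Definition sample_diff (v : X -> R) (x : X) : R :=
  M%:R^-1 * \sum_(m < M) L2inner mu (Z (th m)) v * Z (th m) x - field_op rho mu Z v x.

Lemma sample_diff_L2 v : L2 mu v -> L2 mu (sample_diff v).
Proof.
move=> hv; have h1 := L2_comb (fun m : 'I_M => M%:R^-1 * L2inner mu (Z (th m)) v)
  (fun m => field_L2 ZP (th m)).
have := HL2 (toH h1 - toH (field_op_L2 rho ZP hv)).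
congr (L2 mu); apply/funext => x /=; rewrite /sample_diff mulr_sumr; congr (_ - _).
by apply: eq_bigr => m _; rewrite mulrA.
Qed.

(** The operator norm is at most the Hilbert-Schmidt norm: at each x the value is
    the inner product of v with the section K(x, .), and the squared norms of
    the sections integrate to that of K. *)
Lemma sample_diff_le v : (0 < M)%N -> L2 mu v ->
  L2inner mu (sample_diff v) (sample_diff v) <= sample_error * L2inner mu v v.
Proof.
move=> M0 hv.
have sec := field_section.
have ksec x : L2 mu (fun x' => kernel (x, x')) by case: (field_mean_L2 rho (sec x)).
have csec x t : L2 mu (fun x' => centered_field t (x, x')).
  exact: (HL2 (toH (field_L2 (sec x) t) - toH (ksec x))).
have KsecE x : (fun x' => K (x, x')) = (fun x' => \sum_(m < M) M%:R^-1 * centered_field (th m) (x, x')).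
  by apply/funext => x'; rewrite /K mulr_sumr.
have Ksec x : L2 mu (fun x' => K (x, x')).
  by rewrite KsecE; apply: (L2_comb (fun=> M%:R^-1)).
have hP := semi_inner_hip mu.
have AE x : sample_diff v x = L2inner mu (fun x' => K (x, x')) v.
  have -> : L2inner mu (fun x' => K (x, x')) v =
      hip (\sum_(m < M) M%:R^-1 *: toH (csec x (th m))) (toH hv).
    apply: eq_Rintegral => x' _; rewrite sum_hE; congr (_ * _).
    by rewrite /K mulr_sumr.
  have Ze m : hip (toH (csec x (th m))) (toH hv) =
      L2inner mu (Z (th m)) v * Z (th m) x - field_op rho mu Z v x.
    have -> : hip (toH (csec x (th m))) (toH hv) =
        hip (toH (field_L2 (sec x) (th m)) - toH (ksec x)) (toH hv) by [].
    rewrite (ipBl hP); congr (_ - _).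
      rewrite /hip /L2inner /= -RintegralZr//; last exact: (L2_mul (field_L2 ZP (th m)) hv).
      by apply: eq_Rintegral => x' _; ring.
    exact: field_op_kernel.
  rewrite (ip_suml hP) (eq_bigr (fun m : 'I_M => M%:R^-1 *
      (L2inner mu (Z (th m)) v * Z (th m) x) - M%:R^-1 * field_op rho mu Z v x)) => [|m _].
    rewrite sumrB -mulr_sumr sumr_const card_ord -[X in _ - X]mulr_natl mulrA mulfV ?mul1r//.
    by rewrite pnatr_eq0 -lt0n.
  by rewrite (ipZl hP) Ze mulrBr.
have [iK eK] := kernel_sqnorm KL2 Ksec.
rewrite -KK -eK -RintegralZr//; rewrite {1}/L2inner.
apply: le_Rintegral => //.
- by have := L2_mul (sample_diff_L2 hv) (sample_diff_L2 hv).
- by have := rintegrableZl (L2inner mu v v) iK; apply: eq_integrable => // x _ /=; rewrite mulrC.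
- by move=> x _; rewrite -expr2 AE; exact: (L2inner_cs (Ksec x) hv).
Qed.

End Sample.

End TensorField.

(** * Mean of the sampling error *)

Section Sampling.
Context {dW dT} {W : measurableType dW} {Th : measurableType dT} {R : realType}.
Variables (P : probability W R) (theta : nat -> {RV P >-> Th}).
Variable rho : probability Th R.
Hypothesis iid : iid_with_law theta rho.

Lemma iid_marginal (f : Th -> R) (K : R) m : measurable_fun setT f ->
  (forall t, `|f t| <= K) -> \int[P]_w f (theta m w) = \int[rho]_t f t.
Proof.
move=> mf fK; rewrite /Rintegral; congr (fine _).
have mfE : measurable_fun setT (EFin \o f) by exact/measurable_EFinP.
have ifm : P.-integrable setT ((EFin \o f) \o theta m).
  apply: (@rintegrable_bounded _ _ _ P (f \o theta m) K); first exact: measurableT_comp.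
  by move=> w; exact: fK.
transitivity (\int[distribution P (theta m)]_y (f y)%:E)%E.
  by rewrite integral_distribution.
by apply: eq_measure_integral => A mA _; apply: iid.2.
Qed.

Lemma iid_pair_law m l A B : m != l -> measurable A -> measurable B ->
  P ((theta m @^-1` A) `&` (theta l @^-1` B)) = (rho A * rho B)%E.
Proof.
move=> ml mA mB; have [ind law] := iid.
pose F i := if i == m then A else B.
have mF i : measurable (F i) by rewrite /F; case: ifP.
have := ind [:: m; l] F; rewrite /= inE ml => /(_ isT mF).
rewrite !big_cons big_nil mule1 {2 3}/F eqxx eq_sym (negbTE ml).
rewrite -(law m A mA) -(law l B mB) => <-; congr (P _).
apply/seteqP; split=> [w [wA wB] i /=|w h].
  rewrite !inE => /orP[] /eqP ->; first by rewrite /F eqxx.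
  by rewrite /F eq_sym (negbTE ml).
split; first by have := h m; rewrite /= /F eqxx; apply; rewrite inE eqxx.
by have := h l; rewrite /= /F eq_sym (negbTE ml); apply; rewrite !inE eqxx orbT.
Qed.

(** By uniqueness of the product measure, the joint law of two distinct samples is
    rho x rho. *)
Lemma iid_pair (f : Th -> Th -> R) (K : R) m l : m != l ->
  measurable_fun setT (fun p : Th * Th => f p.1 p.2) ->
  (forall t t', `|f t t'| <= K) ->
  \int[P]_w f (theta m w) (theta l w) = \int[rho]_t (\int[rho]_t' f t t').
Proof.
move=> ml mf fK.
have mp : measurable_fun setT (fun w => (theta m w, theta l w)).
  exact: measurable_fun_pair.
pose thp : {RV P >-> (Th * Th)%type} :=
  HB.pack (fun w => (theta m w, theta l w)) (isMeasurableFun.Build _ _ _ _ _ mp).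
have mfE : measurable_fun setT (fun p : Th * Th => (f p.1 p.2)%:E).
  exact/measurable_EFinP.
have sec t : rintegrable rho (f t).
  by apply: (@rintegrable_bounded _ _ _ rho _ K) => //; exact: measurable_section1 mf.
have secK t : \int[rho]_t' `|f t t'| <= K.
  apply: Rintegral_bounded => //; last exact: (integrable_norm (sec t)).
  by apply: measurableT_comp => //; exact: measurable_section1 mf.
rewrite -(Rfubini_prod rho mf sec secK) /Rintegral; congr (fine _).
have ifm : P.-integrable setT ((fun p : Th * Th => (f p.1 p.2)%:E) \o thp).
  apply: (@rintegrable_bounded _ _ _ P (fun w => f (theta m w) (theta l w)) K).
    exact: (measurableT_comp mf mp).
  by move=> w; exact: fK.
transitivity (\int[distribution P thp]_y (f y.1 y.2)%:E)%E.
  by rewrite integral_distribution.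
apply: eq_measure_integral => A mA _; apply/esym.
apply: (product_measure_unique (m' := distribution P thp)) => // A1 A2 mA1 mA2.
exact: iid_pair_law.
Qed.

Section SampleErrorMean.
Context {dX} {X : measurableType dX} {mu : probability X R}.
Variables (Z : Th -> X -> R) (b : X -> R) (C : R).
Hypothesis ZP : bounded_field mu Z b C.

Notation covZ := (cov rho mu Z).
Notation D M w := (sample_error rho mu Z (theta^~ w) M).

Let mean_sq := \int[rho]_t L2inner mu (Z t) (Z t).

Let cov_rv m l : measurable_fun setT (fun w => covZ (theta m w) (theta l w)).
Proof.
have mp : measurable_fun setT (fun w => (theta m w, theta l w)).
  exact: measurable_fun_pair.
exact: (measurableT_comp (cov_measurable rho ZP) mp).
Qed.

Lemma sample_error_rv M : measurable_fun setT (fun w => D M w).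
Proof.
apply: measurable_funM => //; apply: measurable_sum => m.
by apply: measurable_sum => l; exact: cov_rv.
Qed.

Let cov_int m l : rintegrable P (fun w => covZ (theta m w) (theta l w)).
Proof.
apply: (@rintegrable_bounded _ _ _ P _ (4 * C ^+ 2)) => // w.
exact: (cov_bound rho ZP).
Qed.

Lemma sample_error_integrable M : rintegrable P (fun w => D M w).
Proof.
apply: rintegrableZl; apply: rintegrable_sum => m.
by apply: rintegrable_sum => l; exact: cov_int.
Qed.

(** Only the diagonal covariances survive in the mean. *)
Lemma sample_error_mean M : (0 < M)%N ->
  \int[P]_w D M w <= C * mean_sq / M%:R.
Proof.
move=> M0; have M0' : M%:R != 0 :> R by rewrite pnatr_eq0 -lt0n.
have mcd : measurable_fun setT (fun t => covZ t t).
  have md : measurable_fun setT (fun t : Th => (t, t)) by exact: measurable_fun_pair.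
  exact: (measurableT_comp (cov_measurable rho ZP) md).
rewrite RintegralZl//; last first.
  by apply: rintegrable_sum => m; apply: rintegrable_sum => l; exact: cov_int.
rewrite Rintegral_sum => [|m]; last by apply: rintegrable_sum => l; exact: cov_int.
rewrite (eq_bigr (fun=> \int[rho]_t covZ t t)) => [|m _]; last first.
  rewrite Rintegral_sum => [|l]; last exact: cov_int.
  rewrite (bigD1 m)//= big1 => [|l lm].
    rewrite addr0; apply: (iid_marginal (f := fun t => covZ t t) m mcd) => t.
    exact: (cov_bound rho ZP).
  have lm' : (l != m :> nat) by [].
  have e : \int[P]_w covZ (theta l w) (theta m w) = 0.
    rewrite (iid_pair lm' (cov_measurable rho ZP) (cov_bound rho ZP)).
    transitivity (\int[rho]_t (0 : R)); last by rewrite Rintegral_cst// mul0r.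
    apply: eq_Rintegral => t _; rewrite -[RHS](cov_mean0 rho ZP t).
    by apply: eq_Rintegral => t' _; apply: eq_Rintegral => p _; rewrite mulrC.
  by rewrite -[RHS]e; apply: eq_Rintegral => w _; apply: eq_Rintegral => p _; rewrite mulrC.
rewrite sumr_const card_ord -[X in _ * X]mulr_natl mulrA.
have -> : M%:R ^- 2 * M%:R = M%:R^-1 :> R by rewrite expr2 invfM -mulrA mulVf ?mulr1.
by rewrite mulrC ler_wpM2r ?invr_ge0//; exact: cov_diag ZP.
Qed.

End SampleErrorMean.

End Sampling.

(** * Almost sure convergence of the sampling error *)

Section Interpolation.
Context {R : realType} {H : lmodType R}.
Variable ip : H -> H -> R.
Hypothesis ipP : semi_inner ip.

Lemma ip_sum_le (y : nat -> H) (K : R) (s : seq nat) :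
  (forall i j, ip (y i) (y j) <= K) ->
  ip (\sum_(i <- s) y i) (\sum_(i <- s) y i) <= (size s)%:R ^+ 2 * K.
Proof.
move=> yK; rewrite (ip_suml ipP).
apply: (@le_trans _ _ (\sum_(i <- s) \sum_(j <- s) K)).
  by apply: ler_sum => i _; rewrite (ip_sumr ipP); apply: ler_sum.
rewrite (eq_bigr (fun=> (size s)%:R * K)) => [|i _]; last first.
  by rewrite big_const_seq count_predT iter_addr_0 mulr_natl.
by rewrite big_const_seq count_predT iter_addr_0 -[leLHS]mulr_natl mulrA expr2.
Qed.

(** From n^2 to M at most 2n vectors are added, and dividing by M instead of n^2
    only helps. *)
Lemma square_interpolation (y : nat -> H) (K : R) (n M : nat) :
  (forall i j, ip (y i) (y j) <= K) -> (0 < n)%N -> (n ^ 2 <= M < n.+1 ^ 2)%N ->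
  let avg k := k%:R ^- 2 * ip (\sum_(i < k) y i) (\sum_(i < k) y i) in
  avg M <= 2 * avg (n ^ 2)%N + 8 * K / n%:R ^+ 2.
Proof.
move=> yK n0 /andP[nM Mn]; rewrite /=.
have K0 : 0 <= K by apply: le_trans (yK 0%N 0%N); exact: (ip_ge0 ipP).
have n0' : (0 : R) < n%:R by rewrite ltr0n.
pose u := \sum_(i < n ^ 2) y i; pose v := \sum_(n ^ 2 <= i < M) y i.
have sM : \sum_(i < M) y i = u + v.
  by rewrite /u /v -(big_mkord xpredT y) -(big_mkord xpredT y) -big_cat_nat.
have vv : ip v v <= (2 * n%:R) ^+ 2 * K.
  rewrite /v; apply: (le_trans (ip_sum_le _ yK)).
  rewrite ler_wpM2r// size_iota lerXn2r ?nnegrE ?mulr_ge0//.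
  rewrite -natrM ler_nat leq_subLR.
  by move: Mn; rewrite -(addn1 n) sqrnD exp1n muln1; lia.
have nM' : (n%:R ^+ 2) ^+ 2 <= M%:R ^+ 2 :> R.
  by rewrite lerXn2r ?nnegrE ?exprn_ge0// -natrX ler_nat.
rewrite sM -/u natrX.
have h := ip_sqrD_le ipP u v.
have uu := ip_ge0 ipP u.
apply: (@le_trans _ _ ((n%:R ^+ 2) ^- 2 * ip (u + v) (u + v))).
  have n4 : 0 < (n%:R ^+ 2) ^+ 2 :> R by rewrite !exprn_gt0.
  rewrite ler_wpM2r ?(ip_ge0 ipP)// lef_pV2 ?posrE//.
  exact: lt_le_trans nM'.
apply: (@le_trans _ _ ((n%:R ^+ 2) ^- 2 * (2 * ip u u + 2 * ((2 * n%:R) ^+ 2 * K)))).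
  rewrite ler_wpM2l ?invr_ge0 ?exprn_ge0//.
  by move: h vv; lra.
by rewrite le_eqVlt; apply/orP; left; apply/eqP; field; rewrite gt_eqF.
Qed.

End Interpolation.

Lemma square_bracket M : exists n, (n ^ 2 <= M < n.+1 ^ 2)%N.
Proof.
elim: M => [|M [n /andP[h1 h2]]]; first by exists 0%N.
have [h|h] := ltnP M.+1 (n.+1 ^ 2); first by exists n; rewrite h (leq_trans h1).
exists n.+1; rewrite h /=; rewrite (leq_ltn_trans h2)//.
by rewrite !expnS !expn0 !muln1; lia.
Qed.

Lemma sum_inv_sqr_le (R : realFieldType) n :
  \sum_(0 <= k < n.+1) (k.+1%:R ^- 2 : R) <= 2 - n.+1%:R^-1.
Proof.
elim: n => [|n IH]; first by rewrite big_nat1 expr1n invr1; lra.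
rewrite big_nat_recr//= (le_trans (lerD IH (lexx _)))//.
set a : R := n.+1%:R; have a0 : 0 < a by rewrite ltr0n.
have -> : n.+2%:R = a + 1 :> R by rewrite -natr1.
have -> : 2 - a^-1 + (a + 1) ^- 2 = 2 - (a + 1)^-1 - (a * (a + 1) ^+ 2)^-1.
  by field; rewrite !gt_eqF// addr_gt0.
by rewrite gerBl invr_ge0 mulr_ge0 ?sqr_ge0// ltW.
Qed.

Section AlmostSure.
Context {dW dT dX} {W : measurableType dW} {Th : measurableType dT}
  {X : measurableType dX} {R : realType}.
Variables (P : probability W R) (theta : nat -> {RV P >-> Th}).
Variables (rho : probability Th R) (mu : probability X R).
Hypothesis iid : iid_with_law theta rho.
Variables (Z : Th -> X -> R) (b : X -> R) (C : R).
Hypothesis ZP : bounded_field mu Z b C.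

Notation D M w := (sample_error rho mu Z (theta^~ w) M).

Lemma sample_error_interpolation (th : nat -> Th) n M :
  (0 < n)%N -> (n ^ 2 <= M < n.+1 ^ 2)%N ->
  sample_error rho mu Z th M <=
    2 * sample_error rho mu Z th (n ^ 2)%N + 8 * (4 * C ^+ 2) / n%:R ^+ 2.
Proof.
move=> n0 nM; have [b' yP] := centered_fieldP rho ZP.
have hP := semi_inner_hip (prodP mu mu).
have yK i j : hip (toH (field_L2 yP (th i))) (toH (field_L2 yP (th j))) <= 4 * C ^+ 2.
  exact: le_trans (ler_norm _) (cov_bound rho ZP _ _).
have e k : sample_error rho mu Z th k = k%:R ^- 2 *
    hip (\sum_(i < k) toH (field_L2 yP (th i))) (\sum_(i < k) toH (field_L2 yP (th i))).
  rewrite (ip_suml hP); congr (_ * _); apply: eq_bigr => m _.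
  by rewrite (ip_sumr hP).
rewrite !e; exact: (square_interpolation hP yK n0 nM).
Qed.

(** The errors at the squares have a summable mean, hence a sum that is finite
    almost surely; [sample_error_interpolation] fills the gaps. *)
Lemma sample_error_cvg0 : {ae P, forall w, (fun M => D M w) @ \oo --> 0}.
Proof.
pose c := C * \int[rho]_t L2inner mu (Z t) (Z t).
have D0 M w : 0 <= D M w by exact: (sample_error_ge0 rho ZP).
pose g k w := (D (k.+1 ^ 2)%N w)%:E : \bar R.
have g0 k w : (0 <= g k w)%E by rewrite lee_fin.
have mg k : measurable_fun setT (g k) by apply/measurable_EFinP; exact: (sample_error_rv theta rho ZP).
have c0 : 0 <= c.
  rewrite mulr_ge0 ?(field_C_ge0 ZP)//; apply: Rintegral_ge0 => t _.
  by apply: Rintegral_ge0 => x _; rewrite -expr2 sqr_ge0.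
pose S w := (\sum_(k <oo) g k w)%E.
have mS : measurable_fun setT S.
  apply: (@ge0_emeasurable_sum _ W R setT g predT) => // k w _ _; exact: g0.
have iS : P.-integrable setT S.
  apply/integrableP; split=> //.
  under eq_integral do rewrite gee0_abs ?nneseries_ge0//.
  rewrite integral_nneseries//.
  apply: (@le_lt_trans _ _ (c * 2)%:E); last exact: ltry.
  apply: lime_le; first by apply: is_cvg_nneseries => k _ _; exact: integral_ge0.
  apply: nearW => m.
  apply: (@le_trans _ _ (\sum_(0 <= k < m) (c * k.+1%:R ^- 2)%:E)%E).
    apply: lee_sum => k _.
    rewrite rintegrable_EFin; last exact: (sample_error_integrable theta rho ZP).
    by rewrite lee_fin -natrX; apply: (sample_error_mean iid ZP); rewrite expn_gt0.
  rewrite sumEFin lee_fin -mulr_sumr ler_wpM2l//; case: m => [|m]; first by rewrite big_geq.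
  by rewrite (le_trans (sum_inv_sqr_le _ _))// gerBl invr_ge0.
apply: filterS (integrable_ae measurableT iS) => w /(_ I) Sw.
have cv : (fun k => D (k.+1 ^ 2)%N w) @ \oo --> 0.
  apply: cvg_series_cvg_0; apply: nondecreasing_is_cvgn.
    by apply: nondecreasing_series => k _ _; exact: D0.
  exists (fine (S w)) => _ [m _ <-]; rewrite -lee_fin fineK// /series/= -sumEFin.
  by apply: nneseries_lim_ge => k _ _; exact: g0.
apply/cvgrPdist_le => eps e0.
have e4 : 0 < eps / 4 by rewrite divr_gt0.
move/cvgrPdist_le : cv => /(_ _ e4)[n1 _ hn1].
have : (fun n => 8 * (4 * C ^+ 2) * (n.+1%:R^-1 * n.+1%:R^-1)) @ \oo --> 8 * (4 * C ^+ 2) * (0 * 0 : R).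
  by apply: cvgMr; apply: cvgM; exact: cvg_harmonic.
have e2 : 0 < eps / 2 by rewrite divr_gt0.
rewrite !mulr0 => /cvgrPdist_le/(_ _ e2)[n2 _ hn2].
exists ((maxn n1 n2).+1 ^ 2)%N => // M /= hM.
have [n nM] := square_bracket M.
have n12 : (maxn n1 n2 < n)%N.
  rewrite -ltnS -(ltn_exp2r _ _ (isT : (0 < 2)%N)); apply: leq_ltn_trans hM _.
  by case/andP: nM.
case: n => [|n] // in nM n12 *.
rewrite sub0r normrN ger0_norm ?D0//.
apply: le_trans (sample_error_interpolation _ (ltn0Sn n) nM) _.
have h1 := hn1 n (leq_trans (leq_maxl n1 n2) n12).
have h2 := hn2 n (leq_trans (leq_maxr n1 n2) n12).
move: h1 h2; rewrite /= !sub0r !normrN => /(le_trans (ler_norm _)) h1 /(le_trans (ler_norm _)).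
have -> : n.+1%:R ^- 2 = n.+1%:R^-1 * n.+1%:R^-1 :> R by rewrite expr2 invfM.
rewrite /harmonic => h2; apply: le_trans (lerD (ler_wpM2l _ h1) h2) _ => //; lra.
Qed.

End AlmostSure.

(** * Null sets and the support of a law *)

Section NullSetIntegral.
Context {d} {T : measurableType d} {R : realType}.
Variable mu : {measure set T -> \bar R}.
Import HBNNSimple.

Let ge0_integral_null_le (N : set T) (f g : T -> \bar R) : measurable N -> mu N = 0%E ->
  (forall x, (0 <= f x)%E) -> (forall x, (0 <= g x)%E) ->
  (forall x, ~ N x -> f x = g x) -> (\int[mu]_x f x <= \int[mu]_x g x)%E.
Proof.
move=> mN N0 f0 g0 fg; rewrite !ge0_integralTE//; apply: ge_ereal_sup => _ [h hf <-].
have mNc : measurable (~` N) by exact: measurableC.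
pose h' := proj_nnsfun h mNc.
apply: ereal_sup_ubound; exists h'.
  move=> x; rewrite /= mindicE; have [xN|xN] := boolP (x \in ~` N).
    by rewrite mulr1 -fg ?hf//; rewrite inE in xN.
  by rewrite mulr0.
rewrite -!integralT_nnsfun; apply: ae_eq_integral => //.
- by apply/measurable_EFinP.
- by apply/measurable_EFinP.
exists N; split=> // x /= /not_implyP[_]; apply: contra_notP => nN.
by congr EFin; rewrite /= mindicE mem_set ?mulr1.
Qed.

(** No measurability of f or g is assumed: the integral of a nonnegative function
    is a supremum over simple functions below it, and these can be cut off on
    the null set. *)
Lemma integral_null_eq (N : set T) (f g : T -> \bar R) : measurable N -> mu N = 0%E ->
  (forall x, ~ N x -> f x = g x) -> (\int[mu]_x f x = \int[mu]_x g x)%E.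
Proof.
move=> mN N0 fg.
have e (f' g' : T -> \bar R) : (forall x, (0 <= f' x)%E) -> (forall x, (0 <= g' x)%E) ->
    (forall x, ~ N x -> f' x = g' x) -> (\int[mu]_x f' x = \int[mu]_x g' x)%E.
  move=> f0 g0 fg'; apply/eqP; rewrite eq_le.
  by rewrite !(ge0_integral_null_le mN N0)// => x /fg'.
rewrite integralE [RHS]integralE; congr (_ - _)%E; apply: e => // x Nx.
  by rewrite !funeposE fg.
by rewrite !funenegE fg.
Qed.

End NullSetIntegral.

Section BorelTypes.
Context {R : realType}.

Lemma open_preimage_measurable d (T : measurableType d) (f : T -> R) :
  (forall U, open U -> measurable (f @^-1` U)) -> measurable_fun setT f.
Proof.
move=> cf; apply: (measurability _ (RGenOInfty.measurableE R)) => //.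
move=> /= _ [_ [a ->] <-]; rewrite setTI; apply: cf; exact: interval_open.
Qed.

Variable n : nat.
Notation N := ('rV[R]_n * R)%type.

Let center (i : 'rV[rat]_n * rat * nat) : N := (map_mx ratr i.1.1, ratr i.1.2).
Let rball (i : 'rV[rat]_n * rat * nat) : set N := ball (center i) i.2.+1%:R^-1.

Let rball_basis (U : set N) x : open U -> U x -> exists2 i, rball i x & rball i `<=` U.
Proof.
move=> oU Ux.
have /nbhs_ballP[e /= e0 eU] : nbhs x U by exact: open_nbhs_nbhs.
have [k ke] : exists k : nat, k.+1%:R^-1 < e / 2.
  have e2 : 0 < e / 2 by rewrite divr_gt0.
  by have [k _ /(_ k (leqnn k))] := near_infty_natSinv_lt (PosNum e2); exists k.
have k0 : 0 < k.+1%:R^-1 :> R by rewrite invr_gt0.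
have rapp (y : R) : exists q : rat, `|ratr q - y| < k.+1%:R^-1.
  have h : y - k.+1%:R^-1 < y + k.+1%:R^-1 by rewrite ltrBlDr -addrA ltrDl addr_gt0.
  have [q hq] := rat_in_itvoo h.
  by exists q; move: hq; rewrite in_itv/= ltr_distl.
have /choice[q qP] : forall j : 'I_n, exists q : rat, `|ratr q - x.1 0 j| < k.+1%:R^-1.
  by move=> j; exact: rapp.
have [r rP] := rapp x.2.
have cx : ball (center (\row_j q j, r, k)) k.+1%:R^-1 x.
  split; last exact: rP.
  split=> // i j; rewrite ord1 /center /= !mxE; exact: qP.
exists (\row_j q j, r, k) => // y hy; apply: eU.
apply: (@le_ball _ _ x (k.+1%:R^-1 + k.+1%:R^-1)); first by rewrite [e]splitr lerD// ltW.
exact: ball_triangle (ball_sym cx) hy.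
Qed.

Variable rho : probability (borelType N) R.

Lemma law_support_closed : open (~` law_support rho).
Proof.
rewrite openE => x /= /existsNP[U /not_implyP[oU /not_implyP[Ux Ur]]].
rewrite /interior; apply/nbhs_ballP.
have /nbhs_ballP[e e0 eU] : nbhs x U by exact: open_nbhs_nbhs.
exists e => // y /eU Uy /(_ U oU Uy).
exact: Ur.
Qed.

Lemma law_support_measurable : measurable (law_support rho : set (borelType N)).
Proof.
rewrite -[law_support rho]setCK; apply: measurableC; apply: sub_sigma_algebra.
exact: law_support_closed.
Qed.

(** Lindelof's argument: a point outside the support lies in a null ball with
    rational center and radius 1/(k+1), and there are countably many of them. *)
Lemma law_support_null : rho (~` law_support rho) = 0%E.
Proof.
have mball i : measurable (rball i : set (borelType N)).
  by apply: sub_sigma_algebra; exact: ball_open.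
pose F k : set (borelType N) := if unpickle k is Some i then
  (if rho (rball i) == 0%E then rball i else set0) else set0.
have mF k : measurable (F k).
  by rewrite /F; case: unpickle => // i; case: ifP.
have F0 k : rho (F k) = 0%E.
  rewrite /F; case: unpickle => [i|]; last exact: measure0.
  by case: ifP => [/eqP//|_]; exact: measure0.
have sF : ~` law_support rho `<=` \bigcup_k F k.
  move=> x /= /existsNP[U /not_implyP[oU /not_implyP[Ux Ur]]].
  have [i ix iU] := rball_basis oU Ux.
  exists (pickle i) => //; rewrite /F pickleK ifT//.
  have mU : measurable (U : set (borelType N)) by exact: sub_sigma_algebra.
  have rU : rho U = 0%E.
    by apply/eqP; rewrite eq_le measure_ge0 andbT leNgt; apply/negP.
  have h : (rho (rball i) <= rho U)%E.
    by apply: le_measure => //; exact: mem_set.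
  by rewrite rU in h; rewrite eq_le h measure_ge0.
have nU : rho.-negligible (\bigcup_k F k).
  by apply: negligible_bigcup => k; exists (F k); split => //; exact: F0.
apply/eqP; rewrite eq_le measure_ge0 andbT.
have mU : measurable (\bigcup_k F k) by exact: bigcupT_measurable.
have := le_measure rho (mem_set (measurableC law_support_measurable)) (mem_set mU) sF.
by move/le_trans; apply; move/negligibleP : nU => /(_ mU) ->.
Qed.

End BorelTypes.

(** * Derivatives of ridge functions *)

Section RidgeDerivatives.
Context {R : realType} {n : nat}.
Variables (sigma : R -> R) (p : nat) (Omega : set 'rV[R]_n) (theta : 'rV[R]_n * R).
Hypothesis oOmega : open Omega.
Hypothesis dsigma : forall k x, (k < p)%N -> Omega x ->
  derivable (derive1n k sigma) (affine theta x) 1.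

Lemma affine_shift (i : 'I_n) (h : R) (x : 'rV[R]_n) :
  affine theta (h *: delta_mx 0 i + x) = h * theta.1 0 i + affine theta x.
Proof.
rewrite /affine addrA; congr (_ + _).
rewrite (bigD1 i)//= [in RHS](bigD1 i)//= !mxE !eqxx addrA; congr (_ + _).
  by rewrite mulr1n mulr1; ring.
by apply: eq_bigr => j ji; rewrite !mxE (negbTE ji) andbF mulr0 add0r.
Qed.

Let partial_step i k (c : R) (f : 'rV[R]_n -> R) : (k < p)%N ->
  (forall x, Omega x -> f x = c * derive1n k sigma (affine theta x)) ->
  forall x, Omega x ->
    partial i f x = theta.1 0 i * c * derive1n k.+1 sigma (affine theta x).
Proof.
move=> kp fE x Ox; rewrite /partial.
set g := derive1n k sigma in fE; set t := affine theta x.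
rewrite (@near_eq_derive _ _ _ _ (fun x => c * g (affine theta x))); last first.
  have : nbhs x Omega by exact: open_nbhs_nbhs.
  by apply: filterS => y Oy; exact: fE.
pose l (h : R) := h * theta.1 0 i + t.
have -> : 'D_(delta_mx 0 i) (fun x => c * g (affine theta x)) x =
    'D_1 ((fun y => c * g y) \o l) 0.
  rewrite /derive; set F := fun h : R => _; set F' := fun h : R => _.
  suff -> : F = F' by []; apply/funext => h; rewrite /F /F' /=.
  by rewrite /l !addr0 mul0r add0r [h%:A]mulr1 affine_shift.
have dg : derivable g t 1 by exact: dsigma.
have dli : derivable ((fun h : R => h) * cst (theta.1 0 i)) (0 : R) 1.
  by apply: derivableM; [exact: derivable_id|exact: derivable_cst].
have lE : l = (fun h : R => h) * cst (theta.1 0 i) + cst t by [].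
have dl : derivable l 0 1 by rewrite lE; apply: derivableD.
have l0 : l 0 = t by rewrite /l mul0r add0r.
have cgE : (fun y => c * g y) = cst c * g by [].
have dcg : derivable (fun y => c * g y) (l 0) 1.
  by rewrite l0 cgE; apply: derivableM => //; exact: derivable_cst.
rewrite -derive1E derive1_comp//.
have -> : (fun y => c * g y)^`()%classic (l 0) = c * derive1 g t.
  rewrite l0 derive1E cgE deriveM; [|exact: derivable_cst|exact: dg].
  by rewrite derive_cst scaler0 addr0 -derive1E.
have -> : l^`()%classic 0 = theta.1 0 i.
  rewrite derive1E lE deriveD; [|exact: dli|exact: derivable_cst].
  rewrite derive_cst addr0 deriveM; [|exact: derivable_id|exact: derivable_cst].
  by rewrite derive_cst scaler0 add0r derive_id [_%:A]mulr1.
by rewrite mulrC mulrA.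
Qed.

(** By the chain rule each derivative along a coordinate i of the ridge function
    of sigma^(k) is w_i times the ridge function of sigma^(k+1). *)
Lemma mpartial_feature (q : nat) (alpha : {ffun 'I_n -> 'I_q.+1}) :
  (\sum_i alpha i <= p)%N -> forall x, Omega x ->
  mpartial alpha (feature sigma theta) x =
    \prod_i theta.1 0 i ^+ alpha i * derive1n (\sum_i alpha i)%N sigma (affine theta x).
Proof.
suff gen (s : seq 'I_n) : (\sum_(i <- s) alpha i <= p)%N -> forall x, Omega x ->
    foldr (fun i f => iter (alpha i) (partial i) f) (feature sigma theta) s x =
    \prod_(i <- s) theta.1 0 i ^+ alpha i *
      derive1n (\sum_(i <- s) alpha i)%N sigma (affine theta x).
  by have := gen (enum 'I_n); rewrite !big_enum.
elim: s => [|i s IH] /= sp x Ox.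
  by rewrite !big_nil mul1r.
rewrite !big_cons in sp *.
set m := (\sum_(j <- s) _)%N in sp IH *; set c := \prod_(j <- s) _ in IH *.
have {}IH := IH (leq_trans (leq_addl _ _) sp).
set f := foldr _ _ _ in IH *.
suff gen a : (a + m <= p)%N -> forall x, Omega x ->
    iter a (partial i) f x = theta.1 0 i ^+ a * c * derive1n (a + m) sigma (affine theta x).
  exact: gen.
elim: a => [|a IHa] am y Oy /=; first by rewrite expr0 mul1r IH.
by rewrite (partial_step i am (IHa (ltnW am)) Oy) exprS mulrA.
Qed.

End RidgeDerivatives.

(** A substitute for the k-th derivative that is measurable without any
    differentiability: iterated limits of difference quotients with steps
    1/(m+1), the upper limit being used to have a value everywhere. *)
Fixpoint quotient_limit (R : realType) (sigma : R -> R) (k : nat) : R -> R :=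
  if k is k'.+1 then fun t => fine (limn_esup (fun m =>
    (m.+1%:R * (quotient_limit sigma k' (t + m.+1%:R^-1) - quotient_limit sigma k' t))%:E))
  else sigma.

Lemma quotient_limit_measurable (R : realType) (sigma : R -> R) k :
  measurable_fun setT sigma -> measurable_fun setT (quotient_limit sigma k).
Proof.
move=> ms; elim: k => //= k IH.
apply: (@measurableT_comp _ _ _ _ _ _ fine) => //.
apply: measurable_fun_limn_esup => m; apply/measurable_EFinP.
apply: measurable_funM => //; apply: measurable_funB => //.
apply: (measurableT_comp IH); exact: measurable_funD.
Qed.

(** In the interior of K the difference quotients only see points of K, where the
    previous derivative is known. *)
Lemma quotient_limitE (R : realType) (sigma : R -> R) p (K : set R) :
  (forall k t, (k < p)%N -> K t -> derivable (derive1n k sigma) t 1) ->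
  forall k t, (k <= p)%N -> K° t -> quotient_limit sigma k t = derive1n k sigma t.
Proof.
move=> dK; elim=> [//|k IH] t kp Kt.
have dt : derivable (derive1n k sigma) t 1 by apply: dK => //; exact: interior_subset.
set g := derive1n k sigma in dt IH *.
have hcv : (fun m => m.+1%:R * (g (t + m.+1%:R^-1) - g t)) @ \oo --> derive1 g t.
  have : (fun h : R => h^-1 *: (g (h + t) - g t)) @ 0^' --> derive1 g t.
    rewrite derive1E /derive; move: dt; rewrite /derivable.
    set F := fun h : R => _; set F' := fun h : R => _.
    by have -> : F = F' by apply/funext => h; rewrite /F /F' /= [h%:A]mulr1.
  move=> h1; have h2 : (fun m => m.+1%:R^-1 : R) @ \oo --> 0^'.
    move=> A A0; have h : \forall m \near \oo, (@harmonic R m != 0 -> A (harmonic m)) := @cvg_harmonic R _ A0.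
    apply: filterS h => m; apply; apply: lt0r_neq0; rewrite /harmonic /= invr_gt0//.
  have := cvg_comp _ _ h2 h1; apply: cvg_trans; apply: near_eq_cvg; near=> m.
  by rewrite /= invrK (addrC t).
have Kint : nbhs t (K°) by exact/nbhs_interior.
have tcv : (fun m => t + m.+1%:R^-1 : R) @ \oo --> t.
  by rewrite -[X in _ --> X]addr0; apply: cvgD; [exact: cvg_cst|exact: cvg_harmonic].
rewrite /=; set e := (X in limn_esup X).
have ecv : e @ \oo --> (derive1 g t)%:E.
  pose e' := EFin \o (fun m => m.+1%:R * (g (t + m.+1%:R^-1) - g t)).
  have e'cv : e' @ \oo --> (derive1 g t)%:E by apply: cvg_EFin => //; exact: nearW.
  apply: cvg_trans e'cv; apply: near_eq_cvg; near=> m.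
  rewrite /e /e' /=; congr (_ * (_ - _))%:E; apply/esym.
    rewrite IH//; first exact: ltnW.
    by near: m; exact: tcv.
  by rewrite IH// ltnW.
by rewrite is_cvg_limn_esupE; [rewrite (cvg_lim _ ecv)|apply/cvg_ex; eexists; exact: ecv].
Unshelve. all: by end_near. Qed.

(** * A jointly measurable version of the residual *)

Section RegularResidual.
Context {R : realType} {n : nat}.
Variables (Omega : set 'rV[R]_n) (mu : probability (x_space R n) R).
Variables (L : diffop R n) (sigma : R -> R) (rho : probability (theta_space R n) R).
Notation S := (law_support rho).
Notation p := (dop_order L).

(** The residual with its derivatives written as ridge functions of difference
    quotients.  Setting it to 0 outside the support of rho makes its bounds hold
    for every parameter. *)
Definition regular_residual (t : theta_space R n) (x : x_space R n) : R :=
  \1_S t * \sum_(alpha : {ffun 'I_n -> 'I_p.+1} | (\sum_i alpha i <= p)%N)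
    (dop_coef alpha \_ Omega) x *
    (\prod_i t.1 0 i ^+ alpha i * quotient_limit sigma (\sum_i alpha i) (affine t x)).

Hypothesis oOmega : open Omega.
Hypothesis bsigma : bounded_derivatives sigma p (affine_image Omega S).

Let K := affine_image Omega S.

Let inK (t : theta_space R n) x : S t -> Omega x -> K (affine t x).
Proof. by move=> St Ox; exists t, x; split=> //; exact: subset_closure. Qed.

(** Moving x along the coordinate i moves w.x + b at the speed w_i. *)
Let interiorK (t : theta_space R n) x i : S t -> Omega x -> t.1 0 i != 0 -> K° (affine t x).
Proof.
move=> St Ox ti0.
have /nbhs_ballP[e /= e0 eO] : nbhs x Omega by exact: open_nbhs_nbhs.
apply/nbhs_ballP; exists (e * `|t.1 0 i|); first by rewrite /= mulr_gt0// normr_gt0.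
move=> s; rewrite /ball /= => hs.
pose h := (s - affine t x) / t.1 0 i.
have -> : s = affine t (h *: delta_mx 0 i + x).
  by rewrite affine_shift /h mulfVK// subrK.
apply: inK => //; apply: eO; split=> // a j.
rewrite /ball /= !mxE opprD addrCA subrr addr0 normrN ord1 eqxx /= normrM.
have hh : `|h| < e by rewrite /h normrM normfV ltr_pdivrMr ?normr_gt0// distrC.
case: (j == i); rewrite ?normr1 ?mulr1// normr0 mulr0//.
Qed.

(** If the monomial w^alpha is nonzero and alpha is not 0, some w_i is nonzero and
    [interiorK] applies. *)
Let monomial_derivative (t : theta_space R n) x (alpha : {ffun 'I_n -> 'I_p.+1}) :
  (\sum_i alpha i <= p)%N -> S t -> Omega x ->
  \prod_i t.1 0 i ^+ alpha i * quotient_limit sigma (\sum_i alpha i) (affine t x) =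
  \prod_i t.1 0 i ^+ alpha i * derive1n (\sum_i alpha i)%N sigma (affine t x).
Proof.
move=> ap St Ox; have [->//|] := eqVneq (\sum_i alpha i)%N 0%N.
rewrite sum_nat_eq0 negb_forall => /existsP[i /= ai].
have [ti0|ti0] := eqVneq (t.1 0 i) 0.
  by rewrite (bigD1 i)//= ti0 expr0n (negbTE ai) !mul0r.
have [dsig _] := bsigma.
by rewrite (quotient_limitE dsig)//; exact: (interiorK St Ox ti0).
Qed.

Lemma regular_residualE (t : theta_space R n) : S t -> regular_residual t = residual Omega L sigma t.
Proof.
move=> St; apply/funext => x; rewrite /regular_residual indicE mem_set// mul1r.
rewrite /residual patchE; case: ifPn => [|] xO; last first.
  by apply: big1 => alpha _; rewrite patchE (negbTE xO) mul0r.
have Ox : Omega x by rewrite inE in xO.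
rewrite /dop_apply; apply: eq_bigr => alpha ap.
rewrite patchE xO monomial_derivative//; congr (_ * _).
have [dsig _] := bsigma.
by rewrite (mpartial_feature oOmega (p := p))// => k y kp Oy; apply: dsig => //; exact: inK.
Qed.

Hypothesis mcoef : measurable_coefficients L Omega.
Hypothesis msigma : measurable_fun setT sigma.

Let mOmega : measurable (Omega : set (x_space R n)).
Proof. exact: sub_sigma_algebra. Qed.

Let mcoefO (alpha : {ffun 'I_n -> 'I_p.+1}) : (\sum_i alpha i <= p)%N ->
  measurable_fun setT (dop_coef alpha \_ Omega : x_space R n -> R).
Proof. by move=> ap; apply/(measurable_restrictT _ mOmega); exact: mcoef. Qed.

Let mcoord i : measurable_fun setT (fun x : x_space R n => x 0 i).
Proof.
apply: open_preimage_measurable => U oU; apply: sub_sigma_algebra.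
by move: U oU; apply/continuousP; exact: coord_continuous.
Qed.

Let mweight i : measurable_fun setT (fun t : theta_space R n => t.1 0 i).
Proof.
apply: open_preimage_measurable => U oU; apply: sub_sigma_algebra.
move: U oU; apply/continuousP => t.
apply: (continuous_comp (f := @fst 'rV[R]_n R) (g := fun w : 'rV[R]_n => w 0 i)).
  exact: cvg_fst.
exact: coord_continuous.
Qed.

Let mbias : measurable_fun setT (fun t : theta_space R n => t.2).
Proof.
apply: open_preimage_measurable => U oU; apply: sub_sigma_algebra.
by move: U oU; apply/continuousP => t; exact: cvg_snd.
Qed.

Lemma regular_residual_measurable :
  measurable_fun setT (fun q : theta_space R n * x_space R n => regular_residual q.1 q.2).
Proof.
rewrite /regular_residual.
under eq_fun do rewrite big_mkcond.
apply: measurable_funM.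
  apply: (measurableT_comp (f := \1_S : theta_space R n -> R)) measurable_fst.
  by apply: measurable_indic; exact: law_support_measurable.
apply: measurable_sum => alpha.
have [ap|_] := leqP (\sum_i alpha i)%N p; last exact: measurable_cst.
apply: measurable_funM; first by apply: measurableT_comp measurable_snd; exact: mcoefO.
apply: measurable_funM.
  apply: measurable_prod => i _; apply: measurable_funX.
  exact: (measurableT_comp (mweight i) measurable_fst).
apply: (measurableT_comp (quotient_limit_measurable _ msigma)).
apply: measurable_funD; last exact: (measurableT_comp mbias measurable_fst).
apply: measurable_sum => i; apply: measurable_funM.
  exact: (measurableT_comp (mweight i) measurable_fst).
exact: (measurableT_comp (mcoord i) measurable_snd).
Qed.

Hypothesis bS : bounded_set S.

Let weight_bound : exists2 B : R, 0 <= B & forall (t : theta_space R n) i, S t -> `|t.1 0 i| <= B.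
Proof.
have [B B0 hB] := pinfty_ex_gt0 bS; exists B; first exact: ltW.
move=> t i St; apply: le_trans (hB t St).
rewrite [leRHS]prod_normE le_max; apply/orP; left.
rewrite [leRHS]mx_normrE; apply: (le_bigmax _ (fun ij => `|t.1 ij.1 ij.2|) (ord0, i)).
Qed.

Lemma regular_residual_bound : exists b : x_space R n -> R,
  forall t x, `|regular_residual t x| <= b x.
Proof.
have [B B0 hB] := weight_bound.
have [_ [C hC]] := bsigma.
exists (fun x => \sum_(alpha : {ffun 'I_n -> 'I_p.+1} | (\sum_i alpha i <= p)%N)
  `|(dop_coef alpha \_ Omega) x| * (\prod_i B ^+ alpha i * `|C|)).
move=> t x; rewrite /regular_residual.
have b0 (alpha : {ffun 'I_n -> 'I_p.+1}) : 0 <= \prod_i B ^+ alpha i * `|C|.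
  by rewrite mulr_ge0// prodr_ge0// => i _; rewrite exprn_ge0.
have [St|St] := pselect (S t); last first.
  rewrite indicE memNset// mul0r normr0; apply: sumr_ge0 => alpha _.
  by rewrite mulr_ge0.
rewrite indicE mem_set// mul1r; apply: le_trans (ler_norm_sum _ _ _) _.
apply: ler_sum => alpha ap; rewrite normrM.
have [Ox|Ox] := pselect (Omega x); last first.
  by rewrite patchE memNset// normr0 !mul0r.
rewrite ler_wpM2l// monomial_derivative// normrM ler_pM//.
  rewrite normr_prod; apply: ler_prod => i _.
  by rewrite normr_ge0 normrX lerXn2r ?nnegrE//; exact: hB.
by apply: le_trans (ler_norm C); apply: hC => //; exact: inK.
Qed.

Hypothesis Rz_fin : (sup_sqnorm mu (residual Omega L sigma) S < +oo)%E.
Notation Rz := (fine (sup_sqnorm mu (residual Omega L sigma) S)).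

Lemma regular_residualP : exists b, bounded_field mu regular_residual b Rz.
Proof.
have [b hb] := regular_residual_bound; exists b.
have mZ := regular_residual_measurable.
have mZt t : measurable_fun setT (regular_residual t).
  exact: (measurable_section1 (f := regular_residual) t mZ).
have Rz_ge t : S t -> (L2norm mu (regular_residual t) ^+ 2 <= Rz%:E)%E.
  move=> St; have h : (L2norm mu (regular_residual t) ^+ 2 <=
      sup_sqnorm mu (residual Omega L sigma) S)%E.
    by apply: ereal_sup_ubound; exists t => //; rewrite regular_residualE.
  have h0 : (0 <= L2norm mu (regular_residual t) ^+ 2)%E.
    by rewrite expe_ge0// Lnorm_ge0.
  by rewrite fineK// ge0_fin_numE// (le_trans h0).
have off t : ~ S t -> regular_residual t = fun=> 0.
  by move=> St; apply/funext => x; rewrite /regular_residual indicE memNset// mul0r.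
have ZL2 t : L2 mu (regular_residual t).
  have [St|St] := pselect (S t); last by rewrite off//; exact: L2_cst.
  rewrite /L2/= inE; apply/andP; split; rewrite inE//=.
  rewrite /finite_norm -/(L2norm _ _); move: (Rz_ge t St).
  have := Lnorm_ge0 mu 2%:E (EFin \o regular_residual t); rewrite -/(L2norm _ _).
  by case: (L2norm _ _) => //= r _; rewrite ltry.
split=> // t.
have [St|St] := pselect (S t).
  have := Rz_ge t St; rewrite L2normE// -EFin_expe lee_fin sqr_sqrtr//.
  exact: (ip_ge0 (semi_inner_hip mu) (toH (ZL2 t))).
have : S !=set0.
  apply: contrapT => /set0P/negP; rewrite negbK => /eqP S0.
  have := law_support_null rho; rewrite S0 setC0 probability_setT.
  by move=> /eqP; rewrite onee_eq0.
case=> s Ss; rewrite off//.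
rewrite (_ : L2inner _ _ _ = 0); last first.
  by rewrite /L2inner; under eq_Rintegral do rewrite mulr0; rewrite Rintegral_cst// mul0r.
have := le_trans _ (Rz_ge s Ss); rewrite -lee_fin; apply.
by rewrite expe_ge0// Lnorm_ge0.
Qed.

End RegularResidual.

(** * Concentration and convergence of the errors *)

Section OperatorExtensionality.
Context {d} {X : measurableType d} {R : realType}.
Variables (mu : {measure set X -> \bar R}) (A A' : (X -> R) -> X -> R).
Hypothesis AA' : forall v, L2 mu v -> A v = A' v.

Lemma eigenvalue_seq_ext tau : eigenvalue_seq mu A tau -> eigenvalue_seq mu A' tau.
Proof.
move=> [dec pos mult]; split=> // lam /mult[n [e [eL2 ee free spn]] cn].
exists n => //; exists e; split=> //; first by move=> i; rewrite -AA'.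
by move=> v hv; rewrite -AA'//; exact: spn.
Qed.

Lemma is_trace_ext t : is_trace mu A t -> is_trace mu A' t.
Proof.
move=> [B BP trB]; exists B => //; rewrite -trB; apply: eq_esum => e Be.
by have [BL2 _ _ _] := BP; rewrite AA'//; exact: BL2.
Qed.

End OperatorExtensionality.

Section SampledField.
Context {d1 d2} {Th : measurableType d1} {X : measurableType d2} {R : realType}.
Variables (rho : probability Th R) (mu : probability X R).
Variables (Z : Th -> X -> R) (b : X -> R) (C : R).
Hypothesis ZP : bounded_field mu Z b C.
Variables (S : set Th) (Omega : set X) (zeta : Th -> X -> R).
Hypotheses (mS : measurable S) (S0 : rho (~` S) = 0%E).
Hypothesis zetaE : forall t, S t -> Z t = zeta t.
Hypothesis zeta0 : forall t x, ~ Omega x -> zeta t x = 0.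

Notation T := (integral_operator mu Omega (mean_kernel zeta rho)).
Let hP := semi_inner_hip mu.

Lemma mean_kernelE x x' :
  mean_kernel zeta rho x x' = field_mean rho (fun t x' => Z t x * Z t x') x'.
Proof.
rewrite /mean_kernel unlock /field_mean /Rintegral; congr fine.
apply: (integral_null_eq (measurableC mS) S0) => t /contrapT St /=.
by rewrite zetaE.
Qed.

(** The kernel vanishes for x' outside Omega, so that the integral over Omega is
    the integral over the whole space. *)
Lemma integral_operatorE v : L2 mu v -> T v = field_op rho mu Z v.
Proof.
move=> hv; apply/funext => x; rewrite -(field_op_kernel rho ZP)//.
rewrite /integral_operator Rintegral_mkcond; apply: eq_Rintegral => x' _.
rewrite patchE -mean_kernelE; case: ifPn => // /negP; rewrite inE => Ox'.
rewrite /mean_kernel unlock integral0_eq ?mul0r// => t _ /=.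
by rewrite (zeta0 t Ox') mulr0.
Qed.

(** Cauchy-Schwarz in L^2(rho) bounds |Tv|^4 by <Tv, v> <T Tv, Tv>. *)
Lemma field_op_form0 : (forall v, L2 mu v -> L2inner mu (field_op rho mu Z v) v <= 0) ->
  forall v, L2 mu v -> field_op rho mu Z v = (fun=> 0) %[ae mu].
Proof.
move=> q0 v hv; have hTv := field_op_L2 rho ZP hv.
apply: (L2inner0_ae hTv).
have iL2 u : L2 mu u -> L2 rho (fun t => L2inner mu (Z t) u).
  move=> hu; apply: L2I; first exact: (measurable_field_inner ZP hu).
  exact: (rintegrable_inner_sqr rho ZP hu).
have : L2inner mu (field_op rho mu Z v) (field_op rho mu Z v) ^+ 2 <=
    L2inner mu (field_op rho mu Z v) v *
    L2inner mu (field_op rho mu Z (field_op rho mu Z v)) (field_op rho mu Z v).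
  rewrite !(field_op_inner rho ZP)//; exact: (L2inner_cs (iL2 _ hv) (iL2 _ hTv)).
rewrite [X in _ <= X * _](_ : _ = 0); last first.
  apply/eqP; rewrite eq_le q0//=.
  by rewrite (field_op_form rho ZP hv); apply: Rintegral_ge0 => t _; exact: sqr_ge0.
by rewrite mul0r => a0; apply/eqP; rewrite -sqrf_eq0 eq_le a0 sqr_ge0.
Qed.

Lemma field_op_form_le_mean v : L2 mu v -> L2inner mu (field_op rho mu Z v) v <=
  (\int[rho]_t L2inner mu (Z t) (Z t)) * L2inner mu v v.
Proof.
move=> hv; have [iZ _ _] := field_sqr_fubini rho ZP.
rewrite (field_op_form rho ZP hv) -RintegralZr//; apply: le_Rintegral => //.
- exact: (rintegrable_inner_sqr rho ZP hv).
- have := rintegrableZl (L2inner mu v v) iZ.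
  by apply: eq_integrable => // t _ /=; rewrite mulrC.
- by move=> t _; exact: (L2inner_cs (field_L2 ZP t) hv).
Qed.

Section Errors.
Variables (th : nat -> Th) (M : nat).
Hypotheses (M0 : (0 < M)%N) (thS : forall m, S (th m)).
Notation D := (sample_error rho mu Z th M).

Let tensor_sumE v x :
  M%:R^-1 * tensor_sum mu zeta th M v x = M%:R^-1 * \sum_(m < M) L2inner mu (Z (th m)) v * Z (th m) x.
Proof. by congr (_ * _); apply: eq_bigr => m _; rewrite /tensor zetaE. Qed.

Lemma operator_error_le : (operator_error mu zeta T th M <= (Num.sqrt D)%:E)%E.
Proof.
apply: ge_ereal_sup => _ [v [hv v1] <-].
have -> : (fun x => M%:R^-1 * tensor_sum mu zeta th M v x - T v x) =
    sample_diff rho mu Z th M v.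
  by apply/funext => x; rewrite tensor_sumE integral_operatorE.
have D0 := sample_error_ge0 rho ZP th M.
rewrite (L2normE (sample_diff_L2 rho ZP th M hv)) lee_fin ler_sqrt//.
apply: le_trans (sample_diff_le rho ZP th M0 hv) _.
rewrite -[leRHS]mulr1 ler_wpM2l//.
have vv := ip_ge0 hP (toH hv); rewrite /hip /= in vv.
by move: v1; rewrite (L2normE hv) lee_fin -[leRHS]sqrtr1 ler_sqrt// ltr01.
Qed.

(** The forms of S_M / M and T differ by <A_M v, v>, at most sqrt(D_M) |v|^2, and
    Weyl's inequality is applied in both directions. *)
Lemma spectral_error_le B tau : hilbert_basis mu B -> eigenvalue_seq mu T tau ->
  (spectral_error mu zeta tau th M <= (Num.sqrt D)%:E)%E.
Proof.
move=> BP /(eigenvalue_seq_ext integral_operatorE) tauT.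
have [f2 dT] := field_op_diagonalizes ZP BP tauT.
pose z (m : 'I_M) := toH (field_L2 ZP (th m)).
have M1 : 0 < M%:R^-1 :> R by rewrite invr_gt0 ltr0n.
have [f1 dG] := gram_diagonalizes hP z M1.
have D0 := sample_error_ge0 rho ZP th M.
have key (v : Hspace mu) : `|M%:R^-1 * \sum_m hip (z m) v ^+ 2 - hip (field_opH rho ZP v) v| <=
    Num.sqrt D * hip v v.
  have hv := HL2 v; have hA := sample_diff_L2 rho ZP th M hv.
  have -> : M%:R^-1 * \sum_m hip (z m) v ^+ 2 - hip (field_opH rho ZP v) v = hip (toH hA) v.
    have -> : hip (toH hA) v = hip (M%:R^-1 *: \sum_m hip (z m) v *: z m - field_opH rho ZP v) v.
      apply: eq_Rintegral => x _; congr (_ * _).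
      have sE := sum_hE (fun m : 'I_M => hip (z m) v) z xpredT.
      rewrite /= /sample_diff; congr (_ * _ - _); by rewrite sE.
    rewrite (ipBl hP) (ipZl hP) (ip_suml hP); congr (_ * _ - _).
    by apply: eq_bigr => m _; rewrite (ipZl hP) expr2.
  have vv := ip_ge0 hP v.
  rewrite -ler_sqr ?nnegrE ?mulr_ge0// -normrX ger0_norm ?sqr_ge0//.
  apply: le_trans (cauchy_schwarz hP _ _) _.
  rewrite exprMn sqr_sqrtr// expr2 mulrA ler_wpM2r//.
  exact: (sample_diff_le rho ZP th M0 hv).
have gE : gram mu zeta th M = \matrix_(m, l) hip (z m) (z l).
  by apply/matrixP => m l; rewrite !mxE -!zetaE.
apply: ge_ereal_sup => _ [j _ <-]; rewrite lee_fin gE [X in X - _]mulrC.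
rewrite ler_distl; apply/andP; split.
  rewrite lerBlDr; apply: (weyl hP dT dG) => // v.
  by have := key v; rewrite ler_distlC => /andP[_].
apply: (weyl hP dG dT) => // v.
by have := key v; rewrite ler_distl => /andP[_].
Qed.

End Errors.

Section Concentration.
Context {dW : measure_display} {W : measurableType dW}.
Variables (P : probability W R) (theta : nat -> {RV P >-> Th}).
Hypothesis iid : iid_with_law theta rho.
Notation D M w := (sample_error rho mu Z (theta^~ w) M).

Let inS := [set w | forall m, S (theta m w)].

Let minS : measurable inS.
Proof.
rewrite (_ : inS = \bigcap_m (theta m @^-1` S)).
  by apply: bigcapT_measurable => m; rewrite -[_ @^-1` _]setTI; exact: measurable_funP.
by apply/seteqP; split=> [w h m _|w h m]; [exact: h|exact: (h m I)].
Qed.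

Let outS : P (~` inS) = 0%E.
Proof.
have [_ law] := iid.
have mm m : measurable (theta m @^-1` (~` S)).
  by rewrite -[_ @^-1` _]setTI; apply: measurable_funP => //; exact: measurableC.
have nU : P.-negligible (\bigcup_m (theta m @^-1` (~` S))).
  apply: negligible_bigcup => m; exists (theta m @^-1` (~` S)); split=> //.
  by have := law m _ (measurableC mS); rewrite S0.
apply/negligibleP; first exact: measurableC.
apply: negligibleS nU => w /= /existsNP[m hm]; by exists m.
Qed.

(** The mean square sampling error is at most C E|Z|^2 / M, and the operator
    norm is controlled by it through Markov's inequality. *)
Lemma sample_error_markov (delta eta : R) M : (0 < M)%N -> 0 < eta ->
  C * (\int[rho]_t L2inner mu (Z t) (Z t)) <= M%:R * (delta * eta) ->
  exists E : set W, [/\ measurable E, ((1 - delta)%:E <= P E)%E &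
    forall w, E w -> D M w <= eta /\ forall m, S (theta m w)].
Proof.
move=> M0 eta0 hM.
have mD := sample_error_rv theta rho ZP M.
have D0 w : 0 <= D M w := sample_error_ge0 rho ZP (theta^~ w) M.
pose bad := [set w | (eta%:E <= `|(D M w)%:E|)%E].
have mbad : measurable bad.
  rewrite /bad -[X in measurable X]setTI.
  apply: emeasurable_fun_c_infty => //; apply: measurableT_comp => //.
  exact/measurable_EFinP.
have Pbad : (P bad <= delta%:E)%E.
  have mE : measurable_fun setT (EFin \o (fun w => D M w)) by exact/measurable_EFinP.
  have := le_integral_abse P measurableT mE eta0; rewrite setTI -/bad.
  rewrite (_ : (\int[P]_x `|(EFin \o (fun w => D M w)) x|)%E = (\int[P]_w D M w)%:E); last first.
    rewrite -rintegrable_EFin; last exact: (sample_error_integrable theta rho ZP M).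
    by apply: eq_integral => w _ /=; rewrite ger0_norm.
  rewrite -lee_pdivlMl// => /le_trans; apply; rewrite -EFinM lee_fin.
  rewrite ler_pdivrMl//; apply: le_trans (sample_error_mean iid ZP M0) _.
  rewrite ler_pdivrMr ?ltr0n//; apply: le_trans hM _.
  by rewrite le_eqVlt; apply/orP; left; apply/eqP; ring.
exists (~` bad `&` inS); split.
- by apply: measurableI => //; exact: measurableC.
- rewrite -[_ `&` _]setCK probability_setC; last first.
    by apply/measurableC/measurableI => //; exact: measurableC.
  rewrite EFinB; apply: leeB => //; rewrite setCI setCK.
  apply: le_trans (measureU2 P mbad (measurableC minS)) _.
  by rewrite [X in (_ + X)%E]outS adde0.
- move=> w [/= hb hS]; split=> //; rewrite leNgt; apply/negP => h; apply: hb.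
  by rewrite /bad /= lee_fin ger0_norm// ltW.
Qed.

Lemma ae_inS : {ae P, forall w, forall m, S (theta m w)}.
Proof. by exists (~` inS); split=> //; exact: measurableC. Qed.

Variables (tau : nat -> R) (trT : R).
Hypothesis Tneq0 : ~ (forall v, L2 mu v -> T v = (fun=> 0) %[ae mu]).
Hypothesis tauT : eigenvalue_seq mu T tau.
Hypothesis trTP : is_trace mu T trT.

Let mean_sq := \int[rho]_t L2inner mu (Z t) (Z t).

Let form_pos : exists2 v : Hspace mu, 0 < hip (field_opH rho ZP v) v & 0 <= hip v v.
Proof.
apply: contrapT => h; apply: Tneq0 => v hv; rewrite integral_operatorE//.
apply: field_op_form0 hv => u hu; rewrite leNgt; apply/negP => qu; apply: h.
by exists (toH hu) => //; exact: ip_ge0 hP _.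
Qed.

Lemma mean_sq_gt0 : 0 < mean_sq.
Proof.
have [v qv vv] := form_pos; rewrite ltNge; apply/negP => m0.
have := lt_le_trans qv (field_op_form_le_mean (HL2 v)).
by rewrite ltNge mulr_le0_ge0.
Qed.

Lemma mean_sq_le_trace : mean_sq <= trT.
Proof.
have [B BP trB] := is_trace_ext integral_operatorE trTP.
exact: (trace_bound ZP BP trB).
Qed.

(** Otherwise the form of T, at most tau_1 |v|^2, would vanish, and so would T. *)
Lemma top_eigenvalue_gt0 : 0 < tau 0%N.
Proof.
have [B BP _] := trTP; have [v qv vv] := form_pos.
have [f [_ _ _ tail]] := field_op_diagonalizes ZP BP (eigenvalue_seq_ext integral_operatorE tauT).
rewrite ltNge; apply/negP => t0.
have : hip (field_opH rho ZP v) v <= tau 0%N * hip v v by apply: tail.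
by move=> /(lt_le_trans qv); rewrite ltNge mulr_le0_ge0.
Qed.

Lemma error_concentration (eps delta : R) M : 0 < eps -> 0 < delta ->
  C * trT <= M%:R * (delta * (eps * tau 0%N) ^+ 2) ->
  exists E : set W, [/\ measurable E, ((1 - delta)%:E <= P E)%E &
    forall w, E w ->
      (operator_error mu zeta T (theta^~ w) M <= (eps * tau 0%N)%:E)%E /\
      (spectral_error mu zeta tau (theta^~ w) M <= (eps * tau 0%N)%:E)%E].
Proof.
move=> eps0 delta0 hM.
have C0 : 0 < C := lt_le_trans mean_sq_gt0 (field_sqnorm_mean rho ZP).
have trT0 : 0 < trT := lt_le_trans mean_sq_gt0 mean_sq_le_trace.
have M0 : (0 < M)%N.
  rewrite lt0n; apply/eqP => M0; move: hM; rewrite M0 mul0r leNgt => /negP; apply.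
  exact: mulr_gt0.
have et0 : 0 < eps * tau 0%N by rewrite mulr_gt0// top_eigenvalue_gt0.
have et2 : 0 < (eps * tau 0%N) ^+ 2 by rewrite exprn_gt0.
have [|E [mE PE hE]] := @sample_error_markov delta _ M M0 et2.
  by apply: le_trans hM; rewrite ler_wpM2l ?(ltW C0)// mean_sq_le_trace.
exists E; split=> // w /hE[hD hS].
have sD : ((Num.sqrt (D M w))%:E <= (eps * tau 0%N)%:E)%E.
  by rewrite lee_fin -[leRHS]ger0_norm ?(ltW et0)// -sqrtr_sqr ler_sqrt// ltW.
have [B BP _] := trTP.
split; first exact: (le_trans (operator_error_le M0 hS) sD).
exact: (le_trans (spectral_error_le M0 hS BP tauT) sD).
Qed.

Let error_cvg0 (err : W -> nat -> \bar R) : (forall w M, (0 <= err w M)%E) ->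
  (forall w M, (0 < M)%N -> (forall m, S (theta m w)) ->
    (err w M <= (Num.sqrt (D M w))%:E)%E) ->
  {ae P, forall w, err w M @[M --> \oo] --> 0%E}.
Proof.
move=> err0 errD.
apply: filterS2 ae_inS (sample_error_cvg0 iid ZP) => w hS hD.
have h : (fun M => (Num.sqrt (D M w))%:E) @ \oo --> 0%E.
  apply: cvg_EFin; first exact: nearW.
  rewrite -sqrtr0; apply: cvg_comp hD _; exact: sqrt_continuous.
apply: (squeeze_cvge _ (cvg_cst 0%E) h).
by exists 1%N => // M /= M0; rewrite err0 errD.
Qed.

Lemma operator_error_cvg0 :
  {ae P, forall w, operator_error mu zeta T (theta^~ w) M @[M --> \oo] --> 0%E}.
Proof.
apply: error_cvg0 => w M; last by move=> M0 hS; exact: operator_error_le.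
apply: (@le_trans _ _ (L2norm mu (fun x => M%:R^-1 *
    tensor_sum mu zeta (theta^~ w) M (fun=> 0) x - T (fun=> 0) x))); first exact: Lnorm_ge0.
apply: ereal_sup_ubound.
exists (fun=> 0) => //; split; first exact: L2_cst.
rewrite (L2normE (L2_cst mu 0)) lee_fin (_ : L2inner _ _ _ = 0) ?sqrtr0//.
by rewrite /L2inner; under eq_Rintegral do rewrite mulr0; rewrite Rintegral_cst// mul0r.
Qed.

Lemma spectral_error_cvg0 :
  {ae P, forall w, spectral_error mu zeta tau (theta^~ w) M @[M --> \oo] --> 0%E}.
Proof.
have [B BP _] := trTP.
apply: error_cvg0 => w M; last by move=> M0 hS; exact: (spectral_error_le M0 hS BP tauT).
apply: (@le_trans _ _ `|eigenvalue_nth (gram mu zeta (theta^~ w) M) 0 / M%:R - tau 0%N|%:E).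
  by rewrite lee_fin.
by apply: ereal_sup_ubound; exists 0%N.
Qed.

End Concentration.

End SampledField.

Theorem theorem2 (R : realType) (d : nat) (d_gt0 : (0 < d)%N)
  (Omega : set 'rV[R]_d) (mu : probability (x_space R d) R)
  (L : diffop R d) (sigma : R -> R)
  (rho : probability (theta_space R d) R)
  (dW : measure_display) (W : measurableType dW) (P : probability W R)
  (theta : nat -> {RV P >-> theta_space R d})
  (tau : nat -> R) (trT : R) :
  let zeta := residual Omega L sigma in
  let Rz := sup_sqnorm mu zeta (law_support rho) in
  let T := integral_operator mu Omega (mean_kernel zeta rho) in
  let dtilde := trT / tau 0%N in
  let th w m := theta m w in
  bounded_domain Omega ->
  mu Omega = 1%E ->
  measurable_coefficients L Omega ->
  measurable_fun setT sigma ->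
  bounded_set (law_support rho) ->
  bounded_derivatives sigma (dop_order L) (affine_image Omega (law_support rho)) ->
  (Rz < +oo)%E ->
  ~ (forall v, L2 mu v -> T v = (fun=> 0) %[ae mu]) ->
  eigenvalue_seq mu T tau ->
  is_trace mu T trT ->
  iid_with_law theta rho ->
  [/\ forall (eps delta : R) (M : nat),
        0 < eps < 1 -> 0 < delta < 1 ->
        let bound := fine Rz * trT / (delta * eps ^+ 2 * tau 0%N ^+ 2) in
        bound = fine Rz * dtilde / (delta * eps ^+ 2 * tau 0%N) /\
        (bound <= M%:R ->
         exists E : set W,
           [/\ measurable E, ((1 - delta)%:E <= P E)%E &
               forall w, E w ->
                 (operator_error mu zeta T (th w) M <= (eps * tau 0%N)%:E)%E /\
                 (spectral_error mu zeta tau (th w) M <= (eps * tau 0%N)%:E)%E]),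
      {ae P, forall w, operator_error mu zeta T (th w) M @[M --> \oo] --> 0%E} &
      {ae P, forall w, spectral_error mu zeta tau (th w) M @[M --> \oo] --> 0%E}].
Proof.
move=> zeta Rz T dtilde th [oOmega _ _ _] _ mcoef msigma bS bsigma Rzfin Tneq0 tauT trTP iid.
have [b ZP] := regular_residualP oOmega bsigma mcoef msigma bS Rzfin.
have mS := law_support_measurable rho.
have S0 := law_support_null rho.
have zetaE := regular_residualE oOmega bsigma.
have zeta0 t x : ~ Omega x -> zeta t x = 0.
  by move=> Ox; rewrite /zeta /residual patchE memNset.
have tau0 := top_eigenvalue_gt0 ZP mS S0 zetaE zeta0 Tneq0 tauT trTP.
split.
- move=> eps delta M /andP[eps0 _] /andP[delta0 _] bound; split.
    by rewrite /bound /dtilde; field; rewrite !gt_eqF.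
  move=> hM; apply: (error_concentration ZP mS S0 zetaE zeta0 iid Tneq0 tauT trTP) => //.
  move: hM; rewrite /bound ler_pdivrMr; last by rewrite !mulr_gt0 ?exprn_gt0.
  by move=> /le_trans; apply; rewrite exprMn -[X in _ * X <= _]mulrA.
- exact: (operator_error_cvg0 ZP mS S0 zetaE zeta0 iid).
- exact: (spectral_error_cvg0 ZP mS S0 zetaE zeta0 iid tauT trTP).
Qed.
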